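(* Consider an $n\times n$ input-queued switch with mean arrival rate matrix $\boldsymbol\lambda=(1-\epsilon)\boldsymbol\nu$. Bursty MaxWeight and pipelined MaxWeight (each with parameter $m$, a positive integer) achieve state-space collapse (SSC), and so their heavy traffic behaviour is MaxWeight-like, i.e. under each of these algorithms $$\lim_{\epsilon\downarrow0}\epsilon\,\mathbb E\Big[\sum_{i,j}\bar q_{ij}\Big]=\Big(1-\frac1{2n}\Big)\|\tilde{\boldsymbol\sigma}\|^2 .$$
   Context: Switch model. Time slots are $t=0,1,2,\dots$. $\mathbf q(t)$ is the $n\times n$ queue length matrix, where $q_{ij}(t)$ is the number of packets to be transferred from input $i$ to output $j$; $\mathbf a(t)$ is the $n\times n$ matrix of numbers of arriving packets; the schedule $\mathbf s(t)$ is an element of the set $\mathcal X$ of $n\times n$ permutation matrices, picked in each slot by the scheduling algorithm. The evolution is $q_{ij}(t+1)=\max\{0,\,q_{ij}(t)+a_{ij}(t)-s_{ij}(t)\}$. $\langle\cdot,\cdot\rangle$ and $\|\cdot\|$ are the Frobenius inner product and norm. Let $\tilde{\mathcal H}_t=\{\mathbf q(0),\mathbf s(0),\mathbf q(1),\dots,\mathbf s(t-1),\mathbf q(t),\mathbf s(t)\}$ and let $\sigma(\tilde{\mathcal H}_t)$ be the $\sigma$-algebra it generates. Arrivals. (i) For each pair $(i,j)$, the $a_{ij}(t)$ are independent and identically distributed with respect to $t$; (ii) the arrival process is independent across pairs $(i,j)$; (iii) there exists $a_{\max}$ such that $a_{ij}(t)\le a_{\max}<\infty$ for all $i,j,t$;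 (iv) $\mathbb P(\mathbf a(t)=\mathbf 0)>0$. The mean is $\mathbb E[\mathbf a(t)]=\boldsymbol\lambda=(1-\epsilon)\boldsymbol\nu$ for some $\epsilon\in(0,1)$ (the heavy traffic parameter) and some doubly stochastic matrix $\boldsymbol\nu$ with $\nu_{\min}=\min_{ij}\nu_{ij}>0$. The entrywise variance $\boldsymbol\sigma^2=\mathrm{Var}(\mathbf a(t))$ satisfies $\boldsymbol\sigma^2\to\tilde{\boldsymbol\sigma}^2$ as $\epsilon\downarrow0$ for some $\tilde{\boldsymbol\sigma}^2$. The parameters of the arrival process may depend on $\epsilon$. Algorithms. The MaxWeight schedule for $\mathbf q$ is the schedule $\mathbf s\in\mathcal X$ with the highest weight $\langle\mathbf q,\mathbf s\rangle$. Bursty MaxWeight: evaluates the MaxWeight schedule after every $m$ time slots and then uses the same schedule consecutively for the next $m$ time slots. Pipelined MaxWeight: takes $m$ time slots to compute the MaxWeight schedule, so the MaxWeight schedule corresponding to $\mathbf q(t)$ is used in time slot $t+m$. Cone. $\mathcal S=\{\mathbf x\in\mathbb R^{n\times n}: x_{ij}=w_i+\tilde w_j \text{ for all } i,j, \text{ for some } w,\tilde w\in\mathbb R^n\}$, $\mathcal K=\mathcal S\cap\mathbb R_{+}^{n\times n}$ (the intersection with the positive orthant); $\mathbf x_{\|\mathcal K}$ is the projection of $\mathbf x$ onto $\mathcal K$ and $\mathbf x_{\perp\mathcal K}=\mathbf x-\mathbf x_{\|\mathcal K}$. Markov chain and stability. It is assumed that there is a process $X(t)$ associated with the switch that forms a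 Markov chain. Conditions: (A.1) $X(t)$ is $\sigma(\tilde{\mathcal H}_t)$-measurable, and it is irreducible and aperiodic (for irreducibility one may take the communicating class of $X(0)$ as the state space); (A.2) there is a function $g$ with $\mathbf q(t)=g(X(t))$ such that $g^{-1}(\mathcal A)$ is finite for every finite $\mathcal A\subset\mathbb Z^{n\times n}$. The switch is stable if $X(t)$ is positive recurrent; $\bar{\mathbf q}$ denotes the steady-state queue length matrix, i.e. the limit in distribution of $\mathbf q(t)$. SSC. A scheduling algorithm achieves SSC if the switch is stable, the corresponding Markov chain $X(t)$ satisfies A.1 and A.2, and there exists $\epsilon_0>0$ such that for $0<\epsilon\le\epsilon_0$, $\mathbb E[\|\bar{\mathbf q}_{\perp\mathcal K}\|^r]\le C_r$ for all $r\in\{1,2,\dots\}$, where $C_r$ is a constant independent of $\epsilon$.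
   Formalization: For bursty MaxWeight with m≥2 an aperiodic X(t) need not exist; here X(t) has period m, and SSC and the limit hold for the limit law of q(km+l) for every phase l<m. X(t) is irreducible on a closed class reached almost surely; q(0) and the first m pipelined schedules are fixed. *)

(* Defs.v *)
From HB Require Import structures.
From mathcomp Require Import all_boot all_order all_algebra all_fingroup.
From mathcomp Require Import all_classical all_reals all_analysis.

Set Implicit Arguments.
Unset Strict Implicit.
Unset Printing Implicit Defensive.

Import Order.TTheory GRing.Theory Num.Theory.
Import numFieldNormedType.Exports.

Local Open Scope classical_set_scope.
Local Open Scope ring_scope.

Definition frob_norm (R : realType) (n : nat) (x : 'M[R]_n) : R :=
  Num.sqrt (\sum_i \sum_j x i j ^+ 2).

Definition doubly_stochastic (R : realType) (n : nat) (nu : 'M[R]_n) : Prop :=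
  [/\ forall i j, 0 <= nu i j,
      forall i, \sum_j nu i j = 1
    & forall j, \sum_i nu i j = 1].

Definition space_S (R : realType) (n : nat) : set 'M[R]_n :=
  [set x | exists w w' : 'I_n -> R, forall i j, x i j = w i + w' j].

Definition cone_K (R : realType) (n : nat) : set 'M[R]_n :=
  @space_S R n `&` [set x | forall i j, 0 <= x i j].

(* The projection is the (unique, K being closed and convex) nearest point. *)
Definition proj_K (R : realType) (n : nat) (x : 'M[R]_n) : 'M[R]_n :=
  xget 0 [set y | @cone_K R n y /\
    forall z, @cone_K R n z -> frob_norm (x - y) <= frob_norm (x - z)].

Definition perp_K (R : realType) (n : nat) (x : 'M[R]_n) : 'M[R]_n :=
  x - proj_K x.

Definition realmx (R : realType) (n : nat) (q : 'M[nat]_n) : 'M[R]_n :=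
  map_mx (fun k : nat => k%:R) q.

(* Mutual independence of the classes of events [G i]: product rule over every
   finite subfamily of indices. *)
Definition independent_classes (R : realType) (d : measure_display)
    (T : measurableType d) (P : probability T R) (I : eqType)
    (G : I -> set (set T)) : Prop :=
  forall (J : seq I) (E : I -> set T), uniq J ->
    (forall i, i \in J -> G i (E i)) ->
    P [set w | forall i, i \in J -> E i w] = (\prod_(i <- J) P (E i))%E.

Definition sigma_seq (T V : Type) (X : nat -> T -> V) : set (set T) :=
  <<s [set E | exists t (B : set V), E = X t @^-1` B] >>.

Record arrival_process (R : realType) (n : nat) (d : measure_display)
    (T : measurableType d) (P : probability T R)
    (a : nat -> T -> 'M[nat]_n) (amax : nat) : Prop := ArrivalProcess {
  arrival_meas : forall t i j (B : set nat),
    measurable [set w | B (a t w i j)];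
  arrival_ident : forall t t' i j (B : set nat),
    P [set w | B (a t w i j)] = P [set w | B (a t' w i j)];
  arrival_indep_time : forall i j,
    independent_classes P
      (fun t : nat => [set E | exists B : set nat,
                                 E = [set w | B (a t w i j)]]);
  arrival_indep_pairs :
    independent_classes P
      (fun ij : 'I_n * 'I_n => sigma_seq (fun t w => a t w ij.1 ij.2));
  arrival_bounded : forall t w i j, (a t w i j <= amax)%N;
  arrival_zero : forall t, (0 < P [set w | forall i j, a t w i j = 0%N])%E
}.

Definition arrival_mean (R : realType) (n : nat) (d : measure_display)
    (T : measurableType d) (P : probability T R)
    (a : nat -> T -> 'M[nat]_n) (lambda : 'M[R]_n) : Prop :=
  forall t i j,
    ('E_P[(fun w => (a t w i j)%:R : R)] = (lambda i j)%:E)%E.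

(* The schedule [perm_mx s] is represented by the permutation [s].  All
   quantities are natural numbers and [subn] is truncated, so the right-hand
   side is max {0, q + a - s}. *)
Definition switch_evolution (n : nat) (T : Type)
    (a q : nat -> T -> 'M[nat]_n) (s : nat -> T -> 'S_n) : Prop :=
  forall t w i j,
    q t.+1 w i j
    = (q t w i j + a t w i j - (perm_mx (s t w) : 'M[nat]_n) i j)%N.

Definition weight (n : nat) (q : 'M[nat]_n) (s : 'S_n) : nat :=
  (\sum_i \sum_j q i j * (perm_mx s : 'M[nat]_n) i j)%N.

(* [mw] selects a MaxWeight schedule; ties are broken arbitrarily, but as a
   function of the queue lengths. *)
Definition maxweight_rule (n : nat) (mw : 'M[nat]_n -> 'S_n) : Prop :=
  forall q s, (weight q s <= weight q (mw q))%N.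

Definition deterministic (T V : Type) (X : T -> V) : Prop :=
  exists v, forall w, X w = v.

Definition bursty_maxweight (n : nat) (T : Type) (mw : 'M[nat]_n -> 'S_n)
    (m : nat) (q : nat -> T -> 'M[nat]_n) (s : nat -> T -> 'S_n) : Prop :=
  forall t w, s t w = mw (q (t %/ m * m)%N w).

(* The schedules of the first [m] slots, for which no MaxWeight computation is
   available yet, are arbitrary but fixed. *)
Definition pipelined_maxweight (n : nat) (T : Type) (mw : 'M[nat]_n -> 'S_n)
    (m : nat) (q : nat -> T -> 'M[nat]_n) (s : nat -> T -> 'S_n) : Prop :=
  (forall t w, s (t + m)%N w = mw (q t w)) /\
  (forall t, (t < m)%N -> deterministic (s t)).

Definition history (n : nat) (T : Type) (q : nat -> T -> 'M[nat]_n)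
    (s : nat -> T -> 'S_n) (t : nat) : set (set T) :=
  <<s [set E | exists k, (k <= t)%N /\
                 ((exists A : set 'M[nat]_n, E = q k @^-1` A) \/
                  (exists B : set 'S_n, E = s k @^-1` B))] >>.

Definition stochastic (R : realType) (S : countType) (p : S -> S -> R) : Prop :=
  (forall x y, 0 <= p x y) /\
  (forall x, (\esum_(y in [set: S]) (p x y)%:E = 1)%E).

Definition markov_chain (R : realType) (d : measure_display)
    (T : measurableType d) (P : probability T R) (S : countType)
    (X : nat -> T -> S) (p : S -> S -> R) : Prop :=
  stochastic p /\
  forall t (x : nat -> S),
    (P [set w | forall k, (k <= t.+1)%N -> X k w = x k]
     = P [set w | forall k, (k <= t)%N -> X k w = x k]
       * (p (x t) (x t.+1))%:E)%E.

Fixpoint step_prob (R : realType) (S : countType) (p : S -> S -> R)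
    (k : nat) (x y : S) : \bar R :=
  if k is k'.+1
  then (\esum_(z in [set: S]) (p x z)%:E * step_prob p k' z y)%E
  else ((x == y)%:R)%:E.

Definition accessible (R : realType) (S : countType) (p : S -> S -> R)
    (x y : S) : Prop :=
  exists k, (0 < step_prob p k x y)%E.

Definition closed_communicating_class (R : realType) (S : countType)
    (p : S -> S -> R) (C : set S) : Prop :=
  [/\ C !=set0,
      forall x y, C x -> C y -> accessible p x y
    & forall x y, C x -> accessible p x y -> C y].

(* The period of [x] is [c], i.e. [c] is the gcd of the possible return times;
   [x] is aperiodic when [c] = 1. *)
Definition has_period (R : realType) (S : countType) (p : S -> S -> R)
    (x : S) (c : nat) : Prop :=
  forall e : nat,
    (e %| c)%N <->
    (forall k, (0 < k)%N -> (0 < step_prob p k x x)%E -> (e %| k)%N).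

(* Probability, starting from [x], that the first visit to [y] at a positive
   time takes place at time [k.+1]. *)
Fixpoint first_visit (R : realType) (S : countType) (p : S -> S -> R)
    (y : S) (k : nat) (x : S) : \bar R :=
  if k is k'.+1
  then (\esum_(z in [set z | z != y]) (p x z)%:E * first_visit p y k' z)%E
  else (p x y)%:E.

Definition positive_recurrent (R : realType) (S : countType)
    (p : S -> S -> R) (y : S) : Prop :=
  ((\sum_(0 <= k <oo) first_visit p y k y = 1) /\
   (\sum_(0 <= k <oo) (k.+1%:R)%:E * first_visit p y k y < +oo))%E.

(* Besides positive recurrence, the chain [X] associated with the switch is
   required to be determined by the history, irreducible and of period [c], and
   to determine the queue lengths through [g], whose preimages of finite sets
   are finite.  The integer [c] is the period of the clock driving the
   algorithm, which computes schedules only at times multiple of [c].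

   - Irreducibility is up to restriction of the state space to a closed
     communicating class [C], which [X] reaches almost surely.  If X(0) lies
     in a closed communicating class then [C] is that class; the initial state
     may also be transient.
   - For [c] = 1 the period condition is aperiodicity.  For [c] > 1 the law of
     q(t) depends in general on t mod c, even for large t, so that no aperiodic
     chain determines q(t); requiring period [c] means that the chain is
     aperiodic when sampled every [c] slots. *)
Definition stable_switch (R : realType) (n : nat) (d : measure_display)
    (T : measurableType d) (P : probability T R)
    (q : nat -> T -> 'M[nat]_n) (s : nat -> T -> 'S_n) (c : nat) : Prop :=
  exists (S : countType) (X : nat -> T -> S) (p : S -> S -> R)
         (g : S -> 'M[nat]_n) (C : set S),
    [/\ markov_chain P X p,
        [/\ forall t (A : set S), history q s t (X t @^-1` A),
            closed_communicating_class p C,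
            (P [set w | exists t, C (X t w)] = 1)%E
          & forall x, C x -> has_period p x c],
        (forall t w, q t w = g (X t w)) /\
        (forall A : set 'M[nat]_n, finite_set A -> finite_set (g @^-1` A))
      & forall x, C x -> positive_recurrent p x].

Definition pmf_on (R : realType) (V : choiceType) (mu : V -> R) : Prop :=
  (forall v, 0 <= mu v) /\ (\esum_(v in [set: V]) (mu v)%:E = 1)%E.

(* Expectation of a nonnegative function under the law [mu]. *)
Definition law_mean (R : realType) (V : choiceType) (mu : V -> R)
    (f : V -> R) : \bar R :=
  (\esum_(v in [set: V]) (mu v * f v)%:E)%E.

(* In a discrete space every set is a continuity set. *)
Definition cvg_in_law (R : realType) (d : measure_display)
    (T : measurableType d) (P : probability T R) (V : choiceType)
    (X : nat -> T -> V) (mu : V -> R) : Prop :=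
  pmf_on mu /\
  forall A : set V,
    (fun t => P (X t @^-1` A)) @ \oo --> (\esum_(v in A) (mu v)%:E)%E.

(* [mu] is the law of the steady-state queue length matrix, as observed at
   phase [l] of a clock of period [c]; for [c] = 1 and [l] = 0 it is the limit
   in distribution of q(t). *)
Definition steady_state (R : realType) (n : nat) (d : measure_display)
    (T : measurableType d) (P : probability T R)
    (q : nat -> T -> 'M[nat]_n) (c l : nat) (mu : 'M[nat]_n -> R) : Prop :=
  cvg_in_law P (fun k => q (k * c + l)%N) mu.

Definition achieves_SSC (R : realType) (n : nat) (d : R -> measure_display)
    (T : forall e : R, measurableType (d e)) (P : forall e : R, probability (T e) R)
    (q : forall e, nat -> T e -> 'M[nat]_n)
    (s : forall e, nat -> T e -> 'S_n) (c : nat) : Prop :=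
  (forall e : R, 0 < e < 1 -> stable_switch (P e) (q e) (s e) c) /\
  exists (e0 : R) (Cst : nat -> R), 0 < e0 /\
    forall e : R, 0 < e < 1 -> e <= e0 ->
    forall l, (l < c)%N ->
    exists2 mu : 'M[nat]_n -> R, steady_state (P e) (q e) c l mu &
      forall r : nat, (0 < r)%N ->
        (law_mean mu (fun x => (frob_norm (perp_K (realmx R x)) ^+ r)%R)
         <= (Cst r)%:E)%E.

Definition heavy_traffic_limit (R : realType) (n : nat)
    (d : R -> measure_display) (T : forall e : R, measurableType (d e))
    (P : forall e : R, probability (T e) R)
    (q : forall e, nat -> T e -> 'M[nat]_n) (c : nat) (v : R) : Prop :=
  forall l, (l < c)%N ->
  exists2 mu : R -> 'M[nat]_n -> R,
    forall e : R, 0 < e < 1 -> steady_state (P e) (q e) c l (mu e) &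
    (fun e : R =>
       (e%:E * law_mean (mu e) (fun x => (\sum_i \sum_j realmx R x i j)%R))%E)
      @ 0^'+ --> v%:E.

(* Main.v *)
Require Import Defs.
From HB Require Import structures.
From mathcomp Require Import all_boot all_order all_algebra all_fingroup.
From mathcomp Require Import all_classical all_reals all_analysis.
From mathcomp Require Import ring lra zify.

Set Implicit Arguments.
Unset Strict Implicit.
Unset Printing Implicit Defensive.

Import Order.TTheory GRing.Theory Num.Theory.
Import numFieldNormedType.Exports.

Local Open Scope classical_set_scope.
Local Open Scope ring_scope.

(** Both algorithms are run by a finite controller: the schedule is a function of the
    queues q(t) and of a controller state with finitely many values, which itself
    evolves as a function of q(t).  For the bursty algorithm the controller is the
    schedule of the previous slot and the position in the burst, and for the pipelined one it is
    the list of the next m schedules.  What matters is that the schedule in use was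
    MaxWeight for the queues of at most m slots ago ([recent_maxweight]).  Since queues
    change by a bounded amount in each slot, it is MaxWeight for the current queues up
    to a constant b ([near_max]), and the proofs for MaxWeight survive with b as an
    additive error.

    The state x = (q, controller) is a chain driven by independent noises with finitely
    many values, the arrival matrices; expectations at time t are powers of an operator
    given by finite sums ([noise_op], [chain_law]).

    Drift.  By Birkhoff, MaxWeight serves at least as much weight as any doubly
    substochastic matrix ([birkhoff_max], [substochastic_max]).  Comparison with nu
    gives a negative drift of the norm of q, of order e = epsilon ([norm_drift]).
    Comparison with nu moved by vmin, the least entry of nu, in the direction of the
    residual q_perp, which has nonpositive row and column sums because the cone contains
    the indicators of rows and columns, gives a drift of the norm of q_perp that
    does not depend on e ([near_max_perp], [perp_drift]).  As increments are bounded,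
    exponentials of these norms contract on average ([exponential_drift]).

    Stability.  Two copies of the chain with the same noise and the same phase of the
    clock merge when no packet arrives for long enough, since the queues empty and the
    controller is reset ([idle_merge]).  With the drift this gives Harris's contraction,
    hence geometric forgetting of the initial state ([block_contraction], [forgetting]).
    It follows that expectations converge along each phase ([phase_limit_cvg]), that no
    mass or moment escapes to infinity ([esum_steady_law]), and that return
    probabilities at multiples of the period are bounded below, whence period and
    positive recurrence, by the decomposition at the last visit ([last_exit],
    [no_visit_summable]).  State-space collapse is then the uniform drift of q_perp,
    followed from the empty queues ([perp_moments]).

    Heavy traffic.  Let Phi(q) be the squared norm of the orthogonal projection of q onto
    the space spanned by the cone.  In one slot its mean changes by
    - 2 e / n * sum q + (2 / n - 1 / n^2) * sum sigma^2 + e^2, up to an error due to the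
    unused service, which is bounded by del * ||q_perp||^2 plus 1 / del times the unused
    service ([quad_step]).  In the steady state the mean of Phi over a period does not
    change and the mean unused service is n e.  With del = sqrt e, the bound on the
    moments of q_perp yields e * E[sum q] = (1 - 1 / (2 n)) * sum sigma^2 + O(sqrt e)
    ([mean_qsum_estimate]). *)

(** * The Frobenius inner product and the projection onto the cone *)

Lemma cvg_sumr (R : realType) (I U : Type) (F : set_system U) (r : seq I)
    (f : I -> U -> R) (l : I -> R) : Filter F ->
  (forall i, f i x @[x --> F] --> l i) ->
  \sum_(i <- r) f i x @[x --> F] --> \sum_(i <- r) l i.
Proof. by move=> FF fl; apply: cvg_big => //; exact: (@add_continuous R). Qed.

Section frobenius.
Variables (R : realType) (n : nat).
Implicit Types (x y z : 'M[R]_n).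

Definition dotm x y : R := \sum_i \sum_j x i j * y i j.

Lemma dotmC x y : dotm x y = dotm y x.
Proof. by apply: eq_bigr => i _; apply: eq_bigr => j _; rewrite mulrC. Qed.

Lemma dotmDl x y z : dotm (x + y) z = dotm x z + dotm y z.
Proof.
rewrite -big_split; apply: eq_bigr => i _; rewrite -big_split.
by apply: eq_bigr => j _; rewrite /= mxE mulrDl.
Qed.

Lemma dotmZl (c : R) x y : dotm (c *: x) y = c * dotm x y.
Proof.
rewrite mulr_sumr; apply: eq_bigr => i _; rewrite mulr_sumr.
by apply: eq_bigr => j _; rewrite mxE mulrA.
Qed.

Lemma dotmNl x y : dotm (- x) y = - dotm x y.
Proof. by rewrite -scaleN1r dotmZl mulN1r. Qed.

Lemma dotmBl x y z : dotm (x - y) z = dotm x z - dotm y z.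
Proof. by rewrite dotmDl dotmNl. Qed.

Lemma dotmDr x y z : dotm x (y + z) = dotm x y + dotm x z.
Proof. by rewrite dotmC dotmDl ![dotm _ x]dotmC. Qed.

Lemma dotmZr (c : R) x y : dotm x (c *: y) = c * dotm x y.
Proof. by rewrite dotmC dotmZl dotmC. Qed.

Lemma dotmBr x y z : dotm x (y - z) = dotm x y - dotm x z.
Proof. by rewrite dotmC dotmBl ![dotm _ x]dotmC. Qed.

Lemma dotm_ge0 x y : (forall i j, 0 <= x i j) -> (forall i j, 0 <= y i j) ->
  0 <= dotm x y.
Proof. by move=> x0 y0; apply: sumr_ge0 => i _; apply: sumr_ge0 => j _; exact: mulr_ge0. Qed.

Lemma le_dotm x y z : (forall i j, 0 <= x i j) -> (forall i j, y i j <= z i j) ->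
  dotm x y <= dotm x z.
Proof.
move=> x0 yz; apply: ler_sum => i _; apply: ler_sum => j _; exact: ler_wpM2l.
Qed.

Lemma dotmm_ge0 x : 0 <= dotm x x.
Proof. by apply: sumr_ge0 => i _; apply: sumr_ge0 => j _; rewrite -expr2 sqr_ge0. Qed.

Lemma frob_norm_ge0 x : 0 <= frob_norm x.
Proof. exact: sqrtr_ge0. Qed.

Lemma sqr_frob_norm x : frob_norm x ^+ 2 = dotm x x.
Proof. by rewrite sqr_sqrtr// dotmm_ge0. Qed.

Lemma dotmD2 x y : dotm (x + y) (x + y) = dotm x x + dotm x y *+ 2 + dotm y y.
Proof. by rewrite dotmDl !dotmDr (dotmC y x); ring. Qed.

Lemma dotmB2 x y : dotm (x - y) (x - y) = dotm x x - dotm x y *+ 2 + dotm y y.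
Proof. by rewrite dotmBl !dotmBr (dotmC y x); ring. Qed.

Lemma entry_frob_norm x i j : `|x i j| <= frob_norm x.
Proof.
rewrite -(@ler_pXn2r _ 2) ?nnegrE ?frob_norm_ge0// sqr_frob_norm real_normK ?num_real//.
rewrite /dotm (bigD1 i)//= (bigD1 j)//= -expr2 -addrA lerDl addr_ge0//.
  by apply: sumr_ge0 => j' _; rewrite -expr2 sqr_ge0.
by apply: sumr_ge0 => i' _; apply: sumr_ge0 => j' _; rewrite -expr2 sqr_ge0.
Qed.

Lemma frob_norm_dotm_le x y : (frob_norm x <= frob_norm y) = (dotm x x <= dotm y y).
Proof. by rewrite -!sqr_frob_norm ler_pXn2r// nnegrE frob_norm_ge0. Qed.

Lemma cauchy_schwarz x y : dotm x y <= frob_norm x * frob_norm y.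
Proof.
have [y0|y0] := eqVneq (frob_norm y) 0.
  rewrite y0 mulr0 /dotm big1// => i _; rewrite big1// => j _.
  by have := entry_frob_norm y i j; rewrite y0 normr_le0 => /eqP ->; rewrite mulr0.
have yp : 0 < frob_norm y by rewrite lt_neqAle eq_sym y0 frob_norm_ge0.
have := dotmm_ge0 (frob_norm y *: x - frob_norm x *: y).
rewrite dotmB2 !(dotmZl, dotmZr) -!sqr_frob_norm => h.
have [x0|xp] := eqVneq (frob_norm x) 0.
  rewrite x0 mul0r /dotm big1// => i _; rewrite big1// => j _.
  by have := entry_frob_norm x i j; rewrite x0 normr_le0 => /eqP ->; rewrite mul0r.
have {}xp : 0 < frob_norm x by rewrite lt_neqAle eq_sym xp frob_norm_ge0.
rewrite -(ler_pM2l (mulr_gt0 xp yp)) -subr_ge0 -(pmulr_rge0 _ (ltr0Sn R 1)).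
by apply: le_trans h _; rewrite le_eqVlt; apply/orP; left; apply/eqP; ring.
Qed.

Lemma frob_normD x y : frob_norm (x + y) <= frob_norm x + frob_norm y.
Proof.
rewrite -(@ler_pXn2r _ 2) ?nnegrE ?addr_ge0 ?frob_norm_ge0//.
rewrite sqr_frob_norm dotmD2 sqrrD !sqr_frob_norm lerD2r lerD2l lerMn2r/=.
exact: cauchy_schwarz.
Qed.

Lemma frob_normN x : frob_norm (- x) = frob_norm x.
Proof. by congr Num.sqrt; apply: eq_bigr => i _; apply: eq_bigr => j _; rewrite mxE sqrrN. Qed.

Lemma frob_norm0 : frob_norm (0 : 'M[R]_n) = 0.
Proof.
apply/eqP; rewrite -sqrf_eq0 sqr_frob_norm /dotm big1// => i _; rewrite big1// => j _.
by rewrite !mxE mul0r.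
Qed.

Lemma frob_norm_bound x (b : R) : (forall i j, `|x i j| <= b) ->
  frob_norm x <= n%:R * b.
Proof.
move=> xb; have [iz _|nI] := pickP (@predT 'I_n); last first.
  suff -> : frob_norm x = 0 by have := nI; case: (n) => [|n'] h; [rewrite mul0r|have := h ord0].
  by apply/eqP; rewrite -sqrf_eq0 sqr_frob_norm /dotm big_pred0.
have b0 : 0 <= b := le_trans (normr_ge0 _) (xb iz iz).
rewrite -(@ler_pXn2r _ 2) ?nnegrE ?mulr_ge0 ?frob_norm_ge0// sqr_frob_norm.
apply: le_trans (_ : \sum_(i < n) \sum_(j < n) b ^+ 2 <= _).
  apply: ler_sum => i _; apply: ler_sum => j _.
  by rewrite -expr2 -real_normK ?num_real// ler_pXn2r ?nnegrE.
by rewrite !sumr_const !card_ord exprMn -(mulr_natl (b ^+ 2)) -(mulr_natl (_ * _)) mulrA -expr2.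
Qed.

End frobenius.

Section projection.
Variables (R : realType) (n : nat).
Implicit Types (x y z : 'M[R]_n).

(** Moving the least w i from w to w' makes both parts nonnegative. *)
Lemma cone_K_param x : (0 < n)%N -> cone_K x ->
  exists2 v : 'I_n -> R, (forall i, 0 <= v i) &
  exists2 v' : 'I_n -> R, (forall j, 0 <= v' j) & forall i j, x i j = v i + v' j.
Proof.
case: n x => // k x _ [[w [w' xE]] x0].
have [i0 _ wmin] := @arg_minP _ _ _ (@ord0 k) xpredT w isT.
exists (fun i => w i - w i0) => [i|]; first by rewrite subr_ge0 wmin.
exists (fun j => w i0 + w' j) => [j|i j]; first by rewrite -xE; exact: x0.
by rewrite addrA subrK xE.
Qed.

Lemma cone_K0 : cone_K (0 : 'M[R]_n).
Proof.
by split=> [|i j]; [exists (fun=> 0), (fun=> 0) => i j|]; rewrite mxE ?addr0.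
Qed.

(** A competitor of 0 has entries at most twice the norm of the point, so that
    its coordinates v, v' lie in a box: the distance is minimised on a compact
    set. *)
Lemma proj_K_exists x : (0 < n)%N -> exists y, cone_K y /\
  forall z, cone_K z -> frob_norm (x - y) <= frob_norm (x - z).
Proof.
move=> n0; pose M (v : 'rV[R]_(n + n)) : 'M[R]_n :=
  \matrix_(i, j) (v 0 (lshift n i) + v 0 (rshift n j)).
pose b := frob_norm x *+ 2.
have b0 : 0 <= b by rewrite mulrn_wge0 ?frob_norm_ge0.
pose box := [set v : 'rV[R]_(n + n) | forall k, `[0, b]%classic (v ord0 k)].
have cbox : compact box by apply: (@rV_compact _ _ (fun=> `[0, b]%classic)) => k; exact: segment_compact.
pose f (v : 'rV[R]_(n + n)) := dotm (x - M v) (x - M v).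
have cf : continuous f.
  move=> v; rewrite /continuous_at /f /dotm.
  apply: (@cvg_sumr R _ _ (nbhs v)) => i; apply: (@cvg_sumr R _ _ (nbhs v)) => j.
  have ce : (fun u : 'rV[R]_(n + n) => (x - M u) i j) @ v --> (x - M v) i j.
    have -> : (fun u : 'rV[R]_(n + n) => (x - M u) i j) =
        fun u => x i j - (u 0 (lshift n i) + u 0 (rshift n j)).
      by apply/funext => u; rewrite !mxE.
    have cc k : (fun u : 'rV[R]_(n + n) => u 0 k) @ v --> v 0 k.
      exact: coord_continuous.
    rewrite !mxE; exact: (cvgB (@cvg_cst _ _ _ (nbhs v) _) (cvgD (cc _) (cc _))).
  exact: cvgM.
have box0 : box 0 by move=> k; rewrite mxE /= in_itv/= lexx.
have [v] := compact_EVT_min (ex_intro _ _ box0) cbox (@continuous_subspaceT _ _ _ _ cf).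
rewrite inE => vb vmin.
have KM u : box u -> cone_K (M u).
  move=> ub; split=> [|i j].
    by exists (fun i => u 0 (lshift n i)), (fun j => u 0 (rshift n j)) => i j; rewrite mxE.
  rewrite mxE addr_ge0//; [have := ub (lshift n i)|have := ub (rshift n j)];
  by rewrite /= in_itv/= => /andP[].
exists (M v); split; first exact: KM.
move=> z Kz; rewrite frob_norm_dotm_le.
have M0 : M 0 = 0 by apply/matrixP => i j; rewrite !mxE addr0.
have [zx|xz] := leP (frob_norm (x - z)) (frob_norm x); last first.
  apply: le_trans (vmin 0 _) _; first by rewrite inE.
  by rewrite /f M0 subr0 -frob_norm_dotm_le ltW.
have zb i j : z i j <= b.
  rewrite (le_trans (ler_norm _))// (le_trans (entry_frob_norm _ _ _))//.
  rewrite -[z](subKr x) (le_trans (frob_normD _ _))// frob_normN /b mulr2n.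
  by rewrite lerD2l.
have [w w0 [w' w'0 zE]] := cone_K_param n0 Kz.
pose u : 'rV[R]_(n + n) := \row_(k < n + n) match fintype.split k with inl i => w i | inr j => w' j end.
have uE : M u = z.
  apply/matrixP => i j; rewrite !mxE.
  by rewrite (unsplitK (inl i)) (unsplitK (inr j)) zE.
rewrite -uE; apply: vmin; rewrite inE => k /=; rewrite mxE in_itv/=.
case: (fintype.split k) => [i|j].
  by rewrite w0 (le_trans _ (zb i (Ordinal n0)))// zE lerDl.
by rewrite w'0 (le_trans _ (zb (Ordinal n0) j))// zE lerDr.
Qed.

Hypothesis n0 : (0 < n)%N.

Lemma proj_K_prop x : cone_K (proj_K x) /\
  forall z, cone_K z -> frob_norm (perp_K x) <= frob_norm (x - z).
Proof.
rewrite /perp_K /proj_K; case: xgetP => [y _ //|none].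
by have [y yP] := proj_K_exists x n0; have := none y yP.
Qed.

Lemma proj_K_ge0 x i j : 0 <= proj_K x i j.
Proof. by have [[_ ->]] := proj_K_prop x. Qed.

Lemma perp_K_le x z : cone_K z -> frob_norm (perp_K x) <= frob_norm (x - z).
Proof. by have [_] := proj_K_prop x; apply. Qed.

Lemma perp_K_le_norm x : frob_norm (perp_K x) <= frob_norm x.
Proof. by rewrite -[in leRHS](subr0 x) perp_K_le//; exact: cone_K0. Qed.

Lemma cone_KDZ y z (t : R) : cone_K y -> cone_K z -> 0 <= t -> cone_K (y + t *: z).
Proof.
move=> [[w [w' yE]] y0] [[v [v' zE]] z0] t0; split=> [|i j].
  by exists (fun i => w i + t * v i), (fun j => w' j + t * v' j) => i j;
    rewrite !mxE yE zE; ring.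
by rewrite !mxE addr_ge0 ?mulr_ge0 ?y0 ?z0.
Qed.

(** First-order optimality of the nearest point: the cone contains every ray
    from it in a direction of the cone. *)
Lemma perp_K_polar x z : cone_K z -> dotm (perp_K x) z <= 0.
Proof.
move=> Kz; rewrite leNgt; apply/negP => pos; have [Kp _] := proj_K_prop x.
have zz : 0 < dotm z z.
  rewrite lt_neqAle dotmm_ge0 andbT; apply: contraTneq pos => /esym zz.
  rewrite -leNgt (le_trans (cauchy_schwarz _ _))//.
  by rewrite [frob_norm z](_ : _ = 0) ?mulr0//; apply/eqP; rewrite -sqrf_eq0 sqr_frob_norm zz.
pose t := dotm (perp_K x) z / dotm z z.
have t0 : 0 < t by rewrite divr_gt0.
have := perp_K_le x (cone_KDZ Kp Kz (ltW t0)).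
rewrite opprD addrA frob_norm_dotm_le -/(perp_K x) [leRHS]dotmB2 dotmZr dotmZl dotmZr.
rewrite -addrA lerDl mulr2n addrC subr_ge0 leNgt.
have -> : t * (t * dotm z z) = t * dotm (perp_K x) z by rewrite divfK// gt_eqF.
by rewrite ltrDl mulr_gt0.
Qed.

(** The cone contains the ray through the projection, so that the latter can be
    shrunk as well as stretched. *)
Lemma perp_K_proj x : dotm (perp_K x) (proj_K x) = 0.
Proof.
have [Kp _] := proj_K_prop x; apply/eqP; rewrite eq_le perp_K_polar//= leNgt.
set p := proj_K x in Kp *; set r := perp_K x; apply/negP => neg.
have pp : 0 < dotm p p.
  rewrite lt_neqAle dotmm_ge0 andbT; apply: contraTneq neg => /esym pp.
  rewrite -leNgt -oppr_le0 -dotmNl (le_trans (cauchy_schwarz _ _))//.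
  by rewrite [frob_norm p](_ : _ = 0) ?mulr0//; apply/eqP; rewrite -sqrf_eq0 sqr_frob_norm pp.
(* shrink the projection by a factor 1 - t with 0 < t <= 1 *)
pose t := Num.min 1 (- dotm r p / dotm p p).
have t0 : 0 < t by rewrite lt_min ltr01 divr_gt0// oppr_gt0.
have t1 : t <= 1 by rewrite ge_min lexx.
have tr : t * dotm p p <= - dotm r p by rewrite -ler_pdivlMr// ge_min lexx orbT.
have Kt : cone_K (p - t *: p).
  have := cone_KDZ cone_K0 Kp (_ : 0 <= 1 - t); rewrite add0r scalerBl scale1r.
  by apply; rewrite subr_ge0.
have := perp_K_le x Kt.
have -> : x - (p - t *: p) = r + t *: p by rewrite /r /perp_K opprB addrA addrAC.
rewrite frob_norm_dotm_le -/r [leRHS]dotmD2 dotmZr dotmZl dotmZr -addrA lerDl.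
have -> : (t * dotm r p) *+ 2 + t * (t * dotm p p) = t * (dotm r p *+ 2 + t * dotm p p).
  by ring.
rewrite pmulr_rge0// leNgt => /negP; apply.
by move: tr neg; rewrite mulr2n; lra.
Qed.

End projection.

(** * Maximum weight of doubly substochastic matrices *)

Section hall.
Local Open Scope nat_scope.
Variables (I J : finType).
Implicit Types (A : I -> {set J}) (K : {set I}).

Definition neighbours A K : {set J} := (\bigcup_(i in K) A i)%SET.

Definition hall_condition A := forall K, #|K| <= #|neighbours A K|.

Lemma neighbours_mem A K i j : i \in K -> j \in A i -> j \in neighbours A K.
Proof. by move=> iK jA; apply/bigcupP; exists i. Qed.

(** Rado's argument: in a family that satisfies Hall's condition, a set with two
    elements x, y can lose one of them.  Otherwise two index sets K and L
    witness the failures, and submodularity of the number of neighbours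
    contradicts Hall's condition at K :|: L and at (K :&: L) :\ i. *)
Lemma hall_theorem A : hall_condition A ->
  exists2 f : I -> J, injective f & forall i, f i \in A i.
Proof.
have [k] := ubnP (\sum_i #|A i|); elim: k A => // k IH A ltk hA.
have [/existsP[i /card_gt1P[x [y [xA yA xy]]]] | single] :=
    boolP [exists i, 1 < #|A i|].
  pose drop z i' := if i' == i then A i :\ z else A i'.
  have dropS z i' : drop z i' \subset A i'.
    by rewrite /drop; case: eqVneq => // ->; exact: subD1set.
  have smaller z : z \in A i -> \sum_i' #|drop z i'| < k.
    move=> zA; apply: leq_trans (_ : \sum_i #|A i| <= k); last by rewrite -ltnS.
    rewrite (bigD1 i)//= [X in _ < X](bigD1 i)//=.
    rewrite /drop eqxx (cardsD1 z (A i)) zA add1n addSn ltnS leq_add2l.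
    by apply: leq_sum => i' /negbTE ->.
  have ok z : z \in A i -> hall_condition (drop z) ->
      exists2 f : I -> J, injective f & forall i, f i \in A i.
    move=> zA /(IH _ (smaller z zA))[f fi fA]; exists f => // i'.
    exact: (fintype.subsetP (dropS z i')).
  have [/(ok _ xA)//|nx] := pselect (hall_condition (drop x)).
  have [/(ok _ yA)//|ny] := pselect (hall_condition (drop y)).
  have bad z : ~ hall_condition (drop z) ->
      exists2 K : {set I}, i \in K & #|neighbours (drop z) K| < #|K|.
    move=> /existsNP[K /negP]; rewrite -ltnNge => ltK; exists K => //.
    apply: contraTT ltK => iK; rewrite -leqNgt (leq_trans (hA K))// subset_leq_card//.
    apply/fintype.subsetP => j /bigcupP[i' i'K jA]; apply: (neighbours_mem i'K).
    by rewrite /drop; case: eqVneq i'K => // ->; rewrite (negbTE iK).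
  have [K iK ltK] := bad _ nx; have [L iL ltL] := bad _ ny.
  (* x stays a neighbour through L, and all other elements of A i through K *)
  have hU : #|K :|: L| <= #|neighbours (drop x) K :|: neighbours (drop y) L|.
    rewrite (leq_trans (hA _))// subset_leq_card//.
    apply/fintype.subsetP => j /bigcupP[i' i'K jA]; rewrite inE.
    have [i'i|i'i] := eqVneq i' i.
      have [jx|jx] := eqVneq j x.
        apply/orP; right; apply: (neighbours_mem iL).
        by rewrite /drop eqxx !inE jx xy xA.
      by apply/orP; left; apply: (neighbours_mem iK); rewrite /drop eqxx !inE jx -i'i.
    move: i'K; rewrite inE => /orP[] i'K; apply/orP; [left|right];
    by apply: (neighbours_mem i'K); rewrite /drop (negbTE i'i).
  have hI : #|(K :&: L) :\ i| <= #|neighbours (drop x) K :&: neighbours (drop y) L|.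
    rewrite (leq_trans (hA _))// subset_leq_card//.
    apply/fintype.subsetP => j /bigcupP[i']; rewrite !inE => /and3P[i'i i'K i'L] jA.
    by apply/andP; split; [apply: (neighbours_mem i'K)|apply: (neighbours_mem i'L)];
      rewrite /drop (negbTE i'i).
  have iKL : i \in K :&: L by rewrite inE iK iL.
  have := cardsUI K L.
  have := cardsUI (neighbours (drop x) K) (neighbours (drop y) L).
  by move: hI; rewrite (cardsD1 i (K :&: L)) iKL; lia.
have A1 i : exists j, A i = [set j]%SET.
  apply/cards1P; rewrite eqn_leq; apply/andP; split.
    by rewrite leqNgt; apply: contra single => ?; apply/existsP; exists i.
  by have := hA [set i]%SET; rewrite /neighbours big_set1 cards1.
have [f fA] := choice A1; exists f => [i j eqf|i]; last by rewrite fA set11.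
apply/eqP; apply: contraPT (hA [set i; j]%SET) => nij.
by rewrite /neighbours finset.bigcup_setU !big_set1 !fA eqf finset.setUid cards1 cards2 nij.
Qed.

End hall.

Section birkhoff.
Variables (R : realType) (n : nat).
Implicit Types (x q : 'M[R]_n) (s : 'S_n).

(** A scaled doubly stochastic matrix has a permutation in its support: the mass
    of k rows sits in the columns that they meet, so these are at least k. *)
Lemma support_perm (c : R) x : 0 < c -> (forall i j, 0 <= x i j) ->
  (forall i, \sum_j x i j = c) -> (forall j, \sum_i x i j = c) ->
  exists s : 'S_n, forall i, 0 < x i (s i).
Proof.
move=> c0 x0 rows cols.
have hallx : hall_condition (fun i => [set j | 0 < x i j]%SET).
  move=> K; set N := neighbours _ _.
  rewrite -(@ler_nat R) -(ler_pM2r c0) !mulr_natl -!sumr_const.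
  rewrite (eq_bigr (fun i => \sum_j x i j)) => [|i _]; last by rewrite rows.
  rewrite [leRHS](eq_bigr (fun j => \sum_i x i j)) => [|j _]; last by rewrite cols.
  rewrite exchange_big/= [leLHS](bigID (mem N))/= [X in _ + X]big1 ?addr0.
    apply: ler_sum => j _; rewrite [leRHS](bigID (mem K))/= lerDl.
    exact: sumr_ge0.
  move=> j jN; apply: big1 => i iK; apply/eqP; rewrite eq_le x0 andbT leNgt.
  by apply: contra jN => xij; apply: (neighbours_mem iK); rewrite inE.
have [f fi fA] := hall_theorem hallx.
by exists (perm fi) => i; have := fA i; rewrite inE permE.
Qed.

(** Peeling off a permutation in the support, with the smallest of its entries
    as coefficient, makes an entry vanish and lowers all line sums equally.  This
    is Birkhoff's decomposition, in its dual form: a linear functional is largest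
    at a permutation. *)
Lemma birkhoff_max q (M : R) : (forall s, \sum_i q i (s i) <= M) ->
  forall x (c : R), 0 <= c -> (forall i j, 0 <= x i j) ->
  (forall i, \sum_j x i j = c) -> (forall j, \sum_i x i j = c) ->
  \sum_i \sum_j q i j * x i j <= c * M.
Proof.
move=> qM x c; have [k] := ubnP #|[set ij : 'I_n * 'I_n | x ij.1 ij.2 != 0]%SET|.
elim: k x c => // k IH x c ltk c0 x0 rows cols.
have [iz _|nI] := pickP (@predT 'I_n); last first.
  have := qM 1%g; rewrite !big_pred0 // => M0; exact: mulr_ge0.
have [/eqP c_eq0|cpos] := boolP (c == 0).
  have x00 i j : x i j = 0.
    apply/eqP; rewrite eq_le x0 andbT -c_eq0 -(rows i) (bigD1 j)//= lerDl.
    exact: sumr_ge0.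
  by rewrite c_eq0 mul0r big1// => i' _; rewrite big1// => j _; rewrite x00 mulr0.
have {}cpos : 0 < c by rewrite lt_neqAle eq_sym cpos.
have [s spos] := support_perm cpos x0 rows cols.
have [i0 _ imin] := @arg_minP _ _ _ iz xpredT (fun i => x i (s i)) isT.
set th := x i0 (s i0) in imin.
pose x' : 'M[R]_n := \matrix_(i, j) (x i j - th * (s i == j)%:R).
have x'0 i j : 0 <= x' i j.
  rewrite mxE; case: eqVneq => [<-|_]; last by rewrite mulr0 subr0.
  by rewrite mulr1 subr_ge0 imin.
have rows' i : \sum_j x' i j = c - th.
  under eq_bigr => j _ do rewrite mxE.
  rewrite sumrB rows -mulr_sumr (bigD1 (s i))//= eqxx big1 ?addr0 ?mulr1//.
  by move=> j /negbTE; rewrite eq_sym => ->.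
have cols' j : \sum_i x' i j = c - th.
  under eq_bigr => i _ do rewrite mxE.
  rewrite sumrB cols -mulr_sumr (bigD1 (s^-1%g j))//= permKV eqxx big1 ?addr0 ?mulr1//.
  by move=> i ij; have [sij|//] := eqVneq (s i) j; rewrite -sij permK eqxx in ij.
have thc : 0 <= c - th by rewrite -(rows' iz) sumr_ge0.
have lt' : (#|[set ij : 'I_n * 'I_n | x' ij.1 ij.2 != 0%R]%SET| < k)%N.
  rewrite -ltnS; apply: leq_trans ltk; rewrite ltnS; apply: proper_card.
  apply/properP; split.
    apply/fintype.subsetP => -[i j]; rewrite !inE/=; apply: contraNN => /eqP xij.
    rewrite eq_le x'0 andbT mxE xij sub0r oppr_le0.
    by rewrite mulr_ge0// /th x0.
  by exists (i0, s i0); rewrite !inE/= ?mxE ?eqxx ?mulr1 ?subrr ?eqxx// gt_eqF// spos.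
have := IH x' _ lt' thc x'0 rows' cols'.
under eq_bigr => i _ do under eq_bigr => j _ do rewrite mxE mulrBr.
under eq_bigr => i _ do rewrite sumrB.
rewrite sumrB mulrBl lerBlDr => /le_trans; apply.
rewrite -addrA gerDl addrC subr_le0.
under eq_bigr => i _.
  rewrite (bigD1 (s i))//= eqxx big1 ?addr0 ?mulr1; last first.
    by move=> j /negbTE; rewrite eq_sym => ->; rewrite !mulr0.
  over.
by rewrite -mulr_suml mulrC ler_wpM2l// /th x0.
Qed.

(** A doubly substochastic matrix lies below a doubly stochastic one: the row
    and column deficits are filled in proportionally. *)
Lemma substochastic_max q (M : R) : (forall i j, 0 <= q i j) ->
  (forall s, \sum_i q i (s i) <= M) ->
  forall x, (forall i j, 0 <= x i j) ->
  (forall i, \sum_j x i j <= 1) -> (forall j, \sum_i x i j <= 1) ->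
  \sum_i \sum_j q i j * x i j <= M.
Proof.
move=> q0 qM x x0 rows cols.
pose r i := 1 - \sum_j x i j; pose c j := 1 - \sum_i x i j.
pose t := \sum_i r i.
have tE : t = \sum_j c j by rewrite /t /r /c !sumrB exchange_big.
have r0 i : 0 <= r i by rewrite subr_ge0.
have c0 j : 0 <= c j by rewrite subr_ge0.
have t0 : 0 <= t by rewrite sumr_ge0.
pose y : 'M[R]_n := \matrix_(i, j) (x i j + r i * c j / t).
have xy i j : x i j <= y i j by rewrite mxE lerDl !mulr_ge0// invr_ge0.
have rt i : r i * t / t = r i.
  have [tz|tz] := eqVneq t 0; last by rewrite mulfK.
  suff -> : r i = 0 by rewrite !mul0r.
  by apply/eqP; move/eqP: tz; rewrite psumr_eq0// => /allP/(_ i (mem_index_enum _)).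
have ct j : c j * t / t = c j.
  have [tz|tz] := eqVneq t 0; last by rewrite mulfK.
  suff -> : c j = 0 by rewrite !mul0r.
  apply/eqP; move/eqP: tz; rewrite tE psumr_eq0//.
  by move=> /allP/(_ j (mem_index_enum _)).
rewrite -[M]mul1r; apply: le_trans (_ : \sum_i \sum_j q i j * y i j <= _).
  by apply: ler_sum => i _; apply: ler_sum => j _; rewrite ler_wpM2l.
apply: birkhoff_max => //.
- by move=> i j; rewrite (le_trans (x0 i j)).
- move=> i; under eq_bigr => j _ do rewrite mxE.
  by rewrite big_split/= -mulr_suml -mulr_sumr -tE rt /r subrKC.
- move=> j; under eq_bigr => i _ do rewrite mxE mulrAC.
  rewrite big_split/= -mulr_suml -mulr_suml -/t mulrAC [t * _]mulrC ct /c.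
  by rewrite subrKC.
Qed.

End birkhoff.

(** * Chains driven by independent noise with finitely many values *)

Section driven_chain.
Variables (R : realType) (A : finType) (w : A -> R).
Hypotheses (w_ge0 : forall a, 0 <= w a) (w_sum1 : \sum_a w a = 1).

(** Transition operator of the chain with update [F]; its powers are
    [iter t (noise_op F)].  All sums are finite because the noise is. *)
Definition noise_op (S : Type) (F : S -> A -> S) (phi : S -> R) (x : S) : R :=
  \sum_a w a * phi (F x a).

Fixpoint traj (S : Type) (F : S -> A -> S) (x : S) (al : nat -> A) (k : nat) : S :=
  if k is k'.+1 then F (traj F x al k') (al k') else x.

Definition noise_kernel (S : eqType) (F : S -> A -> S) (x y : S) : R :=
  \sum_(a | F x a == y) w a.

Section operator.
Variables (S : Type) (F : S -> A -> S).
Implicit Types (phi psi : S -> R) (x : S) (t : nat).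
Local Notation op := (noise_op F).

Lemma noise_op_le_pos phi psi x : (forall a, 0 < w a -> phi (F x a) <= psi (F x a)) ->
  op phi x <= op psi x.
Proof.
move=> h; apply: ler_sum => a _; have [->|wa] := eqVneq (w a) 0; first by rewrite !mul0r.
by apply: ler_wpM2l => //; apply: h; rewrite lt_neqAle eq_sym wa w_ge0.
Qed.

Lemma noise_op_le phi psi x : (forall a, phi (F x a) <= psi (F x a)) ->
  op phi x <= op psi x.
Proof. by move=> h; apply: noise_op_le_pos => a _. Qed.

Lemma noise_op_cst (c : R) x : op (fun=> c) x = c.
Proof. by rewrite /noise_op -mulr_suml w_sum1 mul1r. Qed.

Lemma noise_op_lin (c : R) phi psi x :
  op (fun y => c * phi y + psi y) x = c * op phi x + op psi x.
Proof.
rewrite /noise_op mulr_sumr -big_split; apply: eq_bigr => a _ /=.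
by rewrite mulrDr mulrCA.
Qed.

Lemma iter_op_cst t (c : R) x : iter t op (fun=> c) x = c.
Proof.
elim: t x => // t IH x; rewrite iterS -[RHS](noise_op_cst c x); congr (op _ x).
exact/funext.
Qed.

Lemma iter_op_lin t (c : R) phi psi x :
  iter t op (fun y => c * phi y + psi y) x = c * iter t op phi x + iter t op psi x.
Proof.
elim: t x => // t IH x; rewrite !iterS -noise_op_lin; congr (op _ x).
exact/funext.
Qed.

Lemma iter_opZ t (c : R) phi x :
  iter t op (fun y => c * phi y) x = c * iter t op phi x.
Proof.
rewrite -[RHS]addr0 -(iter_op_cst t 0 x) -iter_op_lin.
by congr (iter t op _ x); apply/funext => y; rewrite addr0.
Qed.

Lemma iter_opD t phi psi x :
  iter t op (fun y => phi y + psi y) x = iter t op phi x + iter t op psi x.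
Proof.
rewrite -[X in _ = X + _]mul1r -iter_op_lin.
by congr (iter t op _ x); apply/funext => y; rewrite mul1r.
Qed.

Lemma iter_opB t phi psi x :
  iter t op (fun y => phi y - psi y) x = iter t op phi x - iter t op psi x.
Proof.
rewrite addrC -mulN1r -iter_op_lin.
by congr (iter t op _ x); apply/funext => y; rewrite mulN1r addrC.
Qed.

Lemma iter_op_sum t (I : Type) (r : seq I) (phi : I -> S -> R) x :
  iter t op (fun y => \sum_(i <- r) phi i y) x = \sum_(i <- r) iter t op (phi i) x.
Proof.
elim: r => [|i r IH].
  by rewrite big_nil -[RHS](iter_op_cst t 0 x); congr (iter t op _ x); apply/funext => y; rewrite big_nil.
rewrite big_cons -IH -iter_opD.
by congr (iter t op _ x); apply/funext => y; rewrite big_cons.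
Qed.

Lemma iter_op_add s t phi x : iter (s + t) op phi x = iter s op (iter t op phi) x.
Proof. by rewrite iterD. Qed.

(** The invariant [G] depends on time because the states that are possible at a given
    time depend on the clock. *)
Lemma iter_op_le_inv_pos (G : nat -> S -> Prop) :
  (forall k x a, 0 < w a -> G k x -> G k.+1 (F x a)) ->
  forall t k phi psi x, (forall y, G (k + t)%N y -> phi y <= psi y) -> G k x ->
  iter t op phi x <= iter t op psi x.
Proof.
move=> GF; elim=> [|t IH] k phi psi x le Gx; first by apply: le; rewrite addn0.
rewrite !iterS; apply: noise_op_le_pos => a wa; apply: (IH k.+1); last exact: GF.
by move=> y; rewrite addSnnS; exact: le.
Qed.

Lemma iter_op_le_inv (G : nat -> S -> Prop) :
  (forall k x a, G k x -> G k.+1 (F x a)) ->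
  forall t k phi psi x, (forall y, G (k + t)%N y -> phi y <= psi y) -> G k x ->
  iter t op phi x <= iter t op psi x.
Proof. by move=> GF; apply: iter_op_le_inv_pos => k x a _; exact: GF. Qed.

Lemma iter_op_le t phi psi x : (forall y, phi y <= psi y) ->
  iter t op phi x <= iter t op psi x.
Proof. by move=> le; apply: (@iter_op_le_inv (fun _ _ => True) _ t 0%N). Qed.

Lemma iter_op_ge0 t phi x : (forall y, 0 <= phi y) -> 0 <= iter t op phi x.
Proof. by move=> p0; rewrite -(iter_op_cst t 0 x); exact: iter_op_le. Qed.

Lemma iter_op_norm t phi x : `|iter t op phi x| <= iter t op (fun y => `|phi y|) x.
Proof.
rewrite ler_norml; apply/andP; split; last by apply: iter_op_le => y; exact: ler_norm.
rewrite -mulN1r -iter_opZ; apply: iter_op_le => y.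
by rewrite mulN1r lerNl -normrN ler_norm.
Qed.

Lemma iter_op_path t phi x (a : A) : (forall y, 0 <= phi y) ->
  w a ^+ t * phi (iter t (F^~ a) x) <= iter t op phi x.
Proof.
move=> p0; elim: t x => [|t IH] x; first by rewrite mul1r.
rewrite iterSr iterS /noise_op (bigD1 a)//= exprS -mulrA.
apply: le_trans (_ : w a * iter t op phi (F x a) <= _); first by rewrite ler_wpM2l.
by rewrite lerDl sumr_ge0// => b _; rewrite mulr_ge0// iter_op_ge0.
Qed.

Lemma noise_opD phi psi x : op (fun y => phi y + psi y) x = op phi x + op psi x.
Proof. exact: (iter_opD 1). Qed.

Lemma noise_opZ (c : R) phi x : op (fun y => c * phi y) x = c * op phi x.
Proof. exact: (iter_opZ 1). Qed.

Lemma noise_op_sum (I : Type) (r : seq I) (phi : I -> S -> R) x :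
  op (fun y => \sum_(i <- r) phi i y) x = \sum_(i <- r) op (phi i) x.
Proof. exact: (iter_op_sum 1). Qed.

Lemma noise_op_ge0 phi x : (forall y, 0 <= phi y) -> 0 <= op phi x.
Proof. exact: (iter_op_ge0 1). Qed.

Lemma geometric_bound_ge0 (gam K : R) : gam < 1 -> 0 <= K -> 0 <= K / (1 - gam).
Proof. by move=> g1 K0; rewrite divr_ge0// subr_ge0 ltW. Qed.

(** K / (1 - gam) is the fixed point of v |-> gam * v + K. *)
Lemma iter_op_drift (G : S -> Prop) (V : S -> R) (gam K : R) :
  (forall x a, G x -> G (F x a)) -> 0 <= gam -> gam < 1 -> 0 <= K ->
  (forall x, G x -> op V x <= gam * V x + K) ->
  forall t x, G x -> iter t op V x <= gam ^+ t * V x + K / (1 - gam).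
Proof.
move=> GF gam_ge0 gam_lt1 K_ge0 drift t x Gx.
have K'0 := geometric_bound_ge0 gam_lt1 K_ge0; set K' := K / (1 - gam) in K'0 *.
have gamK : gam * K' + K = K' by rewrite /K'; field; rewrite subr_eq0 gt_eqF.
suff le : iter t op V x <= gam ^+ t * (V x - K') + K'.
  by rewrite (le_trans le)// lerD2r ler_wpM2l ?exprn_ge0// gerBl.
elim: t x Gx => [|t IH] x Gx; first by rewrite mul1r subrK.
rewrite iterS; apply: le_trans (_ : op (fun y => gam ^+ t * V y + (1 - gam ^+ t) * K') x <= _).
  apply: noise_op_le => a; rewrite (le_trans (IH _ (GF x a Gx)))//.
  by rewrite le_eqVlt; apply/orP; left; apply/eqP; ring.
rewrite noise_op_lin noise_op_cst exprSr.
have := ler_wpM2l (exprn_ge0 t gam_ge0) (drift x Gx).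
move: (gam ^+ t) => u h.
have -> : u * gam * (V x - K') + K' = u * (gam * V x + K) + (1 - u) * K' - u * (gam * K' + K - K').
  ring.
by rewrite gamK subrr mulr0 subr0 lerD2r.
Qed.

End operator.

Section coupling.
Variables (S : eqType) (F : S -> A -> S).
Local Notation op := (noise_op F).

(** The synchronous coupling of two copies of the chain. *)
Definition coupled (p : S * S) (a : A) : S * S := (F p.1 a, F p.2 a).

Lemma iter_coupled_fst t phi x y :
  iter t (noise_op coupled) (fun p => phi p.1) (x, y) = iter t op phi x.
Proof.
by elim: t x y => // t IH x y; rewrite !iterS; apply: eq_bigr => a _; rewrite IH.
Qed.

Lemma iter_coupled_snd t phi x y :
  iter t (noise_op coupled) (fun p => phi p.2) (x, y) = iter t op phi y.
Proof.
by elim: t x y => // t IH x y; rewrite !iterS; apply: eq_bigr => a _; rewrite IH.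
Qed.

Lemma iter_coupled_state t a x y :
  iter t (coupled^~ a) (x, y) = (iter t (F^~ a) x, iter t (F^~ a) y).
Proof. by elim: t => //= t ->. Qed.

(** A chain with a clock [ph] of period [c] and a Lyapunov function [V], on the
    closed set [G] of its admissible states.  The last condition says that the
    noise [a0], repeated, brings states of the same phase in a sublevel set of
    [V] together. *)
Record ergodic_chain (G : S -> Prop) (c : nat) (ph : S -> nat) (V : S -> R)
    (gam K : R) (a0 : A) : Prop := ErgodicChain {
  erg_closed : forall x a, G x -> G (F x a);
  erg_phase : forall x a, ph (F x a) = ((ph x).+1 %% c)%N;
  erg_phase_lt : forall x, (ph x < c)%N;
  erg_V_ge0 : forall x, 0 <= V x;
  erg_gam : 0 <= gam < 1;
  erg_K_ge0 : 0 <= K;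
  erg_drift : forall x, G x -> op V x <= gam * V x + K;
  erg_noise_gt0 : 0 < w a0;
  erg_drain : forall r : R, exists N, forall x y, G x -> G y -> ph x = ph y ->
     V x <= r -> V y <= r -> iter N (F^~ a0) x = iter N (F^~ a0) y
}.

Section contraction.
Variables (G : S -> Prop) (c : nat) (ph : S -> nat) (V : S -> R) (gam K : R) (a0 : A).
Hypothesis erg : ergodic_chain G c ph V gam K a0.

Let GF : forall x a, G x -> G (F x a) := erg_closed erg.
Let phF : forall x a, ph (F x a) = ((ph x).+1 %% c)%N := erg_phase erg.
Let ph_lt : forall x, (ph x < c)%N := erg_phase_lt erg.
Let V_ge0 : forall x, 0 <= V x := erg_V_ge0 erg.
Let gam_ge0 : 0 <= gam. Proof. by have /andP[] := erg_gam erg. Qed.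
Let gam_lt1 : gam < 1. Proof. by have /andP[] := erg_gam erg. Qed.
Let K_ge0 : 0 <= K := erg_K_ge0 erg.
Let drift : forall x, G x -> op V x <= gam * V x + K := erg_drift erg.
Let wa0 : 0 < w a0 := erg_noise_gt0 erg.
Let drain : forall r : R, exists N, forall x y, G x -> G y -> ph x = ph y ->
  V x <= r -> V y <= r -> iter N (F^~ a0) x = iter N (F^~ a0) y := erg_drain erg.

Let K' := K / (1 - gam).

Lemma drift_bound_ge0 : 0 <= K'.
Proof. exact: geometric_bound_ge0. Qed.

Lemma iter_drift t x : G x -> iter t op V x <= gam ^+ t * V x + K'.
Proof. by apply: (iter_op_drift GF). Qed.

Lemma iter_drift_le t x : G x -> iter t op V x <= V x + K'.
Proof.
move=> Gx; rewrite (le_trans (iter_drift t Gx))// lerD2r ler_piMl//.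
by apply: exprn_ile1 => //; exact: ltW.
Qed.

Let same (p : S * S) := [/\ G p.1, G p.2 & ph p.1 = ph p.2].

Let same_coupled p a : same p -> same (coupled p a).
Proof. by move=> [Gx Gy e]; split=> /=; [exact: GF|exact: GF|rewrite !phF e]. Qed.

(** Distance that one block of the coupled chain contracts: states that are
    large contract by the drift, states that are small because the noise [a0]
    repeated merges them. *)
Let dist (b : R) (p : S * S) : R := (p.1 != p.2)%:R * (1 + b * (V p.1 + V p.2)).

Let dist_ge0 b p : 0 <= b -> 0 <= dist b p.
Proof. by move=> b0; rewrite mulr_ge0// addr_ge0// mulr_ge0// addr_ge0. Qed.

Lemma dist_le b N x y : 0 <= b -> G x -> G y ->
  iter N (noise_op coupled) (dist b) (x, y) <=
    iter N (noise_op coupled) (fun p => (p.1 != p.2)%:R) (x, y)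
    + b * (iter N op V x + iter N op V y).
Proof.
move=> b0 Gx Gy; rewrite -(iter_coupled_fst _ _ x y) -(iter_coupled_snd _ _ x y).
rewrite -iter_opD -iter_opZ -iter_opD; apply: iter_op_le => -[x' y'] /=.
rewrite /dist /=; case: eqP => _ /=; rewrite ?mul1r// mul0r add0r.
by rewrite mulr_ge0// addr_ge0.
Qed.

(** Harris's argument.  Beyond the level r0 the drift lowers V x + V y by a fixed
    proportion, which outweighs the additive constant; below it the copies
    merge with a probability at least al, which outweighs the growth of V once
    b is small with respect to al.  The block has length N + 1 so that the
    factor gam gains at least one slot. *)
Lemma block_contraction : exists N b rho, [/\ 0 < b <= 1, b * K' <= 1, 0 <= rho < 1
  & forall p, same p -> iter N.+1 (noise_op coupled) (dist b) p <= rho * dist b p].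
Proof.
pose r0 := (4 * K' + 2) / (1 - gam).
have g1 : 0 < 1 - gam by rewrite subr_gt0.
have K'0 := drift_bound_ge0.
have [N drainN] := drain r0.
pose al := w a0 ^+ N.+1.
have al0 : 0 < al by rewrite exprn_gt0.
have al1 : al <= 1.
  rewrite exprn_ile1// -w_sum1 (bigD1 a0)//= lerDl; exact: sumr_ge0.
pose b := al / (4 * K' + 4).
have den : 0 < 4 * K' + 4 by rewrite ltr_wpDl// mulr_ge0.
have b0 : 0 < b by rewrite divr_gt0.
have bE : 4 * (b * K') + 4 * b = al.
  by rewrite -[RHS](divfK (lt0r_neq0 den)) -/b; ring.
have bK : 0 <= b * K' by rewrite mulr_ge0// ltW.
pose del := Num.min ((1 - gam) / 2) b.
have del0 : 0 < del by rewrite lt_min b0 andbT; lra.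
have delg : del <= (1 - gam) / 2 by rewrite ge_min lexx.
have delb : del <= b by rewrite ge_min lexx orbT.
exists N, b, (1 - del); split.
- by rewrite b0/=; lra.
- by lra.
- by apply/andP; split; lra.
move=> [x y] [/= Gx Gy phxy].
have [xy|xy] := eqVneq x y.
  rewrite {2}/dist /= xy eqxx mul0r mulr0 -(iter_op_cst coupled N.+1 0 (y, y)).
  apply: (@iter_op_le_inv _ coupled (fun _ p => p.1 = p.2) _ N.+1 0%N) => //=.
    by move=> _ p a ->.
  by move=> [x' y'] /= ->; rewrite /dist /= eqxx mul0r.
rewrite {2}/dist /= xy mul1r.
apply: le_trans (dist_le N.+1 (ltW b0) Gx Gy) _.
have gN z : G z -> iter N.+1 op V z <= gam * V z + K'.
  move=> Gz; rewrite (le_trans (iter_drift N.+1 Gz))// lerD2r ler_wpM2r//.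
  by rewrite exprS ler_piMr// exprn_ile1// ltW.
set v := V x + V y.
have v0 : 0 <= v by rewrite addr_ge0.
have bv0 : 0 <= b * v by rewrite mulr_ge0// ltW.
have Vle : b * (iter N.+1 op V x + iter N.+1 op V y) <= gam * (b * v) + 2 * (b * K').
  apply: le_trans (ler_wpM2l (ltW b0) (lerD (gN x Gx) (gN y Gy))) _.
  by rewrite le_eqVlt; apply/orP; left; apply/eqP; rewrite /v; ring.
have dbv : del * (b * v) <= (1 - gam) / 2 * (b * v) by rewrite ler_wpM2r.
have gbv : 0 <= (1 - gam) * (b * v) by rewrite mulr_ge0// ltW.
have [vr|vr] := leP v r0.
  have le1 : iter N.+1 (noise_op coupled) (fun p => (p.1 != p.2)%:R) (x, y) <= 1 - al.
    rewrite -[X in _ <= X - al](iter_op_cst coupled N.+1 1 (x, y)).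
    have -> : (fun p : S * S => (p.1 != p.2)%:R : R) = fun p => 1 - (p.1 == p.2)%:R.
      by apply/funext => p; case: eqP; rewrite /= ?subrr ?subr0.
    rewrite iter_opB lerD2l lerN2.
    apply: le_trans (iter_op_path coupled N.+1 (x, y) a0 _) => [|p]; last by [].
    rewrite iter_coupled_state /= (drainN x y)// ?eqxx ?mulr1//.
      by rewrite (le_trans _ vr)// lerDl.
    by rewrite (le_trans _ vr)// lerDr.
  apply: le_trans (lerD le1 Vle) _.
  by lra.
have le1 : iter N.+1 (noise_op coupled) (fun p => (p.1 != p.2)%:R) (x, y) <= 1.
  rewrite -[leRHS](iter_op_cst coupled N.+1 1 (x, y)); apply: iter_op_le => p.
  by case: (_ != _).
apply: le_trans (lerD le1 Vle) _.
have : 4 * (b * K') + 2 * b <= (1 - gam) * (b * v).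
  have -> : 4 * (b * K') + 2 * b = b * (4 * K' + 2) by ring.
  rewrite [leRHS]mulrCA ler_wpM2l ?(ltW b0)//.
  by rewrite [leRHS]mulrC -ler_pdivrMr// ltW.
by lra.
Qed.

(** Whole blocks contract the distance of the coupled copies, and the drift bounds
    it over the incomplete block that remains. *)
Lemma forgetting : exists2 r : nat -> R, (forall t, 0 <= r t) /\ r @ \oo --> 0 &
  forall t x y (phi : S -> R) (C : R), G x -> G y -> ph x = ph y ->
    (forall z, G z -> `|phi z| <= C * (1 + V z)) ->
    `|iter t op phi x - iter t op phi y| <= C * r t * (1 + V x + V y).
Proof.
have [N [b [rho [/andP[b0 b1] bK /andP[rho0 rho1] contr]]]] := block_contraction.
exists (fun t => 6 / b * rho ^+ (t %/ N.+1)%N).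
  split=> [t|]; first by rewrite mulr_ge0 ?exprn_ge0// divr_ge0// ltW.
  rewrite -[0 in X in _ --> X](mulr0 (6 / b)); apply: cvgMr.
  apply: (@cvg_comp _ _ _ (fun t => t %/ N.+1)%N (fun k => rho ^+ k) _ \oo).
    apply/cvgnyPge => k; near=> t; rewrite leq_divRL//.
    by near: t; exact: nbhs_infty_ge.
  by apply: cvg_expr; rewrite ger0_norm.
move=> t x y phi C Gx Gy phxy phiC.
have C0 : 0 <= C.
  by have := le_trans (normr_ge0 _) (phiC x Gx); rewrite pmulr_lge0// ltr_pwDl.
have blocks k p : same p -> iter (k * N.+1) (noise_op coupled) (dist b) p <= rho ^+ k * dist b p.
  elim: k p => [|k IH] p sp; first by rewrite mul1r.
  rewrite mulSn iterD exprSr -mulrA.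
  apply: le_trans (_ : iter N.+1 (noise_op coupled) (fun p => rho ^+ k * dist b p) p <= _).
    apply: (@iter_op_le_inv _ coupled (fun _ => same) _ _ 0%N) => //.
  by rewrite iter_opZ ler_wpM2l ?exprn_ge0// contr.
have phid p : same p -> `|phi p.1 - phi p.2| <= 2 * C / b * dist b p.
  move=> [G1 G2 _]; rewrite /dist; have [->|_] := eqVneq p.1 p.2.
    by rewrite subrr normr0 mul0r mulr0.
  rewrite mul1r (le_trans (ler_normB _ _))// (le_trans (lerD (phiC _ G1) (phiC _ G2)))//.
  have -> : 2 * C / b * (1 + b * (V p.1 + V p.2)) =
      C * (b^-1 * 2 + 2 * (V p.1 + V p.2)) by field; rewrite gt_eqF.
  rewrite -mulrDr ler_wpM2l//.
  have : 1 <= b^-1 by rewrite invf_ge1.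
  by have := V_ge0 p.1; have := V_ge0 p.2; lra.
rewrite -(iter_coupled_fst _ _ x y) -(iter_coupled_snd _ _ x y) -iter_opB.
rewrite (le_trans (iter_op_norm _ _ _ _))//.
apply: le_trans (_ : iter t (noise_op coupled) (fun p => 2 * C / b * dist b p) (x, y) <= _).
  exact: (@iter_op_le_inv _ coupled (fun _ => same) _ _ 0%N).
rewrite iter_opZ {1}(divn_eq t N.+1) addnC iter_op_add.
set k := (t %/ N.+1)%N; set j := (t %% N.+1)%N.
have Cb : 0 <= 2 * C / b by rewrite divr_ge0 ?mulr_ge0// ltW.
apply: le_trans (_ : 2 * C / b * (rho ^+ k * iter j (noise_op coupled) (dist b) (x, y)) <= _).
  rewrite ler_wpM2l// -iter_opZ.
  apply: (@iter_op_le_inv _ coupled (fun _ => same) _ _ 0%N) => //.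
  by move=> p; exact: blocks.
have le1 : iter j (noise_op coupled) (fun p => (p.1 != p.2)%:R) (x, y) <= 1.
  rewrite -[leRHS](iter_op_cst coupled j 1 (x, y)); apply: iter_op_le => p.
  by case: (_ != _).
have := dist_le j (ltW b0) Gx Gy.
have := ler_wpM2l (ltW b0) (lerD (iter_drift_le j Gx) (iter_drift_le j Gy)).
set v := b * (iter j op V x + iter j op V y) => le3.
set D := iter j _ (dist b) _ => le2.
have D3 : D <= 3 * (1 + V x + V y).
  have bS : b * (V x + V y) <= V x + V y by rewrite ler_piMl// addr_ge0.
  have e : b * (V x + K' + (V y + K')) = b * (V x + V y) + 2 * (b * K') by ring.
  have Vx := V_ge0 x; have Vy := V_ge0 y.
  rewrite e in le3; move: le1 le2 le3 bK bS; rewrite -/D.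
  by move: (b * K') (b * (V x + V y)) (iter j _ _ _) => u1 u2 u3; lra.
rewrite [leRHS](_ : _ = 2 * C / b * (rho ^+ k * (3 * (1 + V x + V y)))).
  by rewrite ler_wpM2l// ler_wpM2l// exprn_ge0.
by field; rewrite gt_eqF.
Unshelve. all: by end_near. Qed.

Lemma period_gt0 (x : S) : (0 < c)%N.
Proof. exact: leq_ltn_trans (ph_lt x). Qed.

(** At times multiple of [c] the phase is back to its initial value. *)
Lemma iter_op_le_phase k l phi psi x : G x ->
  (forall y, G y -> ph y = ((ph x + l) %% c)%N -> phi y <= psi y) ->
  iter (k * c + l) op phi x <= iter (k * c + l) op psi x.
Proof.
move=> Gx le.
apply: (@iter_op_le_inv _ F (fun j y => G y /\ ph y = ((ph x + j) %% c)%N) _ _ 0%N).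
- by move=> j y a [Gy phy]; split; [exact: GF|rewrite phF phy -addn1 modnDml addn1 addnS].
- by move=> y [Gy phy]; apply: le => //; rewrite phy add0n addnCA modnMDl.
- by split=> //; rewrite addn0 modn_small.
Qed.

Definition dominated (phi : S -> R) :=
  exists C, forall z, G z -> `|phi z| <= C * (1 + V z).

Lemma dominated_ge0 phi : dominated phi ->
  exists2 C, 0 <= C & forall z, G z -> `|phi z| <= C * (1 + V z).
Proof.
move=> [C h]; exists `|C| => // z Gz; rewrite (le_trans (h z Gz))// ler_wpM2r ?ler_norm//.
by rewrite addr_ge0.
Qed.

Lemma dominated_cst (b : R) : dominated (fun=> b).
Proof. by exists `|b| => z Gz; rewrite ler_peMr// lerDl. Qed.

Lemma dominated_lin (b : R) phi psi : dominated phi -> dominated psi ->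
  dominated (fun x => b * phi x + psi x).
Proof.
move=> [C hC] [D hD]; exists (`|b| * C + D) => z Gz.
rewrite (le_trans (ler_normD _ _))// normrM [leRHS]mulrDl -mulrA lerD ?hD//.
by rewrite ler_wpM2l ?hC.
Qed.

Lemma dominated_sum (I : Type) (r : seq I) (phi : I -> S -> R) :
  (forall i, dominated (phi i)) -> dominated (fun x => \sum_(i <- r) phi i x).
Proof.
move=> h; elim: r => [|i r IH].
  have [C hC] := dominated_cst 0; exists C => z Gz; rewrite big_nil; exact: hC.
have [C hC] := dominated_lin 1 (h i) IH.
by exists C => z Gz; rewrite big_cons -[phi i z]mul1r; exact: hC.
Qed.

Lemma dominated_le phi psi : (forall x, G x -> `|phi x| <= psi x) ->
  dominated psi -> dominated phi.
Proof.
move=> h [C hC]; exists C => z Gz; rewrite (le_trans (h z Gz))//.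
by rewrite (le_trans (ler_norm _))// hC.
Qed.

Lemma dominated_op phi : dominated phi -> dominated (op phi).
Proof.
move=> /dominated_ge0[C C0 hC]; exists (C * (1 + K)) => z Gz.
rewrite (le_trans (iter_op_norm F 1 phi z))//=.
apply: le_trans (_ : op (fun y => C * V y + C) z <= _).
  apply: noise_op_le => a; rewrite (le_trans (hC _ (GF a Gz)))//.
  by rewrite mulrDr mulr1 addrC.
rewrite noise_op_lin noise_op_cst -[X in _ + X]mulr1 -mulrDr -mulrA ler_wpM2l//.
have := drift Gz; have : gam * V z <= V z by rewrite ler_piMl// ltW.
have : 0 <= K * V z by exact: mulr_ge0.
by rewrite mulrDr mulr1 mulrDl mul1r; lra.
Qed.

(** Expectation in the steady state at phase [l] of the clock, for the chain
    started at [x]. *)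
(** Expectation of [phi] in the steady state, as seen at phase [l] of the clock
    when the chain starts from [x]. *)
Definition phase_limit (l : nat) (x : S) (phi : S -> R) : R :=
  lim (iter (k * c + l) op phi x @[k --> \oo]).

Let cvg_mul_period (l : nat) (x : S) : (k * c + l)%N @[k --> \oo] --> \oo.
Proof.
apply/cvgnyPge => N; near=> k; rewrite (@leq_trans k)//.
  by near: k; exact: nbhs_infty_ge.
by rewrite (leq_trans (leq_pmulr k (period_gt0 x)))// leq_addr.
Unshelve. all: by end_near. Qed.

Let cvg_along_phase (l : nat) (x : S) (r : nat -> R) (b : R) : r @ \oo --> b ->
  r (k * c + l)%N @[k --> \oo] --> b.
Proof.
move=> rb; apply: (@cvg_comp _ _ _ (fun k => k * c + l)%N r _ \oo) => //.
exact: cvg_mul_period.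
Qed.

(** After whole periods the chain is again at the phase of [x], and a start from
    there is soon forgotten: the sequence is Cauchy. *)
Lemma phase_limit_cvg l x phi : G x -> dominated phi ->
  iter (k * c + l) op phi x @[k --> \oo] --> phase_limit l x phi.
Proof.
move=> Gx /dominated_ge0[C C0 hC]; have [r [r0 rlim] fr] := forgetting.
suff : cvg (iter (k * c + l) op phi x @[k --> \oo]) by [].
apply: cauchy_cvg; apply: cauchy_exP => e e0.
pose D := C * (1 + V x + (V x + K')) + 1.
have D0 : 0 < D by rewrite ltr_wpDl// mulr_ge0// !addr_ge0// drift_bound_ge0.
have small : \forall k \near \oo, r (k * c + l)%N < e / D.
  by have /cvgr_lt := cvg_along_phase l x rlim; apply; rewrite divr_gt0.
have [k0 _ sk0] := small.
exists (iter (k0 * c + l) op phi x); exists k0 => // k /= le_k.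
rewrite -ball_normE /= distrC -(subnKC le_k).
move: (k - k0)%N => j; set t := (k0 * c + l)%N.
have -> : ((k0 + j) * c + l = j * c + t)%N by rewrite /t mulnDl addnAC addnC.
rewrite iter_op_add.
rewrite -[X in _ - X](iter_op_cst F (j * c) (iter t op phi x) x) -iter_opB.
apply: le_lt_trans (iter_op_norm _ _ _ _) _; rewrite -[(j * c)%N]addn0.
apply: (@le_lt_trans _ _ (iter (j * c + 0) op (fun y => C * r t * V y + C * r t * (1 + V x)) x)).
  apply: iter_op_le_phase => // y Gy phy; rewrite -mulrDr.
  have := @fr t y x phi C Gy Gx; rewrite phy addn0 modn_small// => /(_ erefl hC).
  by rewrite [V y + (1 + _)]addrCA addrA.
rewrite iter_op_lin iter_op_cst addn0 -mulrDr.
have rt : r t < e / D by apply: sk0 => /=.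
apply: le_lt_trans (_ : D * r t < e); last by rewrite mulrC -ltr_pdivlMr.
rewrite mulrAC ler_wpM2r// /D.
rewrite -[leLHS]addr0 lerD// ler_wpM2l//.
have := iter_drift_le (j * c) Gx; move: (iter _ _ _ _) => u; lra.
Qed.

Lemma phase_limit_eq l x y phi : G x -> G y -> ph x = ph y -> dominated phi ->
  phase_limit l x phi = phase_limit l y phi.
Proof.
move=> Gx Gy phxy dom; have [C C0 hC] := dominated_ge0 dom.
have [r [r0 rlim] fr] := forgetting.
have up : C * (1 + V x + V y) * r (k * c + l)%N @[k --> \oo] --> 0.
  rewrite -[0 in X in _ --> X](mulr0 (C * (1 + V x + V y))); apply: cvgMr.
  exact: cvg_along_phase.
have diff0 : ((fun k => iter (k * c + l) op phi x) -
    (fun k => iter (k * c + l) op phi y)) k @[k --> \oo] --> (0 : R).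
  apply: norm_cvg0; apply: (@squeeze_cvgr _ _ _ R (fun=> 0) _ _ _ (0 : R) (cvg_cst 0) up).
  by near=> k; rewrite normr_ge0/= -mulrA [_ * r _]mulrC mulrA; exact: fr.
have cx := cvg_sub0 diff0 (@phase_limit_cvg l _ _ Gy dom).
exact: (cvg_lim (@Rhausdorff R) (cx _)).
Unshelve. all: by end_near. Qed.

Lemma phase_limit_lin l x (b : R) phi psi : G x -> dominated phi -> dominated psi ->
  phase_limit l x (fun y => b * phi y + psi y) =
  b * phase_limit l x phi + phase_limit l x psi.
Proof.
move=> Gx d1 d2; apply: (cvg_lim (@Rhausdorff R)).
under eq_fun => k do rewrite iter_op_lin.
by apply: cvgD; [apply: cvgMr|]; exact: phase_limit_cvg.
Qed.

Lemma phase_limitZ l x (b : R) phi : G x -> dominated phi ->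
  phase_limit l x (fun y => b * phi y) = b * phase_limit l x phi.
Proof.
move=> Gx dom; apply: (cvg_lim (@Rhausdorff R)).
by under eq_fun => k do rewrite iter_opZ; apply: cvgMr; exact: phase_limit_cvg.
Qed.

Lemma phase_limit_cst l x (b : R) : phase_limit l x (fun=> b) = b.
Proof.
apply: (cvg_lim (@Rhausdorff R)); under eq_fun => k do rewrite iter_op_cst.
exact: cvg_cst.
Qed.

Lemma phase_limit_sum l x (I : Type) (s : seq I) (phi : I -> S -> R) : G x ->
  (forall i, dominated (phi i)) ->
  phase_limit l x (fun y => \sum_(i <- s) phi i y) =
  \sum_(i <- s) phase_limit l x (phi i).
Proof.
move=> Gx dom; apply: (cvg_lim (@Rhausdorff R)).
under eq_fun => k do rewrite iter_op_sum.
by apply: cvg_sumr => i; exact: phase_limit_cvg.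
Qed.

Lemma phase_limit_le l x phi psi : G x -> dominated phi -> dominated psi ->
  (forall y, G y -> phi y <= psi y) -> phase_limit l x phi <= phase_limit l x psi.
Proof.
move=> Gx d1 d2 le.
apply: (ler_cvg_to (@phase_limit_cvg l _ _ Gx d1) (@phase_limit_cvg l _ _ Gx d2)).
by near=> k; apply: iter_op_le_phase => // y Gy _; exact: le.
Unshelve. all: by end_near. Qed.

Lemma phase_limit_le_bound l x phi (b : R) : G x -> dominated phi ->
  (forall t, iter t op phi x <= b) -> phase_limit l x phi <= b.
Proof.
move=> Gx dom le; apply: (ler_cvg_to (@phase_limit_cvg l _ _ Gx dom) (cvg_cst b)).
by near=> k; exact: le.
Unshelve. all: by end_near. Qed.

Lemma phase_limit_op l x phi : phase_limit l x (op phi) = phase_limit l.+1 x phi.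
Proof.
rewrite /phase_limit; congr (lim (_ @ \oo)); apply/funext => k.
by rewrite addnS iterSr.
Qed.

Lemma phase_limit_period x phi : G x -> dominated phi ->
  phase_limit c x phi = phase_limit 0 x phi.
Proof.
move=> Gx dom; apply: (cvg_lim (@Rhausdorff R)).
have h := @phase_limit_cvg 0 _ _ Gx dom; rewrite -(cvg_shiftn 1) in h.
have -> : (fun k => iter (k * c + c) op phi x) = (fun k => iter ((k + 1) * c + 0) op phi x).
  by apply/funext => k; rewrite addn0 mulnDl mul1n.
exact: h.
Qed.

(** The operator shifts the phase by one. *)
Lemma period_sum_op x phi : G x -> dominated phi ->
  \sum_(l < c) phase_limit l x (op phi) = \sum_(l < c) phase_limit l x phi.
Proof.
move=> Gx dom; under eq_bigr => l _ do rewrite phase_limit_op.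
have := phase_limit_period Gx dom; case: (c) => [|c' per]; first by rewrite !big_ord0.
by rewrite big_ord_recr big_ord_recl/= per addrC.
Qed.

Section steady_law.
Variables (E : choiceType) (q : S -> E) (U : E -> R) (x : S) (l : nat).
Hypotheses (VU : forall y, V y = U (q y)) (Gx : G x) (U_ge1 : forall v, 1 <= U v)
  (U_finite : forall r, finite_set [set v | U v <= r]).

Definition steady_law (v : E) : R := phase_limit l x (fun y => (q y == v)%:R).

Lemma dominated_sqr (f : E -> R) (C : R) : (forall v, f v ^+ 2 <= C * U v) ->
  dominated (f \o q).
Proof.
move=> fC; exists (Num.max 1 C) => z Gz /=; rewrite VU.
have m1 : 1 <= Num.max 1 C by rewrite le_max lexx.
have U0 : 0 <= U (q z) := le_trans ler01 (U_ge1 _).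
rewrite -(@ler_pXn2r _ 2) ?nnegrE ?mulr_ge0 ?addr_ge0 ?(le_trans ler01 m1)//.
rewrite real_normK ?num_real// (le_trans (fC _))//.
apply: le_trans (_ : Num.max 1 C * U (q z) <= _).
  by rewrite ler_wpM2r// le_max lexx orbT.
set m := Num.max 1 C in m1 *; set u := U (q z) in U0 *.
have : m * u <= m ^+ 2 * u by rewrite ler_wpM2r// expr2 ler_peMr// (le_trans ler01).
have : 0 <= m ^+ 2 * (1 + u + u ^+ 2) by rewrite mulr_ge0 ?sqr_ge0// !addr_ge0 ?sqr_ge0.
by rewrite exprMn; lra.
Qed.

Lemma dominated_indic (P : S -> bool) : dominated (fun y => (P y)%:R).
Proof.
apply: dominated_le (dominated_cst 1) => y _.
by rewrite ger0_norm ?ler0n// lern1; case: (P y).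
Qed.

Lemma steady_law_ge0 v : 0 <= steady_law v.
Proof.
rewrite -(phase_limit_cst l x 0); apply: phase_limit_le => //; first exact: dominated_cst.
exact: dominated_indic.
Qed.

(** Expectations of functions f = O(sqrt U) are not lost in the limit: outside a
    finite set f is below a small multiple of U, whose expectation is bounded
    by the drift. *)
Lemma esum_steady_law (f : E -> R) (C : R) : (forall v, 0 <= f v) ->
  (forall v, f v ^+ 2 <= C * U v) ->
  (\esum_(v in [set: E]) (steady_law v * f v)%:E = (phase_limit l x (f \o q))%:E)%E.
Proof.
move=> f0 fC; have domf := dominated_sqr fC.
have dsum v : dominated (fun y => f v * (q y == v)%:R).
  apply: dominated_le (dominated_cst (f v)) => y _.
  by rewrite ger0_norm ?mulr_ge0// ler_piMr//; case: eqP.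
have pickE (s : seq E) y : uniq s ->
    \sum_(v <- s) f v * (q y == v)%:R = (q y \in s)%:R * f (q y).
  move=> us; have [qs|qs] := boolP (q y \in s).
    rewrite (bigD1_seq (q y))//= eqxx mulr1 mul1r big1 ?addr0// => v.
    by rewrite eq_sym => /negbTE ->; rewrite mulr0.
  rewrite mul0r big_seq big1// => v vs; case: eqP => [e|]; last by rewrite mulr0.
  by rewrite e vs in qs.
have sumE (X : set E) : finite_set X ->
    (\sum_(v \in X) (steady_law v * f v)%:E)%E =
    (phase_limit l x (fun y => \sum_(v <- finmap.enum_fset (fset_set X)) f v * (q y == v)%:R))%:E.
  move=> finX; rewrite fsbig_finite//= sumEFin phase_limit_sum//.
  apply: (congr1 (@EFin R)); apply: eq_bigr => v _.
  by rewrite (@phase_limitZ l x (f v) _ Gx (dominated_indic (fun y => q y == v))) mulrC.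
apply/eqP; rewrite eq_le; apply/andP; split.
  apply: ge_ereal_sup => _ [X [finX _] <-]; rewrite sumE// lee_fin.
  apply: phase_limit_le => //; first exact: dominated_sum.
  move=> y _; rewrite pickE ?finmap.fset_uniq//=.
  by case: (_ \in _); rewrite ?mul1r// mul0r.
apply/lee_addgt0Pr => e e0.
have B0 : 0 < V x + K' + 1 by rewrite ltr_wpDl// addr_ge0// drift_bound_ge0.
pose eta := e / (V x + K' + 1); have eta0 : 0 < eta by rewrite divr_gt0.
pose X := [set v | U v <= C / eta ^+ 2]; have finX : finite_set X := U_finite _.
apply: le_trans (_ : (\sum_(v \in X) (steady_law v * f v)%:E + e%:E <= _)%E); last first.
  by rewrite leeD2r//; apply: esum_ge; exists X.
rewrite sumE// -EFinD lee_fin.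
have domV : dominated V.
  by exists 1 => z Gz; rewrite ger0_norm// mul1r lerDr.
apply: le_trans (_ : phase_limit l x (fun y => eta * V y +
    \sum_(v <- finmap.enum_fset (fset_set X)) f v * (q y == v)%:R) <= _).
  apply: phase_limit_le => //; first by apply: dominated_lin => //; exact: dominated_sum.
  move=> y _ /=; rewrite pickE ?finmap.fset_uniq//.
  have [qX|qX] := boolP (q y \in _); first by rewrite mul1r lerDr mulr_ge0// ltW.
  rewrite mul0r addr0 VU.
  have {}qX : C / eta ^+ 2 < U (q y).
    rewrite ltNge; apply: contra qX => qX; rewrite in_fset_set//; exact/mem_set.
  have U0 : 0 <= U (q y) := le_trans ler01 (U_ge1 _).
  have sq : f (q y) ^+ 2 <= (eta * U (q y)) ^+ 2.
    apply: le_trans (fC _) _.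
    have -> : (eta * U (q y)) ^+ 2 = (eta ^+ 2 * U (q y)) * U (q y) by ring.
    rewrite ler_wpM2r//.
    by apply: ltW; rewrite mulrC -ltr_pdivrMr ?exprn_gt0.
  have eU : 0 <= eta * U (q y) by rewrite mulr_ge0// ltW.
  by move: sq; rewrite ler_pXn2r// nnegrE.
rewrite phase_limit_lin//; last exact: dominated_sum.
rewrite addrC lerD2l.
apply: le_trans (_ : eta * (V x + K') <= _).
  rewrite ler_wpM2l ?(ltW eta0)//; apply: phase_limit_le_bound => // t.
  exact: iter_drift_le.
by rewrite -[leRHS](divfK (lt0r_neq0 B0)) -/eta ler_wpM2l ?(ltW eta0)// lerDl.
Qed.

End steady_law.

Section recurrence.
Implicit Types (x y z : S).

Definition at_state y z : R := (z == y)%:R.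

(** One step of the chain killed when it enters [y]. *)
Definition taboo_op y (phi : S -> R) x : R :=
  \sum_a w a * ((F x a != y)%:R * phi (F x a)).

Definition first_visit_prob y k x : R := iter k (taboo_op y) (op (at_state y)) x.

Definition no_visit_prob y k x : R := iter k (taboo_op y) (fun=> 1) x.

Lemma at_state_ge0 y z : 0 <= at_state y z.
Proof. exact: ler0n. Qed.

Lemma taboo_op_le y phi psi x : (forall z, phi z <= psi z) ->
  taboo_op y phi x <= taboo_op y psi x.
Proof.
by move=> h; apply: ler_sum => a _; rewrite ler_wpM2l// ler_wpM2l ?ler0n.
Qed.

Lemma no_visit_ge0 y k x : 0 <= no_visit_prob y k x.
Proof.
elim: k x => [|k IH] x; first exact: ler01.
by rewrite /no_visit_prob iterS; apply: sumr_ge0 => a _; rewrite !mulr_ge0 ?ler0n// IH.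
Qed.

Lemma taboo_op_split y phi x :
  op phi x = taboo_op y phi x + op (at_state y) x * phi y.
Proof.
rewrite mulr_suml -big_split; apply: eq_bigr => a _ /=; rewrite /at_state.
by case: eqP => [->|_] /=; rewrite ?mul0r ?mul1r ?mulr0 ?mulr1 ?addr0 ?add0r ?mul0r ?addr0.
Qed.

Lemma no_visit_decr y k x : no_visit_prob y k.+1 x <= no_visit_prob y k x.
Proof.
elim: k x => [|k IH] x; last first.
  by rewrite /no_visit_prob !iterS; apply: taboo_op_le => z; exact: IH.
rewrite /no_visit_prob /= -[leRHS](noise_op_cst F 1 x) (taboo_op_split y) lerDl.
by rewrite mulr1; apply: noise_op_ge0 => z; exact: at_state_ge0.
Qed.

Lemma no_visit_antitone y j k x : (j <= k)%N ->
  no_visit_prob y k x <= no_visit_prob y j x.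
Proof.
move=> /subnKC <-; elim: (k - j)%N => [|i IH]; first by rewrite addn0.
by rewrite addnS (le_trans (no_visit_decr _ _ _)).
Qed.

Lemma first_visit_probE y k x :
  first_visit_prob y k x = no_visit_prob y k x - no_visit_prob y k.+1 x.
Proof.
elim: k x => [|k IH] x.
  rewrite /first_visit_prob /no_visit_prob /=.
  have e := noise_op_cst F 1 x; rewrite (taboo_op_split y) mulr1 in e.
  by rewrite -[X in X - _]e addrAC subrr add0r.
rewrite /first_visit_prob /no_visit_prob !iterS {1 2 4}/taboo_op -sumrB.
by apply: eq_bigr => a _; rewrite -!mulrBr; congr (_ * (_ * _)); exact: IH.
Qed.

Lemma first_visit_prob_ge0 y k x : 0 <= first_visit_prob y k x.
Proof. by rewrite first_visit_probE subr_ge0 no_visit_decr. Qed.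

Lemma sum_first_visit y n x :
  \sum_(k < n) first_visit_prob y k x = 1 - no_visit_prob y n x.
Proof.
under eq_bigr => k _ do rewrite first_visit_probE.
elim: n => [|n IH]; first by rewrite big_ord0 subrr.
by rewrite big_ord_recr/= IH addrA subrK.
Qed.

(** Decomposition at the last visit to [y] before time n. *)
Lemma last_exit y n x :
  no_visit_prob y n x + \sum_(j < n) iter (n - j) op (at_state y) x * no_visit_prob y j y = 1.
Proof.
elim: n x => [|n IH] x; first by rewrite big_ord0 addr0.
have e : op (fun z => no_visit_prob y n z +
    \sum_(j < n) iter (n - j) op (at_state y) z * no_visit_prob y j y) x = 1.
  by rewrite -[RHS](noise_op_cst F 1 x); congr (op _ x); apply/funext => z; exact: IH.
rewrite noise_opD (taboo_op_split y) noise_op_sum in e.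
rewrite -[RHS]e big_ord_recr/= subSnn -addrA; congr (_ + _).
rewrite addrC; congr (_ + _); apply: eq_bigr => j _.
rewrite subSn 1?ltnW// iterS mulrC -noise_opZ; congr (op _ x).
by apply/funext => z; rewrite mulrC.
Qed.

Lemma iter_op_compose s t x y z : 0 < iter s op (at_state z) x ->
  0 < iter t op (at_state y) z -> 0 < iter (s + t) op (at_state y) x.
Proof.
move=> sz ty; rewrite iter_op_add.
apply: lt_le_trans (_ : iter t op (at_state y) z * iter s op (at_state z) x <= _).
  exact: mulr_gt0.
rewrite -iter_opZ; apply: iter_op_le => u; rewrite {2}/at_state.
by case: eqP => [->|_]; rewrite ?mulr1// mulr0 iter_op_ge0// => v; exact: at_state_ge0.
Qed.

Lemma iter_op_pos_phase k x y : 0 < iter k op (at_state y) x ->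
  ph y = ((ph x + k) %% c)%N.
Proof.
move=> pos; apply/eqP; apply: contraTT pos => phy; rewrite -leNgt -(iter_op_cst F k 0 x).
apply: (@iter_op_le_inv _ F (fun j z => ph z = ((ph x + j) %% c)%N) _ _ 0%N).
- by move=> j z a phz; rewrite phF phz -addn1 modnDml addn1 addnS.
- move=> z phz; rewrite /at_state; have [zy|_] := eqVneq z y; last by [].
  by move: phy; rewrite -zy phz add0n eqxx.
- by rewrite addn0 modn_small.
Qed.

Lemma iter_op_pos_G k x y : G x -> 0 < iter k op (at_state y) x -> G y.
Proof.
move=> Gx; apply: contraTP => nG; rewrite -leNgt -(iter_op_cst F k 0 x).
apply: (@iter_op_le_inv _ F (fun _ => G) _ _ 0%N) => [_ z a|z Gz|//]; first exact: GF.
by rewrite /at_state; have [zy|_] := eqVneq z y; [rewrite zy in Gz|].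
Qed.

Lemma iter_op_pos_path t x y : iter t (F^~ a0) x = y -> 0 < iter t op (at_state y) x.
Proof.
move=> <-; apply: lt_le_trans (iter_op_path F t x a0 (@at_state_ge0 _)).
by rewrite /at_state eqxx mulr1 exprn_gt0.
Qed.

(** Return probabilities stay away from 0: the drift keeps the chain in a
    sublevel set with probability 1/2, whence the noise [a0] leads to one
    common state, from which [y] is accessible. *)
Lemma return_lower_bound y : G y ->
  (forall N, exists k, 0 < iter k op (at_state y) (iter N (F^~ a0) y)) ->
  exists2 del : R, 0 < del & exists k0, forall k, (k0 <= k)%N ->
    del <= iter (k * c) op (at_state y) y.
Proof.
move=> Gy acc; pose r := 2 * (V y + K' + 1).
have K'0 := drift_bound_ge0.
have r0 : 0 < r by rewrite mulr_gt0// ltr_wpDl// addr_ge0.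
have [N drainN] := drain r; have [k1 pos] := acc N.
set p1 := iter k1 _ _ _ in pos.
exists (w a0 ^+ N * p1 / 2); first by rewrite !mulr_gt0 ?exprn_gt0// invr_gt0.
have posN := iter_op_compose (iter_op_pos_path (erefl (iter N (F^~ a0) y))) pos.
have /dvdnP[k0 k0E] : (c %| N + k1)%N.
  have := iter_op_pos_phase posN; rewrite -{1}(modn_small (ph_lt y)) -{1}[ph y]addn0.
  by move=> /eqP; rewrite eqn_modDl eq_sym mod0n.
exists k0 => k /subnK <-; move: (k - k0)%N => j.
have -> : ((j + k0) * c = (j * c + 0) + (N + k1))%N by rewrite mulnDl addn0 k0E.
rewrite iter_op_add [iter (N + k1) _ _]iterD.
apply: le_trans (_ : iter (j * c + 0) op (fun z => - (w a0 ^+ N * p1 / r) * V z + w a0 ^+ N * p1) y <= _).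
  rewrite iter_op_lin iter_op_cst addn0; move: (iter_drift_le (j * c) Gy).
  move: (iter (j * c) op V y) => u uV; set W := w a0 ^+ N * p1.
  have W0 : 0 <= W by rewrite mulr_ge0 ?exprn_ge0// ltW.
  have ur : u / r <= 2^-1 by rewrite ler_pdivrMr// /r; lra.
  have -> : - (W / r) * u + W = W - W * (u / r) by ring.
  by have := ler_wpM2l W0 ur; lra.
apply: iter_op_le_phase => // z Gz; rewrite addn0 modn_small// => phz.
have psi0 u : 0 <= iter k1 op (at_state y) u.
  by apply: iter_op_ge0 => v; exact: at_state_ge0.
have [Vz|Vz] := leP (V z) r.
  apply: le_trans (iter_op_path F N z a0 psi0).
  rewrite (drainN z y)//; last by rewrite /r; have := V_ge0 y; lra.
  rewrite -/p1 gerDr mulNr oppr_le0 mulr_ge0// divr_ge0 ?(ltW r0)//.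
  by rewrite mulr_ge0 ?exprn_ge0// ltW.
apply: le_trans (iter_op_ge0 F N z psi0); rewrite mulNr addrC subr_le0.
rewrite [leRHS](_ : _ = (w a0 ^+ N * p1) * (V z / r)); last by ring.
rewrite ler_peMr//; first by rewrite mulr_ge0 ?exprn_ge0// ltW.
by rewrite ler_pdivlMr// mul1r ltW.
Qed.

Lemma sum_blocks (f : nat -> R) n :
  \sum_(j < n * c) f j = \sum_(i < n) \sum_(l < c) f (i * c + l)%N.
Proof.
elim: n => [|n IH]; first by rewrite !big_ord0.
rewrite mulSnr -[LHS](big_mkord xpredT f) (@big_cat_nat _ _ _ (n * c)) ?leq_addr//=.
rewrite big_mkord IH big_ord_recr/=; congr (_ + _).
rewrite -{1}[(n * c)%N]add0n big_addn addKn big_mkord.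
by apply: eq_bigr => l _; rewrite addnC.
Qed.

(** The probability u of being at [y] at time n - j and not returning afterwards
    sums to 1 over j, and u is bounded below at multiples of the period: the
    probabilities of not having returned have a finite sum. *)
Lemma no_visit_summable y (del : R) k0 : 0 < del ->
  (forall k, (k0 <= k)%N -> del <= iter (k * c) op (at_state y) y) ->
  exists B, forall n, \sum_(j < n) no_visit_prob y j y <= B.
Proof.
move=> del0 low; exists (c%:R / del) => n; have c0 := period_gt0 y.
have block b : \sum_(i < b) no_visit_prob y (i * c) y <= del^-1.
  rewrite -[del^-1]mul1r ler_pdivlMr// mulrC.
  rewrite -[leRHS](last_exit y ((k0 + b) * c) y).
  pose f j := iter ((k0 + b) * c - j) op (at_state y) y * no_visit_prob y j y.
  have f0 j : 0 <= f j.
    by rewrite mulr_ge0 ?no_visit_ge0// iter_op_ge0// => z; exact: at_state_ge0.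
  rewrite -/(f _) [X in _ + X](_ : _ = \sum_(j < (k0 + b) * c) f j)//.
  rewrite sum_blocks addnC big_split_ord/=.
  rewrite (le_trans _ (_ : \sum_(i < b) \sum_(l < c) f (i * c + l)%N <= _))//; last first.
    by rewrite addrCA lerDl addr_ge0 ?no_visit_ge0// sumr_ge0// => i _; rewrite sumr_ge0.
  rewrite mulr_sumr; apply: ler_sum => i _.
  rewrite (bigD1 (Ordinal c0))//= addn0.
  apply: le_trans (_ : f (i * c)%N <= _); last by rewrite lerDl sumr_ge0.
  rewrite ler_wpM2r ?no_visit_ge0// -mulnBl low//.
  by have := ltn_ord i; lia.
apply: le_trans (_ : \sum_(j < n * c) no_visit_prob y j y <= _).
  rewrite -!(big_mkord xpredT (fun j => no_visit_prob y j y)).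
  rewrite [leRHS](@big_cat_nat _ _ _ n)//= ?leq_pmulr// lerDl.
  by apply: sumr_ge0 => j _; exact: no_visit_ge0.
rewrite (sum_blocks (fun j => no_visit_prob y j y)).
apply: le_trans (_ : \sum_(i < n) c%:R * no_visit_prob y (i * c) y <= _).
  apply: ler_sum => i _.
  apply: le_trans (_ : \sum_(l < c) no_visit_prob y (i * c) y <= _).
    by apply: ler_sum => l _; apply: no_visit_antitone; rewrite leq_addr.
  by rewrite sumr_const card_ord mulr_natl.
by rewrite -mulr_sumr ler_wpM2l.
Qed.

(** A nonincreasing sequence with bounded sums is O(1 / n). *)
Lemma no_visit_cvg0 y (B : R) : (forall n, \sum_(j < n) no_visit_prob y j y <= B) ->
  no_visit_prob y n y @[n --> \oo] --> 0.
Proof.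
move=> sB.
have up n : 0 <= no_visit_prob y n y <= B * n.+1%:R^-1.
  rewrite no_visit_ge0 ler_pdivlMr// mulr_natr.
  rewrite (le_trans _ (sB n.+1))//.
  have <- : \sum_(j < n.+1) no_visit_prob y n y = no_visit_prob y n y *+ n.+1.
    by rewrite sumr_const card_ord.
  by apply: ler_sum => j _; apply: no_visit_antitone; rewrite -ltnS.
apply: (@squeeze_cvgr _ _ _ R (fun=> 0) (fun n => B * n.+1%:R^-1) _ _ (0 : R) (cvg_cst 0)).
  by near=> n; exact: up.
by rewrite -[0 in X in _ --> X](mulr0 B); apply: cvgMr; exact: cvg_harmonic.
Unshelve. all: by end_near. Qed.

(** Summation by parts: the mean return time is the sum of the tails. *)
Lemma sum_return_time y n :
  \sum_(k < n) k.+1%:R * first_visit_prob y k y <= \sum_(j < n) no_visit_prob y j y.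
Proof.
suff -> : \sum_(k < n) k.+1%:R * first_visit_prob y k y =
    \sum_(j < n) no_visit_prob y j y - n%:R * no_visit_prob y n y.
  by rewrite gerBl mulr_ge0// no_visit_ge0.
elim: n => [|n IH]; first by rewrite !big_ord0 mul0r subrr.
have rec (f : nat -> R) : \sum_(i < n.+1) f i = \sum_(i < n) f i + f n.
  by rewrite big_ord_recr.
rewrite (rec (fun k => k.+1%:R * first_visit_prob y k y)).
rewrite (rec (fun j => no_visit_prob y j y)) IH first_visit_probE -natr1.
by move: (no_visit_prob y n.+1 y) => u; ring.
Qed.

End recurrence.

End contraction.
End coupling.
End driven_chain.

(** * From quadratic drift to geometric drift of an exponential *)

Section exponential_drift.
Variable R : realType.

(** From exp x <= 1 / (1 - x). *)
Lemma expR_le_quadratic (x : R) : x <= 2^-1 -> expR x <= 1 + x + 2 * x ^+ 2.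
Proof.
move=> x2; have x1 : 0 < 1 - x by lra.
have := expR_ge1Dx (- x); rewrite expRN -[_^-1]mul1r ler_pdivlMr ?expR_gt0// => le1.
have : (1 + x + 2 * x ^+ 2) * (1 - x) >= 1.
  have -> : (1 + x + 2 * x ^+ 2) * (1 - x) = 1 + x ^+ 2 * (1 - 2 * x) by ring.
  by rewrite lerDl mulr_ge0 ?sqr_ge0//; lra.
by move=> h; rewrite -(ler_pM2r x1); apply: le_trans h; rewrite mulrC.
Qed.

(** A bounded increment of W with E[W'^2 - W^2] <= -2 kap W + 2 B makes W decrease
    on average when W is large, because W'^2 - W^2 >= 2 W (W' - W); then
    exp(eta W) contracts for small eta.  The constants depend on nothing else. *)
Lemma exponential_drift (kap D B : R) : 0 < kap -> 0 < D -> 0 < B ->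
  exists eta gam K : R, [/\ 0 < eta, 0 <= gam < 1, 0 <= K &
  forall (A : finType) (w : A -> R) (W0 : R) (W : A -> R),
    (forall a, 0 <= w a) -> \sum_a w a = 1 -> 0 <= W0 ->
    (forall a, `|W a - W0| <= D) ->
    \sum_a w a * (W a ^+ 2 - W0 ^+ 2) <= - (2 * kap * W0) + 2 * B ->
    \sum_a w a * expR (eta * W a) <= gam * expR (eta * W0) + K].
Proof.
move=> kap0 D0 B0.
(* The first bound on eta permits the quadratic bound of the exponential, the
   second one makes its second-order term at most half of the first-order gain. *)
pose eta : R := Num.min (2 * D)^-1 (kap / (8 * D ^+ 2)).
have D2 : 0 < 8 * D ^+ 2 by rewrite mulr_gt0// exprn_gt0.
have eta0 : 0 < eta by rewrite lt_min invr_gt0 divr_gt0// andbT mulr_gt0.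
have etaD : eta * D <= 2^-1.
  have le : eta <= (2 * D)^-1 by rewrite ge_min lexx.
  have -> : 2^-1 = (2 * D)^-1 * D by field; rewrite gt_eqF.
  by rewrite ler_wpM2r ?(ltW D0).
have etaD2 : 2 * (eta * D) ^+ 2 <= eta * kap / 4.
  have : eta <= kap / (8 * D ^+ 2) by rewrite ge_min lexx orbT.
  rewrite ler_pdivlMr// => h; have := ler_wpM2l (ltW eta0) h.
  have -> : eta * (eta * (8 * D ^+ 2)) = 4 * (2 * (eta * D) ^+ 2) by ring.
  by move: (2 * (eta * D) ^+ 2) (eta * kap) => u v; lra.
(* Above M the mean increment is at most - kap / 2. *)
pose M := 2 * B / kap + 1.
have M0 : 0 < M by rewrite ltr_wpDl// divr_ge0 ?mulr_ge0// ltW.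
pose gam : R := Num.max 0 (1 - eta * kap / 4).
have gam1 : gam < 1.
  by rewrite gt_max ltr01 ltrBlDr ltrDl divr_gt0// mulr_gt0.
exists eta, gam, (expR (eta * (M + D))); split => //.
  by rewrite gam1 le_max lexx.
move=> A w W0 W w0 w1 W00 WD drift.
have small a : eta * (W a - W0) <= 2^-1.
  apply: le_trans etaD; rewrite ler_wpM2l ?(ltW eta0)//.
  exact: le_trans (ler_norm _) (WD a).
have [W0M|MW0] := ltP W0 M.
  apply: le_trans (_ : expR (eta * (M + D)) <= _); last first.
    by rewrite lerDr mulr_ge0 ?expR_ge0// le_max lexx.
  rewrite -[leRHS]mul1r -w1 mulr_suml; apply: ler_sum => a _.
  rewrite ler_wpM2l// ler_expR ler_wpM2l ?(ltW eta0)//.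
  by have := le_trans (ler_norm _) (WD a); lra.
have W0p : 0 < W0 := lt_le_trans M0 MW0.
have mean : \sum_a w a * (W a - W0) <= - (kap / 2).
  have : \sum_a w a * (2 * W0 * (W a - W0)) <= - (2 * kap * W0) + 2 * B.
    apply: le_trans drift; apply: ler_sum => a _; rewrite ler_wpM2l// -subr_ge0.
    have -> : W a ^+ 2 - W0 ^+ 2 - 2 * W0 * (W a - W0) = (W a - W0) ^+ 2 by ring.
    exact: sqr_ge0.
  under eq_bigr => a _ do rewrite mulrCA.
  rewrite -mulr_sumr; set E := \sum_a _ => h.
  rewrite -(ler_pM2l (mulr_gt0 (ltr0Sn R 1) W0p)) (le_trans h)//.
  have : kap * M <= kap * W0 by rewrite ler_wpM2l// ltW.
  have -> : kap * M = 2 * B + kap by rewrite /M; field; rewrite gt_eqF.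
  by lra.
apply: le_trans (_ : gam * expR (eta * W0) <= _); last by rewrite lerDl expR_ge0.
have -> : \sum_a w a * expR (eta * W a) = (\sum_a w a * expR (eta * (W a - W0))) * expR (eta * W0).
  rewrite mulr_suml; apply: eq_bigr => a _; rewrite -mulrA -expRD.
  by congr (_ * expR _); ring.
rewrite ler_wpM2r ?expR_ge0// le_max; apply/orP; right.
apply: le_trans (_ : \sum_a w a * (1 + eta * (W a - W0) + 2 * (eta * D) ^+ 2) <= _).
  apply: ler_sum => a _; rewrite ler_wpM2l// (le_trans (expR_le_quadratic (small a)))//.
  rewrite lerD2l ler_wpM2l// !exprMn ler_wpM2l ?sqr_ge0//.
  by rewrite -real_normK ?num_real// ler_pXn2r ?nnegrE// ltW.
under eq_bigr => a _ do rewrite mulrDr mulrDr mulr1 mulrCA.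
rewrite 2!big_split/= w1 -mulr_sumr -mulr_suml w1 mul1r.
have := ler_wpM2l (ltW eta0) mean; move: etaD2.
by move: (\sum_a _) ((eta * D) ^+ 2) => u v; lra.
Qed.

(** One term of the exponential series; the summand 1 is for r = 0. *)
Lemma exprn_le_expR (eta x : R) r : 0 < eta -> 0 <= x ->
  x ^+ r <= (1 + r`!%:R / eta ^+ r) * expR (eta * x).
Proof.
move=> eta0 x0; case: r => [|r].
  rewrite expr0 mulrDl mul1r; apply: le_trans (_ : expR (eta * x) <= _).
    by rewrite (le_trans _ (expR_ge1Dx _))// lerDl mulr_ge0// ltW.
  by rewrite lerDl mulr_ge0 ?expR_ge0// divr_ge0 ?exprn_ge0// ltW.
have := expR_ge1Dxn r (mulr_ge0 (ltW eta0) x0); set f : R := r.+1`!%:R.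
have f0 : 0 < f by rewrite ltr0n fact_gt0.
have e0 : 0 < eta ^+ r.+1 by rewrite exprn_gt0.
move=> h; rewrite mulrDl mul1r; apply: le_trans (_ : f / eta ^+ r.+1 * expR (eta * x) <= _); last first.
  by rewrite lerDr expR_ge0.
rewrite -[leLHS]mul1r -ler_pdivrMl ?divr_gt0// invf_div mul1r.
apply: le_trans h; rewrite exprMn mulrAC lerDr; exact: ler01.
Qed.

End exponential_drift.

(** * One slot of the switch *)

(* The name is also that of a predicate on matrices over closed fields. *)
Local Notation realmx := Defs.realmx.

Section switch_step.
Variables (R : realType) (n : nat).
Implicit Types (q a : 'M[nat]_n) (s : 'S_n).

Definition schedule_mx s : 'M[R]_n := perm_mx s.

Definition switch_step q a s : 'M[nat]_n :=
  (\matrix_(i, j) (q i j + a i j - (perm_mx s : 'M[nat]_n) i j))%N.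

Definition unused_service q a s : 'M[nat]_n :=
  (\matrix_(i, j) ((perm_mx s : 'M[nat]_n) i j - (q i j + a i j)))%N.

Definition total q : nat := (\sum_i \sum_j q i j)%N.

(** Optimality up to a constant is what remains of a MaxWeight schedule after a
    bounded delay. *)
Definition near_max (b : nat) q s := forall s' : 'S_n, (weight q s' <= weight q s + b)%N.

Lemma perm_mx_nat s i j : (perm_mx s : 'M[nat]_n) i j = (s i == j) :> nat.
Proof. by rewrite !mxE; case: eqP. Qed.

Lemma switch_stepE q a s i j : switch_step q a s i j = (q i j + a i j - (s i == j))%N.
Proof. by rewrite mxE perm_mx_nat. Qed.

Lemma unused_serviceE q a s i j :
  unused_service q a s i j = ((s i == j) - (q i j + a i j))%N.
Proof. by rewrite mxE perm_mx_nat. Qed.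

Lemma schedule_mxE s i j : schedule_mx s i j = (s i == j)%:R.
Proof. by rewrite !mxE. Qed.

Lemma weightE q s : weight q s = (\sum_i q i (s i))%N.
Proof.
apply: eq_bigr => i _; rewrite (bigD1 (s i))//= perm_mx_nat eqxx muln1 big1 ?addn0//.
by move=> j; rewrite perm_mx_nat eq_sym => /negbTE ->; rewrite muln0.
Qed.

Lemma dotm_schedule (x : 'M[R]_n) s : dotm x (schedule_mx s) = \sum_i x i (s i).
Proof.
apply: eq_bigr => i _; rewrite (bigD1 (s i))//= schedule_mxE eqxx mulr1 big1 ?addr0//.
by move=> j; rewrite schedule_mxE eq_sym => /negbTE ->; rewrite mulr0.
Qed.

Lemma realmx_ge0 q i j : 0 <= realmx R q i j.
Proof. by rewrite mxE. Qed.

(** MaxWeight is as good as any doubly substochastic service, by Birkhoff. *)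
Lemma near_max_dotm b q s (x : 'M[R]_n) : near_max b q s ->
  (forall i j, 0 <= x i j) -> (forall i, \sum_j x i j <= 1) -> (forall j, \sum_i x i j <= 1) ->
  dotm (realmx R q) x <= dotm (realmx R q) (schedule_mx s) + b%:R.
Proof.
move=> near x0 rows cols; apply: substochastic_max => // [i j|s'].
  exact: realmx_ge0.
rewrite dotm_schedule.
under eq_bigr => i _ do rewrite mxE; under [X in _ <= X + _]eq_bigr => i _ do rewrite mxE.
by rewrite -!natr_sum -natrD ler_nat; have := near s'; rewrite !weightE.
Qed.

(** Doubly stochastic matrices have the same row and column sums, which is all that
    an element of the space generated by the cone sees. *)
Lemma dotm_space_S (x nu : 'M[R]_n) s : space_S x -> doubly_stochastic nu ->
  dotm x (nu - schedule_mx s) = 0.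
Proof.
move=> [v [v' xE]] [_ rows cols]; rewrite dotmBr dotm_schedule /dotm.
apply/eqP; rewrite subr_eq0; apply/eqP.
under eq_bigr => i _ do under eq_bigr => j _ do rewrite xE mulrDl.
under eq_bigr => i _ do rewrite big_split/= -mulr_sumr rows mulr1.
under [RHS]eq_bigr => i _ do rewrite xE.
rewrite !big_split/=; congr (_ + _); rewrite exchange_big/=.
under eq_bigr => j _ do rewrite -mulr_sumr cols mulr1.
by rewrite (reindex_inj (@perm_inj _ s)).
Qed.

Lemma natr_truncB (x y : nat) : ((x - y)%N)%:R = x%:R - y%:R + ((y - x)%N)%:R :> R.
Proof.
case: (leqP x y) => [|/ltnW] xy; rewrite (natrB _ xy) (eqP (xy : (_ - _)%N == 0)%N); ring.
Qed.

Lemma realmx_step q a s : realmx R (switch_step q a s) =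
  realmx R q + (realmx R a - schedule_mx s + realmx R (unused_service q a s)).
Proof.
apply/matrixP => i j; rewrite [LHS]mxE switch_stepE natr_truncB natrD.
rewrite -unused_serviceE !mxE; ring.
Qed.

Lemma unused_le1 q a s i j : (unused_service q a s i j <= 1)%N.
Proof. by rewrite unused_serviceE; case: (s i == j); lia. Qed.

Lemma unused_pos q a s i j : (0 < unused_service q a s i j)%N ->
  q i j = 0%N /\ switch_step q a s i j = 0%N.
Proof. by rewrite unused_serviceE switch_stepE; case: (s i == j) => /=; lia. Qed.

Lemma dotm_unused q a s : dotm (realmx R q) (realmx R (unused_service q a s)) = 0.
Proof.
rewrite /dotm big1// => i _; rewrite big1// => j _.
rewrite [X in X * _]mxE [X in _ * X]mxE.
by have [->|/unused_pos[-> _]] := posnP (unused_service q a s i j); rewrite ?mulr0 ?mul0r.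
Qed.

Lemma dotm_step_unused q a s :
  dotm (realmx R (switch_step q a s)) (realmx R (unused_service q a s)) = 0.
Proof.
rewrite /dotm big1// => i _; rewrite big1// => j _; rewrite [X in X * _]mxE [X in _ * X]mxE.
by have [->|/unused_pos[_ ->]] := posnP (unused_service q a s i j); rewrite ?mulr0 ?mul0r.
Qed.

Lemma dotm_unused_sqr q a s :
  dotm (realmx R (unused_service q a s)) (realmx R (unused_service q a s)) =
  \sum_i \sum_j realmx R (unused_service q a s) i j.
Proof.
apply: eq_bigr => i _; apply: eq_bigr => j _; rewrite ![realmx _ _ _ _]mxE -natrM.
by have := unused_le1 q a s i j; case: (unused_service _ _ _ _ _) => [|[|]].
Qed.

Section bounded_arrivals.
Variable amax : nat.

Definition increment_bound : R := n%:R * amax.+1%:R.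

Lemma step_increment q a s : (forall i j, (a i j <= amax)%N) ->
  frob_norm (realmx R a - schedule_mx s + realmx R (unused_service q a s)) <= increment_bound.
Proof.
move=> ab; apply: frob_norm_bound => i j; set d := _ - _ + _.
have -> : d = realmx R (switch_step q a s) - realmx R q by rewrite realmx_step addrC addKr.
rewrite mxE [X in _ + X]mxE ![realmx _ _ _ _]mxE.
rewrite switch_stepE ler_norml.
have := ab i j; set A := a i j; set Q := q i j => AA; set b : nat := (s i == j).
have b1 : (b <= 1)%N by rewrite /b; case: (s i == j).
rewrite lerBlDr lerNl opprB lerBlDr -!natrD !ler_nat; lia.
Qed.

(** The unused service is zero where the queue is positive, so that it does not
    increase the distance to a matrix with nonnegative entries: both to 0 and to the
    projection onto the cone. *)
Lemma step_dist (p : 'M[R]_n) q a s : (forall i j, (a i j <= amax)%N) ->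
  (forall i j, 0 <= p i j) ->
  frob_norm (realmx R (switch_step q a s) - p) ^+ 2 <=
  frob_norm (realmx R q - p) ^+ 2
    + 2 * dotm (realmx R q - p) (realmx R a - schedule_mx s) + increment_bound ^+ 2.
Proof.
move=> ab p0; rewrite realmx_step addrAC sqr_frob_norm dotmD2 -!sqr_frob_norm.
set d := realmx R a - _ + _; have dB : frob_norm d ^+ 2 <= increment_bound ^+ 2.
  by rewrite ler_pXn2r ?nnegrE ?frob_norm_ge0 ?mulr_ge0// step_increment.
apply: lerD dB; rewrite lerD2l /d dotmDr [X in _ + X]dotmBl dotm_unused sub0r -[leLHS]mulr_natl.
rewrite ler_wpM2l// gerBl dotm_ge0// => i j; exact: realmx_ge0.
Qed.

Lemma step_lip (W : 'M[nat]_n -> R) q a s : (forall i j, (a i j <= amax)%N) ->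
  (forall q q', W q' <= W q + frob_norm (realmx R q' - realmx R q)) ->
  `|W (switch_step q a s) - W q| <= increment_bound.
Proof.
move=> ab lip; have := step_increment q s ab; set d := _ - _ + _ => dB.
have e : realmx R (switch_step q a s) - realmx R q = d.
  by rewrite realmx_step addrC addKr.
rewrite ler_norml; apply/andP; split.
  rewrite lerBrDr addrC lerBlDr (le_trans (lip (switch_step q a s) q))// lerD2l.
  by rewrite -frob_normN opprB e.
by rewrite lerBlDl (le_trans (lip q (switch_step q a s)))// lerD2l e.
Qed.

End bounded_arrivals.

Hypothesis n0 : (0 < n)%N.

Lemma norm_lip q q' :
  frob_norm (realmx R q') <= frob_norm (realmx R q) + frob_norm (realmx R q' - realmx R q).
Proof. by apply: le_trans (frob_normD _ _); rewrite subrKC. Qed.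

Lemma perp_lip q q' : frob_norm (perp_K (realmx R q')) <=
  frob_norm (perp_K (realmx R q)) + frob_norm (realmx R q' - realmx R q).
Proof.
have [Kp _] := proj_K_prop n0 (realmx R q).
apply: le_trans (perp_K_le n0 _ Kp) _; apply: le_trans (frob_normD _ _).
by rewrite [X in _ <= frob_norm X]addrC addrA subrK.
Qed.

End switch_step.

(** * Drift of the queues under a nearly maximal schedule *)

Section drift.
Variables (R : realType) (n : nat).
Implicit Types (x y : 'M[R]_n) (q : 'M[nat]_n) (s : 'S_n).

Definition entry_sum x : R := \sum_i \sum_j x i j.

Lemma entry_sumE x : entry_sum x = dotm x (const_mx 1).
Proof. by apply: eq_bigr => i _; apply: eq_bigr => j _; rewrite mxE mulr1. Qed.

Lemma frob_norm_le_sum x : (forall i j, 0 <= x i j) -> frob_norm x <= entry_sum x.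
Proof.
move=> x0; have s0 : 0 <= entry_sum x by apply: sumr_ge0 => i _; exact: sumr_ge0.
rewrite -(@ler_pXn2r _ 2) ?nnegrE ?frob_norm_ge0// sqr_frob_norm expr2 mulr_suml.
apply: ler_sum => i _; rewrite mulr_suml; apply: ler_sum => j _; rewrite ler_wpM2l//.
rewrite /entry_sum (bigD1 i)//= (bigD1 j)//= -addrA lerDl addr_ge0 ?sumr_ge0//.
by move=> i' _; exact: sumr_ge0.
Qed.

Lemma sqr_le_sqr (u v : R) : 0 <= u -> u <= v -> u ^+ 2 <= v ^+ 2.
Proof. by move=> u0 uv; rewrite lerXn2r ?nnegrE// (le_trans u0). Qed.

Section mean_arrivals.
Variables (A : finType) (w : A -> R) (arr : A -> 'M[nat]_n) (amax : nat).
Variables (nu : 'M[R]_n) (e vmin : R).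
Hypotheses (w_ge0 : forall a, 0 <= w a) (w_sum1 : \sum_a w a = 1)
  (arr_le : forall a i j, (arr a i j <= amax)%N)
  (arr_mean : forall i j, \sum_a w a * (arr a i j)%:R = (1 - e) * nu i j)
  (nu_ds : doubly_stochastic nu) (vmin0 : 0 < vmin) (nu_min : forall i j, vmin <= nu i j)
  (e0 : 0 < e) (e1 : e < 1).

Lemma mean_dotm x : \sum_a w a * dotm x (realmx R (arr a)) = (1 - e) * dotm x nu.
Proof.
rewrite -dotmZr /dotm; under eq_bigr => a _ do rewrite mulr_sumr.
rewrite exchange_big/=; apply: eq_bigr => i _.
under eq_bigr => a _ do rewrite mulr_sumr.
rewrite exchange_big/=; apply: eq_bigr => j _.
under eq_bigr => a _ do rewrite mxE mulrCA.
by rewrite -mulr_sumr arr_mean mxE.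
Qed.

Lemma mean_cst (b : R) : \sum_a w a * b = b.
Proof. by rewrite -mulr_suml w_sum1 mul1r. Qed.

Lemma mean_dotm_net x s : \sum_a w a * dotm x (realmx R (arr a) - schedule_mx R s) =
  dotm x (nu - schedule_mx R s) - e * dotm x nu.
Proof.
under eq_bigr => a _ do rewrite dotmBr mulrBr.
by rewrite sumrB mean_dotm mean_cst dotmBr; ring.
Qed.

Definition drift_const (b : nat) : R := b%:R + (increment_bound R n amax) ^+ 2 / 2.

Lemma mean_le_drift (f g : A -> R) : (forall a, f a <= g a) ->
  \sum_a w a * f a <= \sum_a w a * g a.
Proof. by move=> h; apply: ler_sum => a _; rewrite ler_wpM2l. Qed.

Lemma near_max_nu b q s : near_max b q s ->
  dotm (realmx R q) (nu - schedule_mx R s) <= b%:R.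
Proof.
have [nu0 rows cols] := nu_ds; move=> near.
by rewrite dotmBr lerBlDl near_max_dotm// => i; rewrite ?rows ?cols.
Qed.

(** A nearly maximal schedule serves at least as much weight as [nu], up to [b], and
    the arrivals bring only (1 - e) * nu: the spare capacity e * nu acts on every
    queue. *)
Lemma norm_drift b q s : near_max b q s ->
  \sum_a w a * (frob_norm (realmx R (switch_step q (arr a) s)) ^+ 2
                - frob_norm (realmx R q) ^+ 2) <=
  - (2 * (e * vmin) * frob_norm (realmx R q)) + 2 * drift_const b.
Proof.
move=> near; set Q := realmx R q.
apply: le_trans (_ : \sum_a w a * (2 * dotm Q (realmx R (arr a) - schedule_mx R s)
    + (increment_bound R n amax) ^+ 2) <= _).
  apply: mean_le_drift => a; rewrite lerBlDl addrA.
  have := @step_dist R n amax 0 q (arr a) s (arr_le a) (fun i j => _).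
  by rewrite !subr0; apply => i j; rewrite mxE.
under eq_bigr => a _ do rewrite mulrDr mulrCA.
rewrite big_split/= -mulr_sumr mean_dotm_net mean_cst /drift_const.
have := near_max_nu near; rewrite -/Q => h1.
have h2 : vmin * frob_norm Q <= dotm Q nu.
  apply: le_trans (_ : vmin * entry_sum Q <= _).
    by rewrite ler_wpM2l ?(ltW vmin0)// frob_norm_le_sum// => i j; rewrite mxE.
  rewrite entry_sumE -dotmZr; apply: le_dotm => i j; first by rewrite mxE.
  by rewrite !mxE mulr1.
have := ler_wpM2l (ltW e0) h2; rewrite mulrA.
by move=> h3; lra.
Qed.

Hypothesis n0 : (0 < n)%N.

Lemma row_cone (i : 'I_n) : cone_K (\matrix_(k, j) (k == i)%:R : 'M[R]_n).
Proof.
split=> [|k j]; last by rewrite mxE.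
by exists (fun k => (k == i)%:R), (fun=> 0) => k j; rewrite mxE addr0.
Qed.

Lemma col_cone (i : 'I_n) : cone_K (\matrix_(k, j) (j == i)%:R : 'M[R]_n).
Proof.
split=> [|k j]; last by rewrite mxE.
by exists (fun=> 0), (fun j => (j == i)%:R) => k j; rewrite mxE add0r.
Qed.

Lemma perp_row_sum x i : \sum_j perp_K x i j <= 0.
Proof.
apply: le_trans (perp_K_polar n0 x (row_cone i)).
rewrite /dotm [leRHS](bigD1 i)//=.
rewrite [X in _ + X]big1 ?addr0 => [|k /negbTE ki]; last first.
  by rewrite big1// => j _; rewrite mxE ki mulr0.
by apply: ler_sum => j _; rewrite [X in _ * X]mxE eqxx mulr1.
Qed.

Lemma perp_col_sum x j : \sum_i perp_K x i j <= 0.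
Proof.
apply: le_trans (perp_K_polar n0 x (col_cone j)); rewrite /dotm.
apply: ler_sum => i _; rewrite (bigD1 j)//= [X in _ * X]mxE eqxx mulr1.
by rewrite big1 ?addr0// => k /negbTE kj; rewrite mxE kj mulr0.
Qed.

(** Moving the doubly stochastic matrix [nu] by vmin in the direction of the
    residual of [q] keeps it substochastic, because row and column sums of the
    residual are nonpositive: a nearly maximal schedule must beat it. *)
Lemma near_max_perp b q s : near_max b q s ->
  dotm (perp_K (realmx R q)) (nu - schedule_mx R s) <=
  b%:R - vmin * frob_norm (perp_K (realmx R q)).
Proof.
have [nu0 rows cols] := nu_ds; move=> near; set Q := realmx R q; set r := perp_K Q.
have [[Sp _] _] := proj_K_prop n0 Q.
have -> : dotm r (nu - schedule_mx R s) = dotm Q (nu - schedule_mx R s).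
  by rewrite /r /perp_K dotmBl (dotm_space_S s Sp nu_ds) subr0.
have [r0|r0] := eqVneq (frob_norm r) 0.
  by rewrite r0 mulr0 subr0; exact: near_max_nu.
have rp : 0 < frob_norm r by rewrite lt_neqAle eq_sym r0 frob_norm_ge0.
pose t := vmin / frob_norm r; have t0 : 0 < t by rewrite divr_gt0.
have sums (u : 'I_n -> R) : \sum_j u j <= 0 -> 1 + t * (\sum_j u j) <= 1.
  by move=> u0; rewrite gerDl mulr_ge0_le0// ltW.
have := @near_max_dotm R n b q s (nu + t *: r) near.
have Qr : dotm Q r = frob_norm r ^+ 2.
  rewrite sqr_frob_norm -[in LHS](subrK (proj_K Q) Q) dotmDl dotmC -/r.
  by rewrite [dotm _ r]dotmC perp_K_proj// addr0 dotmC.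
have tr : t * frob_norm r ^+ 2 = vmin * frob_norm r.
  by rewrite /t expr2 mulrA divfK.
rewrite dotmDr dotmZr -/Q Qr tr dotmBr => h; rewrite lerBrDr addrAC lerBlDl.
apply: h => [i j|i|j].
- have := entry_frob_norm r i j; rewrite ler_norml => /andP[lo _].
  rewrite mxE [X in _ + X]mxE; have := nu_min i j.
  have : t * - frob_norm r <= t * r i j by rewrite ler_wpM2l ?(ltW t0).
  by rewrite mulrN /t divfK//; lra.
- under eq_bigr => j _ do rewrite mxE [X in _ + X]mxE.
  by rewrite big_split/= rows -mulr_sumr sums// perp_row_sum.
- under eq_bigr => i _ do rewrite mxE [X in _ + X]mxE.
  by rewrite big_split/= cols -mulr_sumr sums// perp_col_sum.
Qed.

(** The old projection competes with the new one, so that the distance to it bounds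
    the new distance to the cone.  The load enters only through e * <r, nu>, where r
    is the residual; for small e this is absorbed by half of the drift. *)
Lemma perp_drift b q s : near_max b q s -> e * frob_norm nu <= vmin / 2 ->
  \sum_a w a * (frob_norm (perp_K (realmx R (switch_step q (arr a) s))) ^+ 2
                - frob_norm (perp_K (realmx R q)) ^+ 2) <=
  - (2 * (vmin / 2) * frob_norm (perp_K (realmx R q))) + 2 * drift_const b.
Proof.
move=> near small; set Q := realmx R q; set r := perp_K Q.
have [Kp _] := proj_K_prop n0 Q.
apply: le_trans (_ : \sum_a w a * (2 * dotm r (realmx R (arr a) - schedule_mx R s)
    + (increment_bound R n amax) ^+ 2) <= _).
  apply: mean_le_drift => a; rewrite lerBlDl addrA.
  apply: le_trans (_ : frob_norm (realmx R (switch_step q (arr a) s) - proj_K Q) ^+ 2 <= _).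
    have le1 := perp_K_le n0 (realmx R (switch_step q (arr a) s)) Kp.
    by apply: sqr_le_sqr le1; exact: frob_norm_ge0.
  by apply: step_dist => // i j; exact: proj_K_ge0.
under eq_bigr => a _ do rewrite mulrDr mulrCA.
rewrite big_split/= -mulr_sumr mean_dotm_net mean_cst /drift_const.
have := near_max_perp near; rewrite -/Q -/r => h1.
have h2 : - dotm r nu <= frob_norm r * frob_norm nu.
  by rewrite -dotmNl -(frob_normN r) cauchy_schwarz.
have h3 := ler_wpM2l (ltW e0) h2.
have h4 := ler_wpM2r (frob_norm_ge0 r) small.
have h5 : e * (frob_norm r * frob_norm nu) <= vmin / 2 * frob_norm r.
  by rewrite mulrCA mulrC.
rewrite mulrN in h3.
have -> : 2 * (vmin / 2) * frob_norm r = vmin * frob_norm r by field.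
have e5 : vmin / 2 * frob_norm r = vmin * frob_norm r / 2 by ring.
rewrite e5 in h5; have {h3} := le_trans h3 h5.
by move=> h3; lra.
Qed.

End mean_arrivals.
End drift.

(** * The quadratic test function of the heavy-traffic limit *)

Section row_column_projection.
Variables (R : realType) (n : nat).
Hypothesis n0 : (0 < n)%N.
Implicit Types (x y z : 'M[R]_n).

(** Orthogonal projection onto the span of the row and column indicators. *)
Definition proj_S x : 'M[R]_n := \matrix_(i, j)
  ((\sum_j' x i j') / n%:R + (\sum_i' x i' j) / n%:R - entry_sum x / n%:R ^+ 2).

Lemma proj_SE x i j : proj_S x i j =
  (\sum_j' x i j') / n%:R + (\sum_i' x i' j) / n%:R - entry_sum x / n%:R ^+ 2.
Proof. by rewrite mxE. Qed.

Let nR0 : n%:R != 0 :> R.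
Proof. by rewrite pnatr_eq0 -lt0n. Qed.

Lemma dotm_proj_S x y : dotm (proj_S x) y =
  (\sum_i (\sum_j x i j) * (\sum_j y i j)) / n%:R +
  (\sum_j (\sum_i x i j) * (\sum_i y i j)) / n%:R - entry_sum x * entry_sum y / n%:R ^+ 2.
Proof.
rewrite /dotm.
under eq_bigr => i _ do under eq_bigr => j _ do rewrite mxE mulrBl mulrDl.
under eq_bigr => i _ do rewrite sumrB big_split/= -!mulr_sumr.
rewrite sumrB big_split/= -mulr_sumr; congr (_ + _ - _).
- by rewrite mulr_suml; apply: eq_bigr => i _; rewrite mulrAC.
- rewrite exchange_big mulr_suml; apply: eq_bigr => j _ /=.
  by rewrite -mulr_sumr mulrAC.
- by rewrite mulrAC.
Qed.

Lemma proj_S_sym x y : dotm (proj_S x) y = dotm x (proj_S y).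
Proof.
rewrite [RHS]dotmC !dotm_proj_S; congr (_ / _ + _ / _ - _ / _); last exact: mulrC.
  by apply: eq_bigr => i _; rewrite mulrC.
by apply: eq_bigr => i _; rewrite mulrC.
Qed.

Lemma proj_S_fix x : space_S x -> proj_S x = x.
Proof.
move=> [v [v' xE]]; apply/matrixP => i j.
have row k : \sum_l x k l = n%:R * v k + \sum_l v' l.
  under eq_bigr => l _ do rewrite xE.
  by rewrite big_split/= sumr_const card_ord -[in LHS](mulr_natl (v k)).
have col k : \sum_l x l k = \sum_l v l + n%:R * v' k.
  under eq_bigr => l _ do rewrite xE.
  by rewrite big_split/= sumr_const card_ord -[in LHS](mulr_natl (v' k)).
have tot : entry_sum x = n%:R * (\sum_l v l + \sum_l v' l).
  rewrite /entry_sum; under eq_bigr => l _ do rewrite row.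
  by rewrite big_split/= -mulr_sumr sumr_const card_ord -(mulr_natl (\sum_l v' l)) mulrDr.
rewrite mxE row col tot xE; move: (\sum_l v l) (\sum_l v' l) => u u'.
by field.
Qed.

Lemma proj_S_in x : space_S (proj_S x).
Proof.
exists (fun i => (\sum_j' x i j') / n%:R - entry_sum x / n%:R ^+ 2),
  (fun j => (\sum_i' x i' j) / n%:R) => i j.
by rewrite mxE addrAC.
Qed.

Lemma dotm_proj_Sr x y : dotm x (proj_S y) = dotm (proj_S x) (proj_S y).
Proof. by rewrite proj_S_sym (proj_S_fix (proj_S_in y)). Qed.

Lemma dotm_proj_S_ge0 x : 0 <= dotm x (proj_S x).
Proof. by rewrite dotm_proj_Sr dotmm_ge0. Qed.

Lemma dotm_sub_proj_S x :
  dotm (x - proj_S x) (x - proj_S x) = dotm x x - dotm x (proj_S x).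
Proof. by rewrite dotmB2 -dotm_proj_Sr; ring. Qed.

Lemma dotm_proj_S_le x : dotm x (proj_S x) <= dotm x x.
Proof. by rewrite -subr_ge0 -dotm_sub_proj_S dotmm_ge0. Qed.

Lemma proj_SB x y z : dotm (proj_S (x - y)) z = dotm (proj_S x) z - dotm (proj_S y) z.
Proof. by rewrite !proj_S_sym dotmBl. Qed.

Lemma proj_SD x y z : dotm (proj_S (x + y)) z = dotm (proj_S x) z + dotm (proj_S y) z.
Proof. by rewrite !proj_S_sym dotmDl. Qed.

Lemma quad_proj_SD x y : dotm (x + y) (proj_S (x + y)) =
  dotm x (proj_S x) + 2 * dotm (proj_S x) y + dotm y (proj_S y).
Proof.
rewrite -!proj_S_sym proj_SD !dotmDr [dotm (proj_S y) x]proj_S_sym [dotm y (proj_S x)]dotmC.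
ring.
Qed.

Lemma quad_proj_SB x y : dotm (x - y) (proj_S (x - y)) =
  dotm x (proj_S x) - 2 * dotm (proj_S x) y + dotm y (proj_S y).
Proof.
rewrite -!proj_S_sym proj_SB !dotmBr [dotm (proj_S y) x]proj_S_sym [dotm y (proj_S x)]dotmC.
ring.
Qed.

Lemma proj_S_doubly_stochastic nu x : doubly_stochastic nu ->
  dotm (proj_S x) nu = entry_sum x / n%:R.
Proof.
move=> [_ rows cols]; rewrite dotm_proj_S.
under eq_bigr => i _ do rewrite rows mulr1.
under [X in _ + X / _ - _]eq_bigr => j _ do rewrite cols mulr1.
have -> : entry_sum nu = n%:R.
  by rewrite /entry_sum; under eq_bigr => i _ do rewrite rows; rewrite sumr_const card_ord.
have -> : \sum_j \sum_i x i j = entry_sum x by rewrite exchange_big.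
by rewrite -/(entry_sum x); field.
Qed.

Lemma young_dotm (del : R) x y : 0 < del ->
  `|2 * dotm x y| <= del * dotm x x + dotm y y / del.
Proof.
move=> d0; have sq (c : R) : 0 <= del^-1 * dotm (del *: x + c *: y) (del *: x + c *: y).
  by rewrite mulr_ge0 ?dotmm_ge0// invr_ge0 ltW.
have E (c : R) : c ^+ 2 = 1 -> del^-1 * dotm (del *: x + c *: y) (del *: x + c *: y) =
    del * dotm x x + dotm y y / del + c * (2 * dotm x y).
  move=> c2; rewrite dotmD2 !(dotmZl, dotmZr) [c * (c * _)]mulrA -expr2 c2.
  by field; rewrite gt_eqF.
have := sq 1; have := sq (-1); rewrite !E ?sqrrN ?expr1n// ler_norml; lra.
Qed.

End row_column_projection.

Section quadratic_drift.
Variables (R : realType) (n : nat) (A : finType) (w : A -> R) (arr : A -> 'M[nat]_n).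
Variables (nu : 'M[R]_n) (e : R).
Hypotheses (n0 : (0 < n)%N) (w_ge0 : forall a, 0 <= w a) (w_sum1 : \sum_a w a = 1)
  (arr_mean : forall i j, \sum_a w a * (arr a i j)%:R = (1 - e) * nu i j)
  (nu_ds : doubly_stochastic nu).

Let dev (a : A) : 'M[R]_n := realmx R (arr a) - (1 - e) *: nu.

Hypothesis arr_uncorrelated : forall i j k l, (i, j) != (k, l) ->
  \sum_a w a * (dev a i j * dev a k l) = 0.

Definition arrival_var i j : R := \sum_a w a * dev a i j ^+ 2.

Let nR0 : n%:R != 0 :> R.
Proof. by rewrite pnatr_eq0 -lt0n. Qed.

Lemma dev_mean x : \sum_a w a * dotm x (dev a) = 0.
Proof.
under eq_bigr => a _ do rewrite dotmBr mulrBr.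
rewrite sumrB (mean_dotm arr_mean) (mean_cst w_sum1) dotmZr subrr//.
Qed.

(** Entries being uncorrelated, only the diagonal of the projection counts; all
    its entries are 2/n - 1/n^2. *)
Lemma mean_quad_dev : \sum_a w a * dotm (dev a) (proj_S (dev a)) =
  (2 / n%:R - n%:R ^- 2) * \sum_i \sum_j arrival_var i j.
Proof.
have row i j : \sum_a w a * (dev a i j * \sum_j' dev a i j') = arrival_var i j.
  under eq_bigr => a _ do rewrite mulr_sumr mulr_sumr.
  rewrite exchange_big/= (bigD1 j)//= [X in _ + X]big1 ?addr0 => [|k kj].
    by rewrite /arrival_var; apply: eq_bigr => a _; rewrite expr2.
  by apply: arr_uncorrelated; rewrite xpair_eqE eqxx eq_sym.
have col i j : \sum_a w a * (dev a i j * \sum_i' dev a i' j) = arrival_var i j.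
  under eq_bigr => a _ do rewrite mulr_sumr mulr_sumr.
  rewrite exchange_big/= (bigD1 i)//= [X in _ + X]big1 ?addr0 => [|k ki].
    by rewrite /arrival_var; apply: eq_bigr => a _; rewrite expr2.
  by apply: arr_uncorrelated; rewrite xpair_eqE eqxx andbT eq_sym.
have tot i j : \sum_a w a * (dev a i j * entry_sum (dev a)) = arrival_var i j.
  under eq_bigr => a _ do rewrite mulr_sumr mulr_sumr.
  rewrite exchange_big/= (bigD1 i)//= [X in _ + X]big1 ?addr0 => [|k ki].
    exact: row.
  under eq_bigr => a _ do rewrite mulr_sumr mulr_sumr.
  rewrite exchange_big/= big1// => l _.
  by apply: arr_uncorrelated; rewrite xpair_eqE eq_sym (negbTE ki).
rewrite mulr_sumr /dotm.
under eq_bigr => a _ do rewrite mulr_sumr.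
rewrite exchange_big/=; apply: eq_bigr => i _; rewrite mulr_sumr.
under eq_bigr => a _ do rewrite mulr_sumr.
rewrite exchange_big/=; apply: eq_bigr => j _.
rewrite (eq_bigr (fun a => w a * (dev a i j * \sum_j' dev a i j') / n%:R
    + w a * (dev a i j * \sum_i' dev a i' j) / n%:R
    - w a * (dev a i j * entry_sum (dev a)) / n%:R ^+ 2)) => [|a _]; last first.
  by rewrite proj_SE; ring.
rewrite sumrB big_split/= -!mulr_suml row col tot; by field.
Qed.

Implicit Types (q : 'M[nat]_n) (s : 'S_n).

Definition quad q : R := dotm (realmx R q) (proj_S (realmx R q)).

Lemma entry_sum_doubly_stochastic (x : 'M[R]_n) :
  doubly_stochastic x -> entry_sum x = n%:R.
Proof.
move=> [_ rows _]; rewrite /entry_sum; under eq_bigr => i _ do rewrite rows.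
by rewrite sumr_const card_ord.
Qed.

Lemma schedule_doubly_stochastic s : doubly_stochastic (schedule_mx R s).
Proof.
split=> [i j|i|j]; first by rewrite schedule_mxE ler0n.
  rewrite (bigD1 (s i))//= schedule_mxE eqxx big1 ?addr0// => j.
  by rewrite schedule_mxE eq_sym => /negbTE ->.
rewrite (bigD1 (s^-1%g j))//= schedule_mxE permKV eqxx big1 ?addr0// => i ij.
by rewrite schedule_mxE; have [sij|//] := eqVneq (s i) j; rewrite -sij permK eqxx in ij.
Qed.

Lemma quad_net s : let net := (1 - e) *: nu - schedule_mx R s in
  dotm net (proj_S net) = e ^+ 2.
Proof.
move=> net; rewrite -(proj_S_sym net net) dotm_proj_S.
have [_ rows cols] := nu_ds; have [_ srows scols] := schedule_doubly_stochastic s.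
have rnet i : \sum_j net i j = - e.
  under eq_bigr => j _ do rewrite mxE [X in _ + X]mxE [X in X - _]mxE.
  by rewrite sumrB -mulr_sumr rows srows; ring.
have cnet j : \sum_i net i j = - e.
  under eq_bigr => i _ do rewrite mxE [X in _ + X]mxE [X in X - _]mxE.
  by rewrite sumrB -mulr_sumr cols scols; ring.
have -> : entry_sum net = n%:R * - e.
  rewrite /entry_sum; under eq_bigr => i _ do rewrite rnet.
  by rewrite sumr_const card_ord [RHS]mulr_natl.
under eq_bigr => i _ do rewrite rnet.
under [X in _ + X / _ - _]eq_bigr => j _ do rewrite cnet.
rewrite sumr_const card_ord -(mulr_natl (- e * - e)).
by field.
Qed.

(** Packets are conserved: the service that is not used is the service offered, minus
    what arrives, plus the growth of the queues. *)
Lemma mean_unused q s :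
  \sum_a w a * entry_sum (realmx R (unused_service q (arr a) s)) =
  \sum_a w a * entry_sum (realmx R (switch_step q (arr a) s))
    - entry_sum (realmx R q) + n%:R * e.
Proof.
have point a : entry_sum (realmx R (switch_step q (arr a) s)) =
    entry_sum (realmx R q) - n%:R + dotm (const_mx 1) (realmx R (arr a))
    + entry_sum (realmx R (unused_service q (arr a) s)).
  have := entry_sum_doubly_stochastic (schedule_doubly_stochastic s).
  rewrite !entry_sumE realmx_step !dotmDl dotmNl [dotm (const_mx 1) _]dotmC => ->; ring.
under [in RHS]eq_bigr => a _ do rewrite point 2!mulrDr.
rewrite 2!big_split/= (mean_cst w_sum1) (mean_dotm arr_mean) dotmC -entry_sumE.
rewrite (entry_sum_doubly_stochastic nu_ds); ring.
Qed.

(** The error term of [quad_step]: the unused service is orthogonal to the new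
    queues, hence only meets their residual with respect to the cone. *)
Lemma unused_error (del : R) q a s : 0 < del ->
  `|2 * dotm (proj_S (realmx R (switch_step q a s))) (realmx R (unused_service q a s))
    - dotm (realmx R (unused_service q a s)) (proj_S (realmx R (unused_service q a s)))| <=
  del * frob_norm (perp_K (realmx R (switch_step q a s))) ^+ 2
    + (del^-1 + 1) * entry_sum (realmx R (unused_service q a s)).
Proof.
move=> d0; have := dotm_step_unused R q a s.
have := dotm_unused_sqr R q a s; rewrite -/(entry_sum _).
set Q := realmx R (switch_step q a s); set u := realmx R (unused_service q a s) => uu Qu.
have [[Sp _] _] := proj_K_prop n0 Q; rewrite -uu sqr_frob_norm; set r := perp_K Q.
have -> : dotm (proj_S Q) u = - dotm r (u - proj_S u).
  rewrite dotmBr -proj_S_sym /r /perp_K proj_SB (proj_S_fix n0 Sp) !dotmBl Qu.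
  by ring.
have := young_dotm r (u - proj_S u) d0; rewrite dotm_sub_proj_S//.
have := dotm_proj_S_ge0 n0 u; have := dotm_proj_S_le n0 u.
move: (dotm u (proj_S u)) (dotm u u) (dotm r (u - _)) (del * _) => pu u2 ru rr h1 h2.
have h3 : (u2 - pu) / del <= del^-1 * u2.
  by rewrite mulrC ler_wpM2l ?invr_ge0 ?(ltW d0)//; lra.
by rewrite mulrDl mul1r !ler_norml => /andP[h4 h5]; apply/andP; split; lra.
Qed.

(** The scalar product of the projection with the net service sees only line sums,
    which equal - e; the arrivals contribute their variance, and the unused service
    an error, split by Young's inequality with the weight [del]. *)
Lemma quad_step (del : R) q s : 0 < del ->
  `|\sum_a w a * quad (switch_step q (arr a) s) - (quad q
      - 2 * e / n%:R * entry_sum (realmx R q)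
      + (2 / n%:R - n%:R ^- 2) * (\sum_i \sum_j arrival_var i j) + e ^+ 2)| <=
  del * (\sum_a w a * frob_norm (perp_K (realmx R (switch_step q (arr a) s))) ^+ 2)
  + (del^-1 + 1) * (\sum_a w a * entry_sum (realmx R (switch_step q (arr a) s))
      - entry_sum (realmx R q) + n%:R * e).
Proof.
move=> d0; rewrite -mean_unused.
set Q := realmx R q; set net := (1 - e) *: nu - schedule_mx R s.
pose u a := realmx R (unused_service q (arr a) s).
pose Q' a := realmx R (switch_step q (arr a) s).
pose err a := 2 * dotm (proj_S (Q' a)) (u a) - dotm (u a) (proj_S (u a)).
have point a : quad (switch_step q (arr a) s) =
    quad q + 2 * dotm (proj_S Q) (realmx R (arr a) - schedule_mx R s)
    + (dotm (dev a) (proj_S (dev a)) + 2 * dotm (proj_S net) (dev a) + dotm net (proj_S net))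
    + err a.
  have netE : net + dev a = realmx R (arr a) - schedule_mx R s.
    by rewrite /net /dev addrC addrA subrK.
  have := quad_proj_SB (Q' a) (u a); rewrite {1 2}/Q' realmx_step -/(u a) addrA addrK.
  rewrite quad_proj_SD -netE quad_proj_SD netE /quad -/Q -/(Q' a) /err.
  by move=> e1; lra.
have -> : \sum_a w a * quad (switch_step q (arr a) s) = quad q
      - 2 * e / n%:R * entry_sum Q
      + (2 / n%:R - n%:R ^- 2) * (\sum_i \sum_j arrival_var i j) + e ^+ 2
      + \sum_a w a * err a.
  under eq_bigr => a _ do rewrite point 5!mulrDr [w a * (2 * _)]mulrCA
    [w a * (2 * dotm (proj_S net) _)]mulrCA.
  rewrite !big_split/= !(mean_cst w_sum1) -!mulr_sumr (mean_dotm_net w_sum1 arr_mean) dev_mean.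
  rewrite mean_quad_dev quad_net (dotm_space_S s (proj_S_in Q) nu_ds).
  rewrite (proj_S_doubly_stochastic n0 _ nu_ds); ring.
rewrite addrC addKr mulr_sumr mulr_sumr -big_split/=.
apply: le_trans (ler_norm_sum _ _ _) _; apply: ler_sum => a _.
rewrite normrM (ger0_norm (w_ge0 a)) mulrCA [X in _ + X]mulrCA -mulrDr ler_wpM2l//.
exact: unused_error.
Qed.

End quadratic_drift.

(** * The law of the chain driven by the arrivals *)

Section discrete_measurability.
Variables (T : Type) (M : set (set T)).
Hypothesis sM : sigma_algebra setT M.

Lemma sigma_bigcup (E : nat -> set T) : (forall k, M (E k)) -> M (\bigcup_k E k).
Proof. by case: sM => _ _ h /h. Qed.

Lemma sigma_setC (E : set T) : M E -> M (~` E).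
Proof. by case: sM => _ h _ /h; rewrite setTD. Qed.

Lemma sigma_set0 : M set0.
Proof. by case: sM. Qed.

Lemma sigma_exists (I : countType) (E : I -> set T) : (forall i, M (E i)) ->
  M [set w | exists i, E i w].
Proof.
move=> ME; pose F k := if unpickle k is Some i then E i else set0.
rewrite (_ : [set w | _] = \bigcup_k F k).
  by apply: sigma_bigcup => k; rewrite /F; case: unpickle => // *; exact: sigma_set0.
apply/seteqP; split=> [w [i Ei]|w [k _]].
  by exists (pickle i) => //; rewrite /F pickleK.
by rewrite /F; case: unpickle => // i Ei; exists i.
Qed.

Lemma sigma_forall (I : countType) (E : I -> set T) : (forall i, M (E i)) ->
  M [set w | forall i, E i w].
Proof.
move=> ME; rewrite (_ : [set w | _] = ~` [set w | exists i, (~` E i) w]).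
  by apply/sigma_setC/sigma_exists => i; exact: sigma_setC.
apply/seteqP; split=> w h.
  by move=> [i]; apply; exact: h.
by move=> i; apply: contrapT => nE; apply: h; exists i.
Qed.

Lemma sigma_const (Q : Prop) : M [set w | Q].
Proof.
have [q|q] := pselect Q.
  rewrite (_ : [set w | Q] = ~` set0); first by apply: sigma_setC; exact: sigma_set0.
  by apply/seteqP; split=> w // _ [].
by rewrite (_ : [set w | Q] = set0); [exact: sigma_set0|apply/seteqP; split].
Qed.

Lemma sigma_setI (E E' : set T) : M E -> M E' -> M (E `&` E').
Proof.
move=> ME ME'; rewrite (_ : _ `&` _ = [set w | forall b : bool, (if b then E else E') w]).
  by apply: sigma_forall => -[].
by apply/seteqP; split=> w; [case=> ? ? []|move=> h; split; [exact: (h true)|exact: (h false)]].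
Qed.

Lemma sigma_forall_if (I : countType) (Q : I -> Prop) (E : I -> set T) :
  (forall i, Q i -> M (E i)) -> M [set w | forall i, Q i -> E i w].
Proof.
move=> ME; apply: (@sigma_forall I (fun i => [set w | Q i -> E i w])) => i.
have [q|q] := pselect (Q i).
  rewrite (_ : [set w | _] = E i); first exact: ME.
  by apply/seteqP; split=> w h; [exact: (h q)|move=> _].
rewrite (_ : [set w | _] = [set w | True]); first exact: sigma_const.
by apply/seteqP; split=> w // _ /q.
Qed.

Definition discrete_rv (V : Type) (Y : T -> V) := forall B : set V, M (Y @^-1` B).

Lemma discrete_rvP (V : countType) (Y : T -> V) :
  (forall v, M [set w | Y w = v]) -> discrete_rv Y.
Proof.
move=> MY B; rewrite (_ : _ @^-1` _ = [set w | exists v, (Y w = v) /\ B v]).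
  apply: sigma_exists => v; exact: (sigma_setI (MY v) (sigma_const (B v))).
by apply/seteqP; split=> w; [move=> h; exists (Y w)|move=> [v [<-]]].
Qed.

Lemma discrete_rv_comp2 (V V' : countType) (W : Type) (Y : T -> V) (Y' : T -> V')
  (f : V -> V' -> W) : discrete_rv Y -> discrete_rv Y' ->
  discrete_rv (fun w => f (Y w) (Y' w)).
Proof.
move=> MY MY' B.
rewrite (_ : _ @^-1` _ = [set w | exists v : V * V', (Y w = v.1 /\ Y' w = v.2) /\ B (f v.1 v.2)]).
  apply: sigma_exists => v; apply: (sigma_setI _ (sigma_const (B (f v.1 v.2)))).
  exact: (sigma_setI (MY [set v.1]) (MY' [set v.2])).
apply/seteqP; split=> w; first by move=> h; exists (Y w, Y' w).
by move=> [[v v'] /= [[<- <-]]].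
Qed.

Lemma discrete_rv_cst (V : Type) (v : V) : discrete_rv (fun=> v).
Proof. by move=> B; exact: sigma_const. Qed.

End discrete_measurability.

Section arrival_noise.
Variables (R : realType) (n amax : nat) (d : measure_display) (T : measurableType d).
Variables (P : probability T R) (a : nat -> T -> 'M[nat]_n).
Hypothesis arrivals : arrival_process P a amax.

Definition noise_type : finType := {ffun 'I_n * 'I_n -> 'I_amax.+1}.

Definition noise_mx (al : noise_type) : 'M[nat]_n := \matrix_(i, j) nat_of_ord (al (i, j)).

Definition noise (t : nat) (w : T) : noise_type :=
  [ffun ij => inord (a t w ij.1 ij.2)].

Definition entry_pmf (ij : 'I_n * 'I_n) (k : 'I_amax.+1) : R :=
  fine (P [set w | a 0%N w ij.1 ij.2 = k]).

Definition noise_pmf (al : noise_type) : R := \prod_ij entry_pmf ij (al ij).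

Lemma noise_mx_le al i j : (noise_mx al i j <= amax)%N.
Proof. by rewrite mxE -ltnS ltn_ord. Qed.

Lemma noiseE t w ij : noise t w ij = a t w ij.1 ij.2 :> nat.
Proof. by rewrite ffunE inordK// ltnS (arrival_bounded arrivals). Qed.

Lemma noise_mxE t w : noise_mx (noise t w) = a t w.
Proof. by apply/matrixP => i j; rewrite mxE noiseE. Qed.

Lemma noise_eqP t w al :
  noise t w = al <-> forall ij, a t w ij.1 ij.2 = al ij.
Proof.
split=> [<- ij|h]; first by rewrite noiseE.
by apply/ffunP => ij; apply: val_inj; rewrite /= noiseE h.
Qed.

Let sigmaT : sigma_algebra setT (@measurable d T).
Proof. exact: sigma_algebra_measurable. Qed.

Lemma noise_rv t : discrete_rv (@measurable d T) (noise t).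
Proof.
apply: (discrete_rvP sigmaT) => al.
rewrite (_ : [set w | _] = [set w | forall ij, a t w ij.1 ij.2 = al ij]).
  apply: (sigma_forall sigmaT) => ij.
  exact: (arrival_meas arrivals t ij.1 ij.2 [set k | k = al ij :> nat]).
by apply/seteqP; split=> w; move/noise_eqP.
Qed.

Lemma entry_pmfE t ij (k : 'I_amax.+1) :
  P [set w | a t w ij.1 ij.2 = k] = (entry_pmf ij k)%:E.
Proof.
rewrite /entry_pmf fineK ?fin_num_measure//.
  exact: (arrival_ident arrivals t 0%N ij.1 ij.2 [set x | x = k :> nat]).
exact: (arrival_meas arrivals 0%N ij.1 ij.2 [set x | x = k :> nat]).
Qed.

Lemma noise_pmf_ge0 al : 0 <= noise_pmf al.
Proof. by apply: prodr_ge0 => ij _; exact: fine_ge0. Qed.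

(** Independence across pairs of the whole arrival processes, and across time
    for each pair, make the successive noises independent with law
    [noise_pmf]. *)
Lemma noise_prefix t (l : nat -> noise_type) :
  P [set w | forall k, (k < t)%N -> noise k w = l k] = (\prod_(k < t) noise_pmf (l k))%:E.
Proof.
pose E ij := [set w | forall k, k \in iota 0 t -> a k w ij.1 ij.2 = l k ij].
have -> : [set w | forall k, (k < t)%N -> noise k w = l k] =
    [set w | forall ij, ij \in index_enum ('I_n * 'I_n)%type -> E ij w].
  apply/seteqP; split=> w h.
    move=> ij _ k; rewrite mem_iota add0n => kt; exact: ((noise_eqP _ _ _).1 (h k kt)).
  move=> k kt; apply/noise_eqP => ij; apply: (h ij); first exact: mem_index_enum.
  by rewrite mem_iota.
rewrite (arrival_indep_pairs arrivals) ?index_enum_uniq//; last first.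
  move=> ij _; rewrite /sigma_seq.
  have sG := @smallest_sigma_algebra T setT
    [set E | exists t (B : set nat), E = (fun w => a t w ij.1 ij.2) @^-1` B].
  apply: (sigma_forall_if sG) => k _; apply: sub_sigma_algebra.
  by exists k, [set x | x = l k ij :> nat].
have PE ij : P (E ij) = (\prod_(k < t) entry_pmf ij (l k ij))%:E.
  rewrite /E (arrival_indep_time arrivals (i:=ij.1) (j:=ij.2)) ?iota_uniq//; last first.
    by move=> k _; exists [set x | x = l k ij :> nat].
  under eq_bigr => k _ do rewrite entry_pmfE.
  by rewrite prodEFin -[in LHS](subn0 t) big_mkord.
under eq_bigr => ij _ do rewrite PE.
by rewrite prodEFin exchange_big.
Qed.

Lemma split_noise t (E : set T) : measurable E ->
  P E = (\sum_al P (E `&` [set w | noise t w = al]))%E.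
Proof.
move=> mE; have -> : E = \bigcup_(al in [set` index_enum noise_type]) (E `&` [set w | noise t w = al]).
  apply/seteqP; split=> [w Ew|w [al _ []]//].
  by exists (noise t w) => //=; exact: mem_index_enum.
rewrite measure_fin_bigcup//.
- rewrite -fsbig_seq ?index_enum_uniq//.
  apply: eq_bigr => al _; congr (P _); apply/seteqP; split=> w /=.
    by move=> [Ew ?]; split=> //; exists al => //=; exact: mem_index_enum.
  by move=> [[al' _ []]].
- by apply/trivIsetP => al al' _ _ ne; apply/seteqP; split=> w // [[_ /= e1] [_ e2]];
  rewrite -e1 -e2 eqxx in ne.
- move=> al _; apply: measurableI => //; exact: (noise_rv t [set al]).
Qed.

Lemma noise_pmf_sum1 : \sum_al noise_pmf al = 1.
Proof.
apply: EFin_inj; rewrite -(probability_setT P) (split_noise 0)// -sumEFin.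
apply: eq_bigr => al _.
have := noise_prefix 1 (fun=> al); rewrite big_ord1 => <-.
congr (P _); apply/seteqP; split=> w /=; first by move=> h; split=> //; exact: h.
by move=> [_ <-] [|k].
Qed.

Definition set_at (l : nat -> noise_type) (j : nat) (al : noise_type) : nat -> noise_type :=
  fun k => if k == j then al else l k.

Definition prefix (j : nat) (l : nat -> noise_type) : set T :=
  [set w | forall k, (k < j)%N -> noise k w = l k].

Lemma prefix_measurable j l : measurable (prefix j l).
Proof.
apply: (sigma_forall_if sigmaT) => k _; exact: (noise_rv k [set l k]).
Qed.

Lemma prefixS j l al : prefix j l `&` [set w | noise j w = al] = prefix j.+1 (set_at l j al).
Proof.
apply/seteqP; split=> w /=.
  move=> [h e] k; rewrite ltnS leq_eqVlt /set_at; case: eqP => [->//|_] /=; exact: h.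
move=> h; split=> [k kj|]; last by rewrite h// /set_at eqxx.
by rewrite h ?ltnS ?(ltnW kj)// /set_at ltn_eqF.
Qed.

Lemma prefix_prob j l al :
  P (prefix j.+1 (set_at l j al)) = (P (prefix j l) * (noise_pmf al)%:E)%E.
Proof.
rewrite !noise_prefix -EFinM big_ord_recr/= {2}/set_at eqxx; congr (_ * _)%:E.
by apply: eq_bigr => k _; rewrite /set_at ltn_eqF.
Qed.

(** By induction on r, splitting according to the noise at time j, until the prefix
    decides the event. *)
Lemma next_noise_indep r j l (H : set T) al : measurable H ->
  (forall w w', (forall k, (k < j + r)%N -> noise k w = noise k w') -> H w -> H w') ->
  P (prefix j l `&` H `&` [set w | noise (j + r)%N w = al]) =
    (P (prefix j l `&` H) * (noise_pmf al)%:E)%E.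
Proof.
move=> mH; elim: r j l => [|r IH] j l dep.
  rewrite addn0 in dep *; have [[w [pw Hw]]|no] := pselect (prefix j l `&` H !=set0).
    have -> : prefix j l `&` H = prefix j l.
      apply/setIidPl => w' pw'; apply: dep Hw => k kj; by rewrite pw ?pw'.
    by rewrite prefixS prefix_prob.
  have -> : prefix j l `&` H = set0 by apply: contrapT => ne; apply: no; apply/set0P/eqP.
  by rewrite set0I measure0 mul0e.
have mp i l' : measurable (prefix i l' `&` H) by apply: measurableI => //; exact: prefix_measurable.
rewrite (split_noise j); last by apply: measurableI => //; exact: (noise_rv _ [set al]).
rewrite (split_noise j (mp j l)) ge0_sume_distrl; last by move=> *; exact: measure_ge0.
apply: eq_bigr => be _; have := IH j.+1 (set_at l j be); rewrite addSnnS => /(_ dep).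
rewrite -prefixS => IHj.
by rewrite (setIAC (prefix j l `&` H)) !(setIAC (prefix j l) H).
Qed.

Section chain.
Variables (S : countType) (F : S -> noise_type -> S) (x0 : S).

Definition chain (t : nat) (w : T) : S := traj F x0 (noise^~ w) t.

Lemma chain_rv t : discrete_rv (@measurable d T) (chain t).
Proof.
elim: t => [|t IH]; first exact: (discrete_rv_cst sigmaT).
exact: (discrete_rv_comp2 sigmaT F IH (noise_rv t)).
Qed.

Lemma chain_dep t w w' : (forall k, (k < t)%N -> noise k w = noise k w') ->
  chain t w = chain t w'.
Proof.
elim: t => //= t IH h; rewrite /chain /= h//; congr (F _ _).
by apply: IH => k kt; rewrite h// ltnW.
Qed.

Lemma traj_set_at x l j al :
  traj F x (set_at l j al) j.+1 = F (traj F x l j) al.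
Proof.
rewrite /= {2}/set_at eqxx; congr (F _ al).
suff : forall i, (i <= j)%N -> traj F x (set_at l j al) i = traj F x l i by apply.
elim=> //= i IH ij; rewrite IH ?(ltnW ij)//.
by rewrite /set_at ltn_eqF.
Qed.

Lemma chain_prefix l j w : prefix j l w -> chain j w = traj F x0 l j.
Proof.
rewrite /chain; elim: j => //= j IH pw; rewrite IH.
  by rewrite pw.
by move=> k kj; apply: pw; rewrite ltnW.
Qed.

(** With the first noises fixed, the induction on the remaining time applies the
    transition operator once for the next noise. *)
Lemma chain_law_prefix t j l (B : set S) :
  P (prefix j l `&` (chain (j + t)%N @^-1` B)) =
  ((\prod_(k < j) noise_pmf (l k)) *
   iter t (noise_op noise_pmf F) (fun y => (`[< B y >])%:R) (traj F x0 l j))%:E.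
Proof.
elim: t j l => [|t IH] j l.
  rewrite addn0 /=; have [h|h] := asboolP (B _).
    rewrite mulr1 -noise_prefix; congr (P _); apply/setIidPl => w pw.
    by rewrite /= (chain_prefix pw).
  rewrite mulr0; apply: etrans (measure0 P); congr (P _); apply/seteqP; split=> w //= [pw].
  by rewrite (chain_prefix pw).
rewrite (split_noise j); last first.
  by apply: measurableI; [exact: prefix_measurable|exact: chain_rv].
rewrite iterS /noise_op mulr_sumr -sumEFin; apply: eq_bigr => al _.
rewrite (setIAC (prefix j l)) prefixS -addSnnS IH traj_set_at.
have pj i l' : P (prefix i l') = (\prod_(k < i) noise_pmf (l' k))%:E := noise_prefix i l'.
have := prefix_prob j l al; rewrite !pj -EFinM => -[->].
by rewrite -mulrA.
Qed.

Lemma chain_law t (B : set S) :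
  P (chain t @^-1` B) = (iter t (noise_op noise_pmf F) (fun y => (`[< B y >])%:R) x0)%:E.
Proof.
have := chain_law_prefix t 0 (fun k => noise k point) B; rewrite big_ord0 mul1r add0n => <-.
by congr (P _); apply/esym/setIidPr => w _ k.
Qed.

Lemma chain_markov t (x : nat -> S) :
  P [set w | forall k, (k <= t.+1)%N -> chain k w = x k] =
  (P [set w | forall k, (k <= t)%N -> chain k w = x k] * (noise_kernel noise_pmf F (x t) (x t.+1))%:E)%E.
Proof.
set H := [set w | forall k, (k <= t)%N -> chain k w = x k].
have mH : measurable H.
  by apply: (sigma_forall_if sigmaT) => k _; exact: (chain_rv k [set x k]).
have mH' : measurable [set w | forall k, (k <= t.+1)%N -> chain k w = x k].
  by apply: (sigma_forall_if sigmaT) => k _; exact: (chain_rv k [set x k]).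
rewrite (split_noise t mH') /noise_kernel -sumEFin (bigID (fun al => F (x t) al == x t.+1))/=.
rewrite [X in (_ + X)%E]big1 ?adde0 => [|al ne]; last first.
  rewrite -(measure0 P); congr (P _); apply/seteqP; split=> w //= [h e].
  by move: ne; rewrite -(h t)// -e -(h t.+1) ?eqxx.
rewrite ge0_sume_distrr => [|al _]; last by rewrite lee_fin noise_pmf_ge0.
apply: eq_bigr => al /eqP Fal.
have p0 : prefix 0 (fun=> al) = setT by apply/seteqP; split.
have dep w w' : (forall k, (k < 0 + t)%N -> noise k w = noise k w') -> H w -> H w'.
  move=> e h k kt; rewrite -(h k kt); apply/esym/chain_dep => i ik.
  by apply: e; rewrite add0n (leq_trans ik).
have := @next_noise_indep t 0 (fun=> al) H al mH dep.
rewrite p0 setTI add0n => <-; congr (P _); apply/seteqP; split=> w /= [h e]; split=> //.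
  by move=> k kt; apply: h; rewrite ltnW.
move=> k; rewrite leq_eqVlt => /orP[/eqP->|]; last exact: h.
rewrite -Fal -(h t (leqnn t)) -e //.
Qed.

End chain.

Lemma expectation_noise t (f : noise_type -> R) : (forall al, 0 <= f al) ->
  ('E_P[(fun w => f (noise t w))] = (\sum_al noise_pmf al * f al)%:E)%E.
Proof.
move=> f0; rewrite unlock.
under eq_integral => w _.
  rewrite (_ : f (noise t w) = \sum_al f al * \1_[set w | noise t w = al] w); last first.
    rewrite (bigD1 (noise t w))//= indicE mem_set// mulr1 big1 ?addr0// => al ne.
    by rewrite indicE memNset ?mulr0//= => e; rewrite e eqxx in ne.
  rewrite -sumEFin.
  over.
have mN al : measurable [set w | noise t w = al] by exact: (noise_rv t [set al]).
rewrite ge0_integral_sum//=; last 2 first.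
- move=> al; apply/measurable_realfun.measurable_EFinP.
  apply: measurable_realfun.measurable_funM => //; exact: measurable_realfun.measurable_indic.
- by move=> al w _; rewrite lee_fin mulr_ge0.
rewrite -sumEFin; apply: eq_bigr => al _.
under eq_integral => w _ do rewrite EFinM.
rewrite ge0_integralZl_EFin//; last exact/measurable_realfun.measurable_EFinP.
rewrite integral_indic// setIT mulrC EFinM; congr (_ * _)%E.
have dep w w' : (forall k, (k < 0 + t)%N -> noise k w = noise k w') -> setT w -> setT w' by [].
have := @next_noise_indep t 0 (fun=> al) setT al measurableT dep.
have -> : prefix 0 (fun=> al) = setT by apply/seteqP; split.
by rewrite !setTI probability_setT mul1e add0n => h; exact: h.
Qed.

Lemma mean_entry (lambda : 'M[R]_n) : arrival_mean P a lambda -> forall i j,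
  \sum_al noise_pmf al * (noise_mx al i j)%:R = lambda i j.
Proof.
move=> hl i j; apply: EFin_inj; rewrite -(hl 0%N i j).
rewrite -(expectation_noise 0 (f := fun al => (noise_mx al i j)%:R))//.
by congr expectation; apply/funext => w; rewrite noise_mxE.
Qed.

Lemma var_entry (lambda : 'M[R]_n) : arrival_mean P a lambda -> forall t i j,
  ('V_P[(fun w => (a t w i j)%:R : R)] =
   (\sum_al noise_pmf al * ((noise_mx al i j)%:R - lambda i j) ^+ 2)%:E)%E.
Proof.
move=> hl t i j; rewrite /variance unlock hl /=.
rewrite -(expectation_noise t (f := fun al => ((noise_mx al i j)%:R - lambda i j) ^+ 2)).
  by congr expectation; apply/funext => w; rewrite noise_mxE /= expr2.
by move=> al; exact: sqr_ge0.
Qed.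

(** Under the product law the mean of a product of functions of the entries factors,
    and deviations have mean 0. *)
Lemma noise_pmf_uncorrelated (lambda : 'M[R]_n) : arrival_mean P a lambda ->
  forall i j k l, (i, j) != (k, l) ->
  \sum_al noise_pmf al * (((noise_mx al i j)%:R - lambda i j) *
    ((noise_mx al k l)%:R - lambda k l)) = 0.
Proof.
move=> hl i j k l ne; pose dev ij (x : 'I_amax.+1) : R := x%:R - lambda ij.1 ij.2.
pose prod_mean (g : 'I_n * 'I_n -> 'I_amax.+1 -> R) ij := \sum_x entry_pmf ij x * g ij x.
have fac g : \sum_al noise_pmf al * \prod_ij g ij (al ij) = \prod_ij prod_mean g ij.
  rewrite /prod_mean bigA_distr_bigA; apply: eq_bigr => al _.
  by rewrite -big_split.
pose g1 ij x : R := if ij == (i, j) then dev ij x else 1.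
pose g2 ij x : R := if ij == (k, l) then dev ij x else g1 ij x.
have prod_g1 al : \prod_ij g1 ij (al ij) = dev (i, j) (al (i, j)).
  rewrite (bigD1 (i, j))//= {1}/g1 eqxx big1 ?mulr1// => ij /negbTE.
  by rewrite /g1 => ->.
have prod_g2 al : \prod_ij g2 ij (al ij) = dev (i, j) (al (i, j)) * dev (k, l) (al (k, l)).
  rewrite (bigD1 (k, l))//= {1}/g2 eqxx mulrC -prod_g1; congr (_ * _).
  have g1kl x : g1 (k, l) x = 1 by rewrite /g1 eq_sym (negbTE ne).
  rewrite [RHS](bigD1 (k, l))//= g1kl mul1r.
  by apply: eq_bigr => ij /negbTE; rewrite /g2 => ->.
have g1_0 : prod_mean g1 (i, j) = 0.
  have : \prod_ij prod_mean g1 ij = 0.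
    rewrite -fac; under eq_bigr => al _ do rewrite prod_g1 mulrBr.
    rewrite sumrB -mulr_suml noise_pmf_sum1 mul1r; apply/eqP; rewrite subr_eq0; apply/eqP.
    by rewrite -(mean_entry hl); apply: eq_bigr => al _; rewrite mxE.
  have : \prod_ij prod_mean (fun _ _ => 1) ij = 1.
    rewrite -(fac (fun _ _ => 1)) (eq_bigr noise_pmf) ?noise_pmf_sum1// => al _.
    by rewrite [X in _ * X]big1 ?mulr1.
  rewrite (bigD1 (i, j))//= => p1.
  rewrite (bigD1 (i, j))//= [X in _ * X](_ : _ =
      \prod_(ij | ij != (i, j)) prod_mean (fun _ _ => 1) ij); last first.
    by apply: eq_bigr => ij /negbTE ne'; rewrite /prod_mean /g1 ne'.
  move=> /eqP; rewrite mulf_eq0 => /orP[/eqP//|/eqP p0].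
  by move: p1; rewrite p0 mulr0 => /esym/eqP; rewrite oner_eq0.
under eq_bigr => al _ do rewrite [noise_mx al i j]mxE [noise_mx al k l]mxE -(prod_g2 al).
rewrite fac (bigD1 (i, j))//= [prod_mean g2 (i, j)](_ : _ = prod_mean g1 (i, j)) ?g1_0 ?mul0r//.
by rewrite /prod_mean /g2 (negbTE ne).
Qed.

Lemma noise_pmf_zero_gt0 : 0 < noise_pmf [ffun=> ord0].
Proof.
rewrite -lte_fin; have := noise_prefix 1 (fun=> [ffun=> ord0]); rewrite big_ord1 => <-.
have := arrival_zero arrivals 0; congr (0 < P _)%E.
apply/seteqP; split=> w /= h.
  by move=> [|//] _; apply/noise_eqP => ij; rewrite h ffunE.
by move=> i j; have /noise_eqP := h 0%N isT; move=> /(_ (i, j)) /=; rewrite ffunE.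
Qed.

Lemma noise_mx0 : noise_mx [ffun=> ord0] = 0.
Proof. by apply/matrixP => i j; rewrite !mxE ffunE. Qed.

End arrival_noise.

(** * Recurrence of driven chains as Markov chains *)

Section markov_structure.
Variables (R : realType) (A : finType) (w : A -> R).
Hypotheses (w_ge0 : forall a, 0 <= w a) (w_sum1 : \sum_a w a = 1).
Variables (S : countType) (F : S -> A -> S).
Local Notation p := (noise_kernel w F).
Local Notation op := (noise_op w F).

Lemma esum_at (D : set S) (y : S) (h : S -> \bar R) : (0 <= h y)%E ->
  (\esum_(z in D) (if y == z then h z else 0) = if y \in D then h y else 0)%E.
Proof.
move=> h0; have -> : (\esum_(z in D) (if y == z then h z else 0))%E =
    (\esum_(z in D) (if z \in [set y] then h z else 0))%E.
  congr (esum D _); apply/funext => z.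
  have [->|ne] := eqVneq y z; first by rewrite mem_set.
  by rewrite memNset// => /= e; rewrite e eqxx in ne.
rewrite -esum_mkcondr; have [yD|yD] := boolP (y \in D).
  rewrite (_ : _ `&` _ = [set y]) ?esum_set1//.
  by apply/seteqP; split=> z [] // -> ; split=> //; exact/set_mem.
rewrite (_ : _ `&` _ = set0) ?esum_set0//.
by apply/seteqP; split=> z //= [zD zy]; rewrite zy in zD; move: yD; rewrite mem_set.
Qed.

(** Turns the sums over all states in the definitions of recurrence into finite sums
    over the noise. *)
Lemma esum_kernel (D : set S) x (h : S -> \bar R) : (forall z, 0 <= h z)%E ->
  (\esum_(z in D) (p x z)%:E * h z =
   \sum_a if F x a \in D then (w a)%:E * h (F x a) else 0)%E.
Proof.
move=> h0; have -> : (\esum_(z in D) (p x z)%:E * h z)%E =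
    (\esum_(z in D) \sum_a (if F x a == z then (w a)%:E * h z else 0))%E.
  congr (esum D _); apply/funext => z; rewrite /noise_kernel -sumEFin ge0_sume_distrl.
    by rewrite big_mkcond.
  by move=> a _; rewrite lee_fin.
rewrite esum_sum => [|z a _ _]; last by case: ifP => // _; rewrite mule_ge0 ?lee_fin.
by apply: eq_bigr => a _; rewrite esum_at// mule_ge0 ?lee_fin.
Qed.

Lemma kernel_stochastic : stochastic p.
Proof.
split=> [x y|x]; first exact: sumr_ge0.
have -> : (\esum_(y in [set: S]) (p x y)%:E = \esum_(y in [set: S]) (p x y)%:E * 1)%E.
  by apply: eq_esum => z _; rewrite mule1.
rewrite (@esum_kernel setT x (fun=> 1%E))//.
apply: etrans (_ : (\sum_a (w a)%:E)%E = _); last by rewrite sumEFin w_sum1.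
by apply: eq_bigr => a _; rewrite in_setT mule1.
Qed.

Lemma step_probE k x y : step_prob p k x y = (iter k op (at_state R y) x)%:E.
Proof.
elim: k x => [|k IH] x //=.
have h0 z : (0 <= step_prob p k z y)%E.
  by rewrite IH lee_fin iter_op_ge0// => u; exact: at_state_ge0.
rewrite (esum_kernel setT x h0) -sumEFin; apply: eq_bigr => a _.
by rewrite in_setT IH -EFinM.
Qed.

Lemma first_visitE k x y : first_visit p y k x = (first_visit_prob w F y k x)%:E.
Proof.
elim: k x => [|k IH] x /=.
  rewrite /first_visit_prob /= /noise_op /noise_kernel big_mkcond; congr EFin.
  by apply: eq_bigr => a _; rewrite /at_state; case: (_ == _); rewrite ?mulr1 ?mulr0.
have h0 z : (0 <= first_visit p y k z)%E by rewrite IH lee_fin first_visit_prob_ge0.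
rewrite (esum_kernel _ x h0) -sumEFin.
apply: eq_bigr => a _; rewrite IH -EFinM.
have [e|ne] := eqVneq (F x a) y.
  by rewrite memNset ?mul0r ?mulr0//= => /eqP.
by rewrite mem_set ?mul1r.
Qed.

Lemma accessibleE x y : accessible p x y <-> exists k, 0 < iter k op (at_state R y) x.
Proof. by split=> -[k h]; exists k; move: h; rewrite step_probE lte_fin. Qed.

Variables (G : S -> Prop) (c : nat) (ph : S -> nat) (V : S -> R) (gam K : R) (a0 : A).
Hypothesis erg : ergodic_chain w F G c ph V gam K a0.
Variable z0 : S.
Hypotheses (Gz0 : G z0) (reach : forall x, exists M, iter M (F^~ a0) x = z0).

Definition recurrent_class : set S :=
  [set y | exists k, 0 < iter k op (at_state R y) z0].

Lemma class_G y : recurrent_class y -> G y.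
Proof. by move=> [k]; exact: (iter_op_pos_G w_ge0 w_sum1 erg Gz0). Qed.

(** The noise [a0], repeated, leads from anywhere to [z0]. *)
Lemma class_accessible x y : recurrent_class y ->
  exists k, 0 < iter k op (at_state R y) x.
Proof.
move=> [k ky]; have [M Mx] := reach x; exists (M + k)%N.
exact: (iter_op_compose w_ge0 w_sum1 (iter_op_pos_path w_ge0 w_sum1 erg Mx) ky).
Qed.

Lemma class_communicates : closed_communicating_class p recurrent_class.
Proof.
split.
- by exists z0; exists 0%N; rewrite /= /at_state eqxx.
- by move=> x y _ Cy; apply/accessibleE; exact: class_accessible.
- move=> x y [k kx] /accessibleE[l ly]; exists (k + l)%N.
  exact: (iter_op_compose w_ge0 w_sum1 kx ly).
Qed.

Lemma class_return y : recurrent_class y ->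
  exists2 del : R, 0 < del & exists k0, forall k, (k0 <= k)%N ->
    del <= iter (k * c) op (at_state R y) y.
Proof.
move=> Cy; apply: (return_lower_bound w_ge0 w_sum1 erg (class_G Cy)) => N.
exact: class_accessible.
Qed.

(** The clock makes return times multiples of [c], and all large multiples are return
    times. *)
Lemma class_period y : recurrent_class y -> has_period p y c.
Proof.
move=> Cy e; split=> [/dvdn_trans ec k k0|ret].
  rewrite step_probE lte_fin => /(iter_op_pos_phase w_ge0 w_sum1 erg) phy.
  apply: ec; move: phy; rewrite -{1}(modn_small (erg_phase_lt erg y)) -{1}[ph y]addn0.
  by move/eqP; rewrite eqn_modDl eq_sym mod0n.
have [del del0 [k0 low]] := class_return Cy.
have c0 := period_gt0 erg y.
have div k : (k0 <= k)%N -> (e %| k.+1 * c)%N.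
  move=> kk; apply: ret; first by rewrite muln_gt0.
  by rewrite step_probE lte_fin (lt_le_trans del0)// low// (leq_trans kk).
have := div k0.+1 (leqnSn _); rewrite mulSn dvdn_addl//; exact: div.
Qed.

(** Returning at multiples of the period with a probability that is bounded below makes
    the probabilities of not having returned summable. *)
Lemma class_positive_recurrent y : recurrent_class y -> positive_recurrent p y.
Proof.
move=> Cy; have [del del0 [k0 low]] := class_return Cy.
have [B sB] := no_visit_summable w_ge0 w_sum1 erg del0 low.
have nv := no_visit_cvg0 w_ge0 w_sum1 sB; split.
  apply: cvg_lim => //.
  rewrite (_ : (fun n => _) = EFin \o (fun n => 1 - no_visit_prob w F y n y)).
    apply: cvg_EFin; first by near=> n.
    rewrite -[X in _ --> X](subr0 (1 : R)).
    by apply: cvgB; [exact: cvg_cst|exact: nv].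
  apply/funext => n /=; rewrite big_mkord -(sum_first_visit w_sum1) -sumEFin.
  by apply: eq_bigr => k _; exact: first_visitE.
apply: (@le_lt_trans _ _ B%:E); last exact: ltry.
apply: lime_le.
  apply: is_cvg_nneseries => k _ _; rewrite first_visitE mule_ge0 ?lee_fin//.
  exact: first_visit_prob_ge0.
near=> n; rewrite big_mkord; under eq_bigr => k _ do rewrite first_visitE -EFinM.
rewrite sumEFin lee_fin (le_trans _ (sB n))//.
exact: (sum_return_time w_ge0 w_sum1).
Unshelve. all: by end_near. Qed.

(** By forgetting, the chain is in the class with probability close to that of
    the chain started in the class, that is 1. *)
Lemma class_absorbs x : G x -> ph x = ph z0 -> forall e : R, 0 < e ->
  exists t, 1 - e <= iter t op (fun y => (`[< recurrent_class y >])%:R) x.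
Proof.
move=> Gx phx e e0; have [r [r0 rlim] fr] := forgetting w_ge0 w_sum1 erg.
pose phi y : R := (`[< recurrent_class y >])%:R.
have one t : iter t op phi z0 = 1.
  apply: le_anti; apply/andP; split.
    rewrite -[leRHS](iter_op_cst w_sum1 F t 1 z0); apply: iter_op_le => // y.
    by rewrite /phi; case: asboolP.
  rewrite -[leLHS](iter_op_cst w_sum1 F t 1 z0).
  apply: (iter_op_le_inv_pos w_ge0 (G := fun _ => recurrent_class) _ (k := 0%N)) => //.
  - move=> _ y a wa [k ky]; exists (k + 1)%N; apply: (iter_op_compose w_ge0 w_sum1 ky).
    rewrite /= /noise_op (bigD1 a)//= /at_state eqxx mulr1 ltr_wpDr// sumr_ge0// => b _.
    by rewrite mulr_ge0 ?ler0n.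
  - by move=> y Cy; rewrite /phi asboolT.
  - by exists 0%N; rewrite /= /at_state eqxx.
have V0 := erg_V_ge0 erg.
have D0 : 0 < 1 + V x + V z0 by rewrite -addrA ltr_pwDl// addr_ge0.
have [t _ small] : \forall t \near \oo, r t < e / (1 + V x + V z0).
  by have /cvgr_lt := rlim; apply; rewrite divr_gt0.
exists t; have := fr t x z0 phi 1 Gx Gz0 phx; rewrite one mul1r => h.
have : `|iter t op phi x - 1| <= e.
  apply: le_trans (h _) _ => [z _|].
    by rewrite mul1r /phi ger0_norm ?ler0n//; case: asboolP => _; rewrite ?lerDl// addr_ge0.
  by rewrite -ler_pdivlMr// ltW// small /=.
by rewrite ler_norml -/phi => /andP[]; lra.
Qed.

End markov_structure.

(** * Switches that use recently computed MaxWeight schedules *)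

Section controller.
Variables (n amax : nat) (ctl : finType).
Variables (sched : 'M[nat]_n -> ctl -> 'S_n) (next : 'M[nat]_n -> ctl -> ctl).

Definition switch_state : countType := ('M[nat]_n * ctl)%type.

Definition switch_update (x : switch_state) (al : noise_type n amax) : switch_state :=
  (switch_step x.1 (noise_mx al) (sched x.1 x.2), next x.1 x.2).

(** [m] bounds the age of the queue lengths for which the schedule in use is
    MaxWeight, from any initial state once [m] slots have passed; [c] is the
    period of the clock.  While the queues stay empty, [m] slots erase the
    memory of the controller, up to the phase of its clock. *)
Record recent_maxweight (mw : 'M[nat]_n -> 'S_n) (m c : nat) (phase : ctl -> nat) :
    Prop := RecentMaxweight {
  ctl_recent : forall x (al : nat -> noise_type n amax),
    let y := traj switch_update x al m in
    exists2 k, (k <= m)%N & sched y.1 y.2 = mw (traj switch_update x al k).1;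
  ctl_phase : forall q f, phase (next q f) = ((phase f).+1 %% c)%N;
  ctl_phase_lt : forall f, (phase f < c)%N;
  ctl_reset : forall f f', phase f = phase f' -> iter m (next 0) f = iter m (next 0) f'
}.

Variables (mw : 'M[nat]_n -> 'S_n) (m c : nat) (phase : ctl -> nat).
Hypotheses (mwP : maxweight_rule mw) (ctlP : recent_maxweight mw m c phase).

Implicit Types (x y : switch_state) (al : nat -> noise_type n amax) (q : 'M[nat]_n).
Local Notation path := (traj switch_update).

Lemma traj_add x al j k : path x al (j + k) = path (path x al j) (fun i => al (j + i)%N) k.
Proof. by elim: k => [|k IH]; rewrite ?addn0// addnS /= IH. Qed.

Lemma weight_le_total q s : (weight q s <= total q)%N.
Proof. by rewrite weightE; apply: leq_sum => i _; rewrite (bigD1 (s i))//= leq_addr. Qed.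

Lemma weight_step q s s' (al : noise_type n amax) :
  (weight (switch_step q (noise_mx al) s) s' <= weight q s' + n * amax)%N /\
  (weight q s' <= weight (switch_step q (noise_mx al) s) s' + n)%N.
Proof.
rewrite !weightE; split.
  rewrite -[X in (_ <= _ + X * _)%N](card_ord n) -sum_nat_const -big_split.
  apply: leq_sum => i _; rewrite switch_stepE /=.
  by have := noise_mx_le al i (s' i); lia.
rewrite -[X in (_ <= _ + X)%N]muln1 -[X in (_ <= _ + X * _)%N](card_ord n).
rewrite -sum_nat_const -big_split; apply: leq_sum => i _; rewrite switch_stepE /=.
by case: (s i == _); lia.
Qed.

Lemma weight_path x al s k :
  (weight (path x al k).1 s <= weight x.1 s + k * (n * amax))%N /\
  (weight x.1 s <= weight (path x al k).1 s + k * n)%N.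
Proof.
elim: k => [|k [IH1 IH2]] /=; first by rewrite !addn0.
have [h1 h2] := weight_step (path x al k).1 (sched (path x al k).1 (path x al k).2) s (al k).
rewrite !mulSn; split.
  by rewrite (leq_trans h1)// [X in (_ <= X)%N]addnCA addnC leq_add2l.
by rewrite (leq_trans IH2)// addnA leq_add2r.
Qed.

(** In one slot at most n * amax packets are added to the weight of a schedule and at
    most n are removed; over [m] slots both may separate a MaxWeight schedule from
    its competitors. *)
Definition staleness : nat := (m * (n * amax.+1))%N.

Lemma recent_near_max x al : let y := path x al m in
  near_max staleness y.1 (sched y.1 y.2).
Proof.
move=> y s'; have [k km ->] := ctl_recent ctlP x al.
have yE : y = path (path x al k) (fun i => al (k + i)%N) (m - k).
  by rewrite -traj_add subnKC.
have [h1 _] := weight_path (path x al k) (fun i => al (k + i)%N) s' (m - k).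
have [_ h2] := weight_path (path x al k) (fun i => al (k + i)%N) (mw (path x al k).1) (m - k).
rewrite -yE in h1 h2; have h3 := mwP (path x al k).1 s'.
have h4 : ((m - k) * (n * amax) + (m - k) * n <= staleness)%N.
  by rewrite /staleness -mulnDr -mulnSr leq_mul2r leq_subr orbT.
by lia.
Qed.

Lemma late_near_max x al t : (m <= t)%N -> let y := path x al t in
  near_max staleness y.1 (sched y.1 y.2).
Proof. by move=> /subnK <-; rewrite traj_add; exact: recent_near_max. Qed.

(** Schedules are recent only after [m] slots.  Quantifying over all future noises makes
    the property invariant under the dynamics, and each state has it for some [b]. *)
Definition always_near_max (b : nat) x :=
  forall al t, let y := path x al t in near_max b y.1 (sched y.1 y.2).

Lemma always_near_max_closed b x a :
  always_near_max b x -> always_near_max b (switch_update x a).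
Proof.
move=> h al t; have := h (fun i => if i is i'.+1 then al i' else a) t.+1.
by rewrite -add1n traj_add.
Qed.

Lemma always_near_max_le b b' x : (b <= b')%N -> always_near_max b x -> always_near_max b' x.
Proof. by move=> bb h al t y s'; rewrite (leq_trans (h al t s'))// leq_add2l. Qed.

Lemma always_near_max_any x : exists2 b, (staleness <= b)%N & always_near_max b x.
Proof.
exists (staleness + (total x.1 + m * (n * amax)))%N; first exact: leq_addr.
move=> al t y s'; have [mt|tm] := leqP m t.
  by rewrite (leq_trans (late_near_max x al mt s'))// leq_add2l leq_addr.
have [h _] := weight_path x al s' t.
rewrite (leq_trans h)// (leq_trans _ (leq_addl _ _))// (leq_trans _ (leq_addl _ _))//.
by rewrite leq_add ?weight_le_total// leq_mul2r (ltnW tm) orbT.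
Qed.

Definition idle : noise_type n amax := [ffun=> ord0].

Local Notation idle_step := (switch_update^~ idle).

Lemma idle_path x t : iter t idle_step x = path x (fun=> idle) t.
Proof. by elim: t => //= t ->. Qed.

Lemma idle_entry x i j : ((idle_step x).1 i j <= x.1 i j)%N.
Proof. by rewrite switch_stepE noise_mx0 mxE addn0 leq_subr. Qed.

Lemma idle_entry_iter t x i j : ((iter t idle_step x).1 i j <= x.1 i j)%N.
Proof. by elim: t => //= t IH; exact: leq_trans (idle_entry _ _ _) IH. Qed.

Lemma total_eq q q' : (forall i j, (q' i j <= q i j)%N) -> (total q <= total q')%N -> q' = q.
Proof.
move=> le tot; have eqT : total q' = total q.
  by apply/eqP; rewrite eqn_leq tot andbT; apply: leq_sum => i _; exact: leq_sum.
have rowle i : (\sum_j q' i j <= \sum_j q i j)%N by exact: leq_sum.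
have [_] := leqif_sum (fun i (_ : true) => leqif_eq (rowle i)).
rewrite -/(total q) -/(total q') eqT eqxx => /esym/forallP rows.
apply/matrixP => i j; have [_] := leqif_sum (fun j (_ : true) => leqif_eq (le i j)).
by rewrite (eqP (rows i)) eqxx => /esym/forallP/(_ j)/eqP.
Qed.

Lemma weight0_eq0 q : (forall s, weight q s = 0%N) -> q = 0.
Proof.
move=> w0; apply/matrixP => i j; rewrite mxE; apply/eqP.
have := w0 (tperm i j); rewrite weightE => /eqP; rewrite sum_nat_eq0 => /forallP/(_ i).
by rewrite tpermL.
Qed.

(** If m + 1 slots without arrivals served nothing, the queues would be constant and the
    schedule would become MaxWeight for them; having nothing to serve, it would have
    weight 0, and so would all schedules. *)
Lemma idle_decrease x : x.1 != 0 -> (total (iter m.+1 idle_step x).1 < total x.1)%N.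
Proof.
apply: contra_neqT; rewrite -leqNgt => tot.
have const t : (t <= m.+1)%N -> (iter t idle_step x).1 = x.1.
  move=> tm; apply: total_eq => [i j|]; first exact: idle_entry_iter.
  rewrite (leq_trans tot)//; apply: leq_sum => i _; apply: leq_sum => j _.
  by rewrite -(subnK tm) iterD; exact: idle_entry_iter.
have [k km sE] := ctl_recent ctlP x (fun=> idle).
rewrite -!idle_path !const ?leqnSn ?(leq_trans km)// in sE.
apply: weight0_eq0 => s; apply/eqP; rewrite -leqn0 (leq_trans (mwP x.1 s))// leqn0.
rewrite weightE sum_nat_eq0; apply/forallP => i; apply/implyP => _.
have := congr1 (fun q => q i (mw x.1 i)) (const _ (leqnn m.+1)).
rewrite iterS /= switch_stepE noise_mx0 mxE addn0 const// sE eqxx subn1 => h.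
by rewrite -leqn0 leqNgt; apply/negP => pos; move: h; case: (x.1 _ _) pos => //= k' _ /n_Sn.
Qed.

Lemma idle_zero t x : x.1 = 0 -> iter t idle_step x = (0, iter t (next 0) x.2).
Proof.
move=> x0; elim: t => [|t IH] /=; first by case: x x0 => q f /= ->.
rewrite IH /switch_update /=; congr pair; apply/matrixP => i j.
by rewrite switch_stepE noise_mx0 !mxE.
Qed.

Lemma idle_empty k x : (total x.1 <= k)%N -> (iter (k * m.+1) idle_step x).1 = 0.
Proof.
elim: k x => [|k IH] x tot.
  apply/matrixP => i j; rewrite mxE; apply/eqP; move: tot.
  by rewrite leqn0 sum_nat_eq0 => /forallP/(_ i)/=; rewrite sum_nat_eq0 => /forallP/(_ j).
have [x0|xn0] := eqVneq x.1 0; first by rewrite idle_zero.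
by rewrite mulSn addnC iterD IH// -ltnS (leq_trans (idle_decrease xn0)).
Qed.

Lemma switch_phase x a : phase (switch_update x a).2 = ((phase x.2).+1 %% c)%N.
Proof. exact: ctl_phase ctlP _ _. Qed.

Lemma switch_phase_iter x t : phase (iter t idle_step x).2 = ((phase x.2 + t) %% c)%N.
Proof.
elim: t => [|t IH]; first by rewrite addn0 modn_small// (ctl_phase_lt ctlP).
by rewrite iterS switch_phase IH -addn1 modnDml addn1 addnS.
Qed.

(** Without arrivals the queues empty, and then the controller is reset. *)
Lemma idle_merge k : exists N, forall x y, (total x.1 <= k)%N -> (total y.1 <= k)%N ->
  phase x.2 = phase y.2 -> iter N idle_step x = iter N idle_step y.
Proof.
exists (m + k * m.+1)%N => x y tx ty phxy; rewrite !iterD.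
rewrite (idle_zero m (idle_empty tx)) (idle_zero m (idle_empty ty)).
apply: (congr1 (fun f => (0, f) : switch_state)); apply: (ctl_reset ctlP).
by rewrite !switch_phase_iter phxy.
Qed.

(** A number m * c of slots without packets resets the controller and is a multiple of
    the period of the clock. *)
Definition empty_state (f : ctl) : switch_state := (0, iter (m * c) (next 0) f).

Lemma phase_next0 t f : phase (iter t (next 0) f) = ((phase f + t) %% c)%N.
Proof.
elim: t => [|t IH]; first by rewrite addn0 modn_small// (ctl_phase_lt ctlP).
by rewrite iterS (ctl_phase ctlP) IH -addn1 modnDml addn1 addnS.
Qed.

Lemma reset_late t f f' : (m <= t)%N -> phase f = phase f' ->
  iter t (next 0) f = iter t (next 0) f'.
Proof. by move=> /subnK <- h; rewrite !iterD (ctl_reset ctlP h). Qed.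

Lemma empty_state_eq f f' : phase f = 0%N -> phase f' = 0%N -> empty_state f = empty_state f'.
Proof.
move=> phf phf'; congr pair; apply: reset_late; last by rewrite phf.
by rewrite leq_pmulr// (leq_trans _ (ctl_phase_lt ctlP f)).
Qed.

Variable f0 : ctl.
Hypothesis phase_f0 : phase f0 = 0%N.

Local Notation z0 := (empty_state f0).

Lemma empty_state_phase : phase z0.2 = 0%N.
Proof. by rewrite phase_next0 phase_f0 add0n modnMl. Qed.

Lemma idle_reach x : exists M, iter M idle_step x = z0.
Proof.
have c0 : (0 < c)%N by rewrite (leq_trans _ (ctl_phase_lt ctlP f0)).
pose k := (total x.1 * m.+1)%N; set y := iter k idle_step x.
have y0 : y.1 = 0 by exact: idle_empty.
exists ((m * c + (c - phase y.2)) + k)%N; rewrite iterD -/y idle_zero// iterD.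
apply: (congr1 (fun f => (0, f) : switch_state)); apply: reset_late; first by rewrite leq_pmulr.
by rewrite phase_next0 phase_f0 subnKC ?modnn// ltnW// (ctl_phase_lt ctlP).
Qed.

(** The empty state recurs as long as no packet arrives, so that it can be given a past
    of any length. *)
Lemma empty_state_near_max : always_near_max staleness z0.
Proof.
have c0 : (0 < c)%N by rewrite (leq_trans _ (ctl_phase_lt ctlP f0)).
have cyc : path z0 (fun=> idle) (m * c) = z0.
  rewrite -idle_path idle_zero//; apply: (congr1 (fun f => (0, f) : switch_state)).
  rewrite /empty_state /= -iterD iterD; apply: reset_late; first by rewrite leq_pmulr.
  by rewrite phase_next0 phase_f0 add0n modnMl.
move=> al t; have := @late_near_max z0
  (fun i => if (i < m * c)%N then idle else al (i - m * c)%N) (m * c + t).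
rewrite traj_add.
have -> : path z0 (fun i => if (i < m * c)%N then idle else al (i - m * c)%N) (m * c)
    = z0.
  rewrite -[RHS]cyc; suff : forall k, (k <= m * c)%N -> path z0
    (fun i => if (i < m * c)%N then idle else al (i - m * c)%N) k = path z0 (fun=> idle) k by apply.
  by elim=> //= k IH kc; rewrite IH ?(ltnW kc)// kc.
have -> : (fun i => (fun i => if (i < m * c)%N then idle else al (i - m * c)%N) (m * c + i)%N) = al.
  by apply/funext => i; rewrite ltnNge leq_addr/= addKn.
by apply; rewrite (leq_trans (leq_pmulr m c0))// leq_addr.
Qed.

End controller.

(** * Stationary moments at a fixed load *)

Section fixed_load.
Variables (R : realType) (n amax : nat) (ctl : finType).
Variables (sched : 'M[nat]_n -> ctl -> 'S_n) (next : 'M[nat]_n -> ctl -> ctl).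
Variables (mw : 'M[nat]_n -> 'S_n) (m c : nat) (phase : ctl -> nat) (f0 : ctl).
Hypotheses (n0 : (0 < n)%N) (mwP : maxweight_rule mw)
  (ctlP : recent_maxweight amax sched next mw m c phase) (phase_f0 : phase f0 = 0%N).
Variables (nu : 'M[R]_n) (vmin : R).
Hypotheses (nu_ds : doubly_stochastic nu) (vmin0 : 0 < vmin)
  (nu_min : forall i j, vmin <= nu i j).

Local Notation state := (switch_state n ctl).
Local Notation F := (@switch_update n amax ctl sched next).
Local Notation near := (@always_near_max n amax ctl sched next).
Local Notation qnorm := (fun q : 'M[nat]_n => frob_norm (realmx R q)).
Local Notation qperp := (fun q : 'M[nat]_n => frob_norm (perp_K (realmx R q))).
Local Notation qsum := (fun q : 'M[nat]_n => entry_sum (realmx R q)).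
Local Notation stale := (staleness n amax m).
Local Notation z0 := (empty_state next m c f0 : state).

Lemma increment_bound_gt0 : 0 < increment_bound R n amax.
Proof. by rewrite mulr_gt0// ltr0n. Qed.

Lemma drift_const_gt0 b : 0 < drift_const R n amax b.
Proof. by rewrite ltr_wpDl// divr_gt0// exprn_gt0// increment_bound_gt0. Qed.

Lemma entry_le_norm (q : 'M[nat]_n) i j : (q i j)%:R <= qnorm q.
Proof. by have := entry_frob_norm (realmx R q) i j; rewrite mxE ger0_norm. Qed.

Lemma norm_sublevel (eta r : R) : 0 < eta ->
  exists N, forall q : 'M[nat]_n, expR (eta * qnorm q) <= r -> forall i j, (q i j <= N)%N.
Proof.
move=> eta0; exists (Num.bound (`|r| / eta)) => q qr i j.
rewrite -(ler_nat R) (le_trans (entry_le_norm q i j))//.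
have r0 : 0 <= `|r| / eta by rewrite divr_ge0// ltW.
apply: le_trans (ltW (archi_boundP r0)); rewrite ler_pdivlMr// mulrC.
apply: le_trans (ler_norm r); apply: le_trans qr.
by apply: le_trans (expR_ge1Dx _); rewrite lerDr.
Qed.

Lemma norm_sublevel_finite (eta r : R) : 0 < eta ->
  finite_set [set q : 'M[nat]_n | expR (eta * qnorm q) <= r].
Proof.
move=> eta0; have [N hN] := @norm_sublevel eta r eta0.
apply: (@sub_finite_set _ _ ((@noise_mx n N) @` [set: noise_type n N])); last first.
  exact/finite_image/finite_finset.
move=> q /= /hN qN; exists [ffun ij => inord (q ij.1 ij.2)] => //.
by apply/matrixP => i j; rewrite mxE ffunE inordK// ltnS.
Qed.

(** The perpendicular component has a drift that does not depend on the load,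
    so that its moments, from the empty state, are bounded uniformly. *)
Lemma perp_moments : exists Cst : nat -> R,
  forall (e : R) (w : noise_type n amax -> R), (forall al, 0 <= w al) -> \sum_al w al = 1 ->
  (forall i j, \sum_al w al * (noise_mx al i j)%:R = (1 - e) * nu i j) ->
  0 < e -> e < 1 -> e * frob_norm nu <= vmin / 2 ->
  forall r t, iter t (noise_op w F) (fun y => qperp y.1 ^+ r) z0 <= Cst r.
Proof.
have [|eta [gam [K [eta0 gam01 K0 expd]]]] :=
  @exponential_drift R (vmin / 2) (increment_bound R n amax) (drift_const R n amax stale) _
    increment_bound_gt0 (drift_const_gt0 stale).
  by rewrite divr_gt0.
have /andP[g0 g1] := gam01; have K'0 := geometric_bound_ge0 g1 K0.
have C0 r : 0 <= 1 + r`!%:R / eta ^+ r by rewrite addr_ge0// divr_ge0// exprn_ge0// ltW.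
exists (fun r => (1 + r`!%:R / eta ^+ r) * (1 + K / (1 - gam))).
move=> e w w0 w1 wm e0 e1 small r t.
pose U (y : state) : R := expR (eta * qperp y.1).
apply: le_trans (_ : (1 + r`!%:R / eta ^+ r) * iter t (noise_op w F) U z0 <= _).
  rewrite -(iter_opZ w1); apply: (iter_op_le w0) => y.
  by apply: exprn_le_expR => //; exact: frob_norm_ge0.
rewrite ler_wpM2l//.
have drift x : near stale x -> noise_op w F U x <= gam * U x + K.
  move=> nx; apply: (expd _ w (qperp x.1) (fun al => qperp (F x al).1)) => //.
  - exact: frob_norm_ge0.
  - by move=> al; apply: (step_lip (W := qperp) _ _ _ (perp_lip R n0)) => i j; exact: noise_mx_le.
  apply: (perp_drift (amax := amax) (nu := nu) (e := e)) => //.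
    by move=> al i j; exact: noise_mx_le.
  exact: (nx (fun=> idle n amax) 0%N).
have h := iter_op_drift w0 w1 (F := F) (G := near stale)
  (fun x a => @always_near_max_closed n amax ctl sched next stale x a) g0 g1 K0 drift t
  (empty_state_near_max mwP ctlP phase_f0).
apply: le_trans h _; rewrite lerD2r.
have -> : U z0 = 1.
  rewrite /U /=; have -> : frob_norm (perp_K (realmx R (0 : 'M[nat]_n))) = 0.
    apply/eqP; rewrite eq_le frob_norm_ge0 andbT (le_trans (perp_K_le_norm n0 _))//.
    by rewrite (_ : realmx R 0 = 0) ?frob_norm0//; apply/matrixP => i j; rewrite !mxE.
  by rewrite mulr0 expR0.
by rewrite mulr1 exprn_ile1// ltW.
Qed.

Section load.
Variables (e : R) (w : noise_type n amax -> R).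
Hypotheses (w_ge0 : forall al, 0 <= w al) (w_sum1 : \sum_al w al = 1)
  (arr_mean : forall i j, \sum_al w al * (noise_mx al i j)%:R = (1 - e) * nu i j)
  (e0 : 0 < e) (e1 : e < 1) (idle_gt0 : 0 < w (idle n amax)).

Local Notation op := (noise_op w F).
Local Notation ph := (fun x : state => phase x.2).

(** The queue lengths are controlled by an exponential of their norm; the rate
    may depend on the load. *)
Lemma switch_ergodic b : exists eta gam K : R, 0 < eta /\
  ergodic_chain w F (near b) c ph (fun x => expR (eta * qnorm x.1)) gam K (idle n amax).
Proof.
have [|eta [gam [K [eta0 gam01 K0 expd]]]] :=
  @exponential_drift R (e * vmin) (increment_bound R n amax) (drift_const R n amax b) _
    increment_bound_gt0 (drift_const_gt0 b).
  by rewrite mulr_gt0.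
exists eta, gam, K; split=> //; constructor=> //.
- by move=> x al; exact: always_near_max_closed.
- by move=> x al; exact: switch_phase ctlP x al.
- by move=> x; exact: ctl_phase_lt ctlP _.
- move=> x nx; apply: (expd _ w (qnorm x.1) (fun al => qnorm (F x al).1)) => //.
  - exact: frob_norm_ge0.
  - by move=> al; apply: (step_lip (W := qnorm) _ _ _ (@norm_lip R n)) => i j; exact: noise_mx_le.
  apply: (norm_drift (amax := amax) (nu := nu) (e := e)) => //.
    by move=> al i j; exact: noise_mx_le.
  exact: (nx (fun=> idle n amax) 0%N).
- move=> r; have [N hN] := @norm_sublevel eta r eta0.
  have [M hM] := idle_merge mwP ctlP (n * (n * N)); exists M => x y _ _ phxy xr yr.
  have tot (q : 'M[nat]_n) : (forall i j, (q i j <= N)%N) -> (total q <= n * (n * N))%N.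
    move=> qN; rewrite -[X in (_ <= X * _)%N](card_ord n) -sum_nat_const.
    apply: leq_sum => i _; rewrite -[X in (_ <= X * _)%N](card_ord n) -sum_nat_const.
    exact: leq_sum.
  by apply: hM => //; apply/tot/hN.
Qed.

(** Polynomial growth is O(sqrt U) for U the exponential of the norm, at any rate; this
    is the growth for which expectations pass to the steady state. *)
Lemma poly_growth (eta : R) (k : nat) (f : 'M[nat]_n -> R) (B : R) : 0 < eta ->
  (forall q, `|f q| <= B * qnorm q ^+ k) ->
  exists C, forall q, f q ^+ 2 <= C * expR (eta * qnorm q).
Proof.
move=> eta0 fB; exists (B ^+ 2 * (1 + (k * 2)`!%:R / eta ^+ (k * 2))) => q.
rewrite -mulrA; apply: le_trans (_ : B ^+ 2 * qnorm q ^+ (k * 2) <= _); last first.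
  by rewrite ler_wpM2l ?sqr_ge0// exprn_le_expR// frob_norm_ge0.
rewrite exprM -exprMn -(real_normK (num_real (f q))); apply: sqr_le_sqr => //.
Qed.

Lemma qsum_norm q : `|qsum q| <= n%:R ^+ 2 * qnorm q ^+ 1.
Proof.
rewrite (le_trans (ler_norm_sum _ _ _))// expr2 -mulrA [leRHS]mulr_natl.
rewrite -[X in _ *+ X](card_ord n) -sumr_const.
apply: ler_sum => i _; rewrite (le_trans (ler_norm_sum _ _ _))// mulr_natl.
rewrite -[X in _ *+ X](card_ord n) -sumr_const; apply: ler_sum => j _.
exact: entry_frob_norm.
Qed.

Lemma qperp_norm r q : `|qperp q ^+ r| <= 1 * qnorm q ^+ r.
Proof.
rewrite mul1r ger0_norm ?exprn_ge0 ?frob_norm_ge0//.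
by rewrite lerXn2r ?nnegrE ?frob_norm_ge0// perp_K_le_norm.
Qed.

Lemma quad_norm q : `|quad R q| <= 1 * qnorm q ^+ 2.
Proof.
by rewrite mul1r ger0_norm ?dotm_proj_S_ge0// sqr_frob_norm dotm_proj_S_le.
Qed.

Section start.
Variables (b : nat) (x0 : state).
Hypotheses (stale_b : (stale <= b)%N) (x0_near : near b x0) (x0_phase : ph x0 = 0%N).
Variables (eta gam K : R).
Hypotheses (eta0 : 0 < eta)
  (erg : ergodic_chain w F (near b) c ph (fun x => expR (eta * qnorm x.1)) gam K (idle n amax)).

Local Notation dom := (dominated (near b) (fun x : state => expR (eta * qnorm x.1))).
Local Notation mean l := (phase_limit w F c l x0).

Lemma expR_norm_ge1 q : 1 <= expR (eta * qnorm q).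
Proof. by rewrite -expR0 ler_expR mulr_ge0 ?frob_norm_ge0// ltW. Qed.

Lemma poly_dominated k (f : 'M[nat]_n -> R) (B : R) :
  (forall q, `|f q| <= B * qnorm q ^+ k) -> dom (fun x => f x.1).
Proof.
move=> fB; have [C hC] := poly_growth eta0 fB.
exact: (@dominated_sqr _ _ (near b) (fun x : state => expR (eta * qnorm x.1)) _
  (fun x : state => x.1) (fun q => expR (eta * qnorm q)) (fun=> erefl) expR_norm_ge1 f C hC).
Qed.

Lemma steady_mean l k (f : 'M[nat]_n -> R) (B : R) : (forall q, 0 <= f q) ->
  (forall q, `|f q| <= B * qnorm q ^+ k) ->
  law_mean (steady_law w F c (fun x : state => x.1) x0 l) f = (mean l (fun x => f x.1))%:E.
Proof.
move=> f_ge0 fB; have [C hC] := poly_growth eta0 fB.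
apply: (esum_steady_law w_ge0 w_sum1 erg (q := fun x : state => x.1)
  (U := fun q => expR (eta * qnorm q)) l _ x0_near _ _ f_ge0 hC) => //.
- exact: expR_norm_ge1.
- by move=> r; exact: norm_sublevel_finite.
Qed.

Let c_gt0 : (0 < c)%N. Proof. exact: leq_ltn_trans (ctl_phase_lt ctlP f0). Qed.

(** The steady state depends on the start only through its phase.  A bound along the
    chain started empty therefore holds in the steady state with constants that do not
    depend on the initial queues. *)
Lemma mean_le_empty l k (f : 'M[nat]_n -> R) (B D : R) :
  (forall q, `|f q| <= B * qnorm q ^+ k) ->
  (forall t, iter t op (fun x => f x.1) z0 <= D) -> mean l (fun x => f x.1) <= D.
Proof.
move=> fB le; have df := poly_dominated fB.
have nz : near b z0 by apply: always_near_max_le stale_b (empty_state_near_max mwP ctlP phase_f0).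
rewrite (phase_limit_eq w_ge0 w_sum1 erg l x0_near nz _ df).
  by apply: (phase_limit_le_bound w_ge0 w_sum1 erg).
by rewrite x0_phase (empty_state_phase ctlP phase_f0).
Qed.

Let entry_bound : R := n%:R * (n%:R * amax.+1%:R).

Let entry_bound_ge0 : 0 <= entry_bound.
Proof. by rewrite !mulr_ge0. Qed.

Lemma qsum_step x al : `|qsum (F x al).1 - qsum x.1| <= entry_bound.
Proof.
rewrite -sumrB (le_trans (ler_norm_sum _ _ _))// /entry_bound [leRHS]mulr_natl.
rewrite -[X in _ *+ X](card_ord n) -sumr_const; apply: ler_sum => i _.
rewrite -sumrB (le_trans (ler_norm_sum _ _ _))// mulr_natl.
rewrite -[X in _ *+ X](card_ord n) -sumr_const; apply: ler_sum => j _.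
have -> : realmx R (F x al).1 i j =
    (x.1 i j + noise_mx al i j - (sched x.1 x.2 i == j))%N%:R by rewrite mxE switch_stepE.
have -> : realmx R x.1 i j = (x.1 i j)%:R by rewrite mxE.
have := noise_mx_le al i j; move: (noise_mx al i j) (x.1 i j) (_ == _) => y p k yb.
rewrite ler_norml; apply/andP; split.
  by rewrite lerNl opprB lerBlDr -natrD ler_nat; case: k; lia.
by rewrite lerBlDr -natrD ler_nat; case: k; lia.
Qed.

(** In one slot at most [amax] packets join each queue and at most one leaves it. *)
Lemma mean_qsum_phase l k : (l < c)%N -> (k < c)%N ->
  `|mean l (fun x => qsum x.1) - mean k (fun x => qsum x.1)| <= 2 * (c%:R * entry_bound).
Proof.
have dT := poly_dominated qsum_norm.
have step j : `|mean j.+1 (fun x => qsum x.1) - mean j (fun x => qsum x.1)| <= entry_bound.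
  rewrite -phase_limit_op ler_norml.
  have dO := dominated_op w_ge0 w_sum1 erg dT.
  have dle (f g : state -> R) u : dom f -> dom g -> (forall x, near b x -> f x <= u + g x) ->
      mean j f <= u + mean j g.
    move=> df dg le; rewrite -[u in leRHS](phase_limit_cst w_sum1 F c j x0 u) -[X in _ + X]mul1r addrC.
    rewrite -(phase_limit_lin w_ge0 w_sum1 erg) //; last exact: (dominated_cst erg).
    apply: (phase_limit_le w_ge0 w_sum1 erg) => //.
      by apply: dominated_lin => //; exact: (dominated_cst erg).
    by move=> x nx; rewrite mul1r addrC; exact: le.
  have opB x : `|op (fun x => qsum x.1) x - qsum x.1| <= entry_bound.
    rewrite -(noise_op_cst w_sum1 F (qsum x.1) x) -sumrB (le_trans (ler_norm_sum _ _ _))//.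
    rewrite -[leRHS](noise_op_cst w_sum1 F entry_bound x); apply: ler_sum => al _.
    by rewrite -mulrBr normrM ger0_norm// ler_wpM2l// qsum_step.
  apply/andP; split; [rewrite lerNl opprB lerBlDr|rewrite lerBlDr].
    by apply: dle => // x _; have := opB x; rewrite ler_norml => /andP[]; lra.
  by apply: dle => // x _; have := opB x; rewrite ler_norml => /andP[]; lra.
have from0 j : (j < c)%N ->
    `|mean j (fun x => qsum x.1) - mean 0 (fun x => qsum x.1)| <= c%:R * entry_bound.
  move=> jc; apply: le_trans (_ : j%:R * entry_bound <= _); last first.
    by rewrite ler_wpM2r// ler_nat ltnW.
  elim: j {jc} => [|j IH]; first by rewrite subrr normr0 mul0r.
  rewrite -(subrKA (mean j (fun x => qsum x.1))) (le_trans (ler_normD _ _))//.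
  by rewrite -addn1 natrD mulrDl mul1r addrC lerD// addn1.
move=> lc kc; rewrite -(subrKA (mean 0 (fun x => qsum x.1))) (le_trans (ler_normD _ _))//.
by rewrite mulr_natl mulr2n lerD ?from0// distrC from0.
Qed.

Hypothesis arr_uncorrelated : forall i j k l, (i, j) != (k, l) ->
  \sum_al w al * ((realmx R (noise_mx al) - (1 - e) *: nu) i j *
                  (realmx R (noise_mx al) - (1 - e) *: nu) k l) = 0.

Local Notation var_sum := (\sum_i \sum_j arrival_var w (@noise_mx n amax) nu e i j).

(** In steady state the squared norm of the projection has no drift over a period; what
    remains of its one-step change gives the mean of the total queue length, averaged
    over the phases, and the phases differ by a bounded amount. *)
Lemma mean_qsum_estimate l (del C2 : R) : (l < c)%N -> 0 < del ->
  (forall j, mean j (fun x => qperp x.1 ^+ 2) <= C2) ->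
  `|e * mean l (fun x => qsum x.1) - (1 - (2 * n%:R)^-1) * var_sum| <=
  n%:R / 2 * (e ^+ 2 + del * C2 + (del^-1 + 1) * (n%:R * e)) + e * (2 * (c%:R * entry_bound)).
Proof.
move=> lc d0 perpC2; set SV := var_sum.
pose v2 := (2 / n%:R - n%:R ^- 2) * SV + e ^+ 2; pose B := del^-1 + 1.
pose Q (x : state) := quad R x.1; pose T (x : state) := qsum x.1.
pose G (x : state) := qperp x.1 ^+ 2.
have domQ : dom Q := poly_dominated quad_norm.
have domT : dom T := poly_dominated qsum_norm.
have domG : dom G := poly_dominated (qperp_norm 2).
have domop phi : dom phi -> dom (op phi) := dominated_op w_ge0 w_sum1 erg (phi := phi).
have domcst u : dom (fun=> u) := dominated_cst erg u.
have lin j u phi psi : dom phi -> dom psi ->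
    mean j (fun y => u * phi y + psi y) = u * mean j phi + mean j psi.
  exact: (phase_limit_lin w_ge0 w_sum1 erg).
have step j : `|mean j (op Q) - mean j Q + 2 * e / n%:R * mean j T - v2| <=
    del * C2 + B * (mean j (op T) - mean j T + n%:R * e).
  pose phi x := 1 * op Q x + (-1 * Q x + (2 * e / n%:R * T x + - v2)).
  pose psi x := del * op G x + (B * op T x + (- B * T x + B * (n%:R * e))).
  have dphi : dom phi by do ?apply: dominated_lin => //; exact: domop.
  have dpsi : dom psi by do ?apply: dominated_lin => //; exact: domop.
  have bound x : `|phi x| <= psi x.
    have := quad_step n0 w_ge0 w_sum1 arr_mean nu_ds arr_uncorrelated x.1 (sched x.1 x.2) d0.
    rewrite -/SV; set u := `|_|; have -> : u = `|phi x|.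
      by rewrite /u /phi; congr `|_|; rewrite /v2 /op /Q /T /=; ring.
    by move=> h; apply: le_trans h _; rewrite /psi /B /G /T /op /=; lra.
  have phiE : mean j phi = mean j (op Q) - mean j Q + 2 * e / n%:R * mean j T - v2.
    rewrite /phi !lin//; do ?[exact: domop | apply: dominated_lin => //].
    by rewrite (phase_limit_cst w_sum1); ring.
  have psiE : mean j psi = del * mean j.+1 G + B * (mean j (op T) - mean j T + n%:R * e).
    rewrite /psi !lin//; do ?[exact: domop | apply: dominated_lin => //; do ?exact: domop].
    by rewrite (phase_limit_cst w_sum1) [mean j (op G)]phase_limit_op; ring.
  have le1 : mean j phi <= mean j psi.
    apply: (phase_limit_le w_ge0 w_sum1 erg) => // x _.
    exact: le_trans (ler_norm _) (bound x).
  have le2 : -1 * mean j phi + 0 <= mean j psi.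
    rewrite -[X in _ + X <= _](phase_limit_cst w_sum1 F c j x0) -lin//.
    apply: (phase_limit_le w_ge0 w_sum1 erg) => //; first exact: dominated_lin.
    by move=> x _; rewrite addr0 mulN1r (le_trans _ (bound x))// -normrN ler_norm.
  have le3 : del * mean j.+1 G <= del * C2 by rewrite ler_wpM2l ?(ltW d0)// perpC2.
  rewrite -phiE ler_norml; apply/andP; split; lra.
have nR0 : (0 : R) < n%:R by rewrite ltr0n.
have cR0 : (0 : R) < c%:R by rewrite ltr0n.
pose M := \sum_(j < c) mean j T.
have total_bound : `|2 * e / n%:R * M - c%:R * v2| <= c%:R * (del * C2 + B * (n%:R * e)).
  have perQ := period_sum_op w_ge0 w_sum1 erg x0_near domQ.
  have perT := period_sum_op w_ge0 w_sum1 erg x0_near domT.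
  have -> : 2 * e / n%:R * M - c%:R * v2 =
      \sum_(j < c) (mean j (op Q) - mean j Q + 2 * e / n%:R * mean j T - v2).
    rewrite sumrB big_split/= sumrB perQ subrr add0r -mulr_sumr -/M.
    by rewrite sumr_const card_ord (mulr_natl v2).
  have -> : c%:R * (del * C2 + B * (n%:R * e)) =
      \sum_(j < c) (del * C2 + B * (mean j (op T) - mean j T + n%:R * e)).
    rewrite big_split/= -[X in _ = _ + X]mulr_sumr big_split/= sumrB perT subrr add0r.
    rewrite !sumr_const !card_ord.
    by rewrite -(mulr_natl _ c) -(mulr_natl _ c); ring.
  by apply: le_trans (ler_norm_sum _ _ _) _; apply: ler_sum.
have ML : `|c%:R * mean l T - M| <= c%:R * (2 * (c%:R * entry_bound)).
  have cst (X : R) : c%:R * X = \sum_(j < c) X by rewrite sumr_const card_ord mulr_natl.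
  rewrite (cst (mean l T)) (cst (2 * (c%:R * entry_bound))) /M -sumrB.
  rewrite (le_trans (ler_norm_sum _ _ _))//; apply: ler_sum => j _.
  exact: mean_qsum_phase.
have keyE : c%:R * (e * mean l T - (1 - (2 * n%:R)^-1) * SV) =
    n%:R / 2 * (2 * e / n%:R * M - c%:R * v2) + e * (c%:R * mean l T - M)
    + c%:R * (n%:R / 2 * e ^+ 2).
  by rewrite /v2; field; rewrite gt_eqF.
rewrite -(ler_pM2l cR0) -{1}(gtr0_norm cR0) -normrM keyE.
have h1 := ler_wpM2l (divr_ge0 (ltW nR0) (ler0n R 2)) total_bound.
have h2 := ler_wpM2l (ltW e0) ML.
have h3 : 0 <= c%:R * (n%:R / 2 * e ^+ 2).
  by rewrite mulr_ge0 ?(ltW cR0)// mulr_ge0 ?sqr_ge0// divr_ge0 ?(ltW nR0).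
rewrite (le_trans (ler_normD _ _))// (ger0_norm h3) (le_trans (lerD (ler_normD _ _) (lexx _)))//.
rewrite (normrM (n%:R / 2)) (normrM e) (gtr0_norm e0) (ger0_norm (divr_ge0 (ltW nR0) (ler0n R 2))).
rewrite (le_trans (lerD (lerD h1 h2) (lexx _)))// -/B; lra.
Qed.

End start.
End load.
End fixed_load.

(** * The stochastic switch *)

(** The weight [del] of the error terms is taken to be u = sqrt e, which makes all of them
    O(sqrt e). *)
Lemma load_bound (R : realType) (u N C D : R) : 0 < u -> u < 1 -> 0 <= N -> 0 <= C -> 0 <= D ->
  N / 2 * ((u ^+ 2) ^+ 2 + u * C + (u^-1 + 1) * (N * u ^+ 2)) + u ^+ 2 * D <=
  u * (N / 2 * (1 + C + 2 * N) + D).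
Proof.
move=> u0 u1 N0 C0 D0.
have -> : (u^-1 + 1) * (N * u ^+ 2) = N * (u + u ^+ 2) by field; rewrite gt_eqF.
have u2 : u ^+ 2 <= u by rewrite expr2 ler_piMr// ltW.
have u4 : (u ^+ 2) ^+ 2 <= u.
  by apply: le_trans (u2); rewrite [leLHS]expr2 ler_piMr ?sqr_ge0// (le_trans u2)// ltW.
rewrite [leRHS]mulrDr lerD ?ler_wpM2r// [leRHS]mulrCA ler_wpM2l ?divr_ge0//.
have := ler_wpM2l N0 u2; lra.
Qed.

Section stochastic_switch.
Variables (R : realType) (n amax : nat) (ctl : finType).
Variables (sched : 'M[nat]_n -> ctl -> 'S_n) (next : 'M[nat]_n -> ctl -> ctl).
Variables (mw : 'M[nat]_n -> 'S_n) (m c : nat) (phase : ctl -> nat) (f0 : ctl).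
Hypotheses (n0 : (0 < n)%N) (mwP : maxweight_rule mw)
  (ctlP : recent_maxweight amax sched next mw m c phase) (phase_f0 : phase f0 = 0%N).
Variables (nu : 'M[R]_n) (vmin : R).
Hypotheses (nu_ds : doubly_stochastic nu) (vmin0 : 0 < vmin)
  (nu_min : forall i j, vmin <= nu i j).

Local Notation state := (switch_state n ctl).
Local Notation F := (@switch_update n amax ctl sched next).
Local Notation qnorm := (fun q : 'M[nat]_n => frob_norm (realmx R q)).
Local Notation qperp := (fun q : 'M[nat]_n => frob_norm (perp_K (realmx R q))).
Local Notation qsum := (fun q : 'M[nat]_n => \sum_i \sum_j realmx R q i j).
Local Notation stale := (staleness n amax m).
Local Notation z0 := (empty_state next m c f0 : state).
Local Notation near := (@always_near_max n amax ctl sched next).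
Local Notation ph := (fun x : state => phase x.2).

Fixpoint ctl_path (T : Type) (q : nat -> T -> 'M[nat]_n) (t : nat) (w : T) : ctl :=
  if t is t'.+1 then next (q t' w) (ctl_path q t' w) else f0.

Section load.
Variables (e : R) (d : measure_display) (T : measurableType d) (P : probability T R).
Variables (a : nat -> T -> 'M[nat]_n) (q : nat -> T -> 'M[nat]_n) (s : nat -> T -> 'S_n).
Variable q0 : 'M[nat]_n.
Hypotheses (e0 : 0 < e) (e1 : e < 1) (arrivals : arrival_process P a amax)
  (mean_nu : arrival_mean P a ((1 - e) *: nu)) (q_start : forall w, q 0%N w = q0)
  (evol : switch_evolution a q s)
  (s_ctl : forall t w, s t w = sched (q t w) (ctl_path q t w)).

Let w : noise_type n amax -> R := noise_pmf P a.
Let w_ge0 : forall al, 0 <= w al := noise_pmf_ge0 P a.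
Let w_sum1 : \sum_al w al = 1 := noise_pmf_sum1 arrivals.
Let idle_gt0 : 0 < w (idle n amax) := noise_pmf_zero_gt0 arrivals.
Let arr_mean i j : \sum_al w al * (noise_mx al i j)%:R = (1 - e) * nu i j.
Proof. by rewrite (mean_entry arrivals mean_nu) mxE. Qed.

Let arr_uncorrelated i j k l : (i, j) != (k, l) ->
  \sum_al w al * ((realmx R (noise_mx al) - (1 - e) *: nu) i j *
                  (realmx R (noise_mx al) - (1 - e) *: nu) k l) = 0.
Proof.
move=> ne; rewrite -[RHS](noise_pmf_uncorrelated arrivals mean_nu ne).
by apply: eq_bigr => al _; congr (_ * (_ * _)); rewrite 2!mxE [X in _ + X]mxE.
Qed.

Local Notation op := (noise_op w F).
Local Notation X := (fun t w => (q t w, ctl_path q t w) : state).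
Let x0 : state := (q0, f0).

Lemma switch_chain t : X t = chain a F x0 t.
Proof.
elim: t => [|t IH]; apply/funext => v; first by rewrite /= q_start.
have Et := congr1 (fun g => g v) IH; rewrite /= in Et.
rewrite /chain /= -[traj _ _ _ t]/(chain a F x0 t v) -Et /switch_update /=.
congr pair; apply/matrixP => i j; rewrite (evol t) [RHS]mxE s_ctl.
by rewrite (noise_mxE arrivals).
Qed.

Let reach x : exists M, iter M (F^~ (idle n amax)) x = z0.
Proof. exact: (idle_reach mwP ctlP phase_f0 x). Qed.

Let z0_near b : (stale <= b)%N -> near b z0.
Proof. by move=> sb; apply: always_near_max_le sb (empty_state_near_max mwP ctlP phase_f0). Qed.

Let z0_phase : ph x0 = ph z0.
Proof. by rewrite /= [RHS](empty_state_phase ctlP phase_f0) phase_f0. Qed.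

Let ergodic b := switch_ergodic n0 mwP ctlP nu_ds vmin0 nu_min w_ge0 w_sum1 arr_mean e0 idle_gt0 b.

(** The controller is a function of the past queue lengths. *)
Lemma history_state t : discrete_rv (history q s t) (X t).
Proof.
have sG := @smallest_sigma_algebra T setT [set E | exists k, (k <= t)%N /\
  ((exists A : set 'M[nat]_n, E = q k @^-1` A) \/ (exists B : set 'S_n, E = s k @^-1` B))].
have qk k : (k <= t)%N -> discrete_rv (history q s t) (q k).
  by move=> kt B; apply: sub_sigma_algebra; exists k; split=> //; left; exists B.
suff fk k : (k <= t)%N -> discrete_rv (history q s t) (ctl_path q k).
  exact: (discrete_rv_comp2 sG pair (qk t (leqnn t)) (fk t (leqnn t))).
elim: k => [|k IH] kt; first exact: (discrete_rv_cst sG).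
exact: (discrete_rv_comp2 sG next (qk k (ltnW kt)) (IH (ltnW kt))).
Qed.

Lemma switch_stable : stable_switch P q s c.
Proof.
have [b sb xb] := always_near_max_any mwP ctlP x0.
have [eta [gam [K [eta0 erg]]]] := ergodic b; have zb := z0_near sb.
pose C := recurrent_class w F z0.
exists state, (chain a F x0), (noise_kernel w F), fst, C; split.
- split; first exact: kernel_stochastic.
  exact: (chain_markov arrivals F x0).
- split; first by move=> t A; rewrite -switch_chain; exact: history_state.
  + exact: (class_communicates w_ge0 w_sum1 erg reach).
  + have mC t : measurable (chain a F x0 t @^-1` C) by exact: (chain_rv arrivals).
    have mE : measurable [set v | exists t, C (chain a F x0 t v)].
      by apply: (sigma_exists (sigma_algebra_measurable T)) => t; exact: mC.
    apply/eqP; rewrite eq_le probability_le1//=; apply/lee_addgt0Pr => r r0.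
    have [t ht] := class_absorbs w_ge0 w_sum1 erg zb xb z0_phase r0.
    apply: le_trans (_ : P (chain a F x0 t @^-1` C) + r%:E <= _)%E; last first.
      by rewrite leeD2r// le_measure ?inE// => v Cv; exists t.
    by rewrite (chain_law arrivals) -EFinD lee_fin -lerBlDr.
  + by move=> x; exact: (class_period w_ge0 w_sum1 erg zb reach).
- split=> [t v|A finA]; first by rewrite -switch_chain.
   apply: (@sub_finite_set _ _ (A `*` [set: ctl])); first by move=> [].
  by apply: finite_setX => //; exact: finite_finset.
- by move=> x; exact: (class_positive_recurrent w_ge0 w_sum1 erg zb reach).
Qed.

Section steady.
Variables (b : nat) (eta gam K : R).
Hypotheses (x0_near : near b x0) (eta0 : 0 < eta)
  (erg : ergodic_chain w F (near b) c ph (fun x => expR (eta * qnorm x.1)) gam K (idle n amax)).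

Let mu l := steady_law w F c (fun x : state => x.1) x0 l.

Lemma switch_steady_state l : steady_state P q c l (mu l).
Proof.
have mu0 v : 0 <= mu l v := steady_law_ge0 w_ge0 w_sum1 erg _ l x0_near v.
have meanE := steady_mean (k := 0) (B := 1) w_ge0 w_sum1 x0_near eta0 erg l.
have indE (A : set 'M[nat]_n) : (\esum_(v in A) (mu l v)%:E)%E =
    (phase_limit w F c l x0 (fun x => (`[< A x.1 >])%:R))%:E.
  rewrite -(meanE (fun v => (`[< A v >])%:R)) => [|v|v]; last first.
  - by rewrite mulr1 ger0_norm ?ler0n// lern1 leq_b1.
  - exact: ler0n.
  - rewrite esum_mkcond; apply: eq_esum => v _.
    have [vA|vA] := boolP (v \in A); first by rewrite asboolT ?mulr1//; exact/set_mem.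
    by rewrite asboolF ?mulr0// => /mem_set; apply/negP.
split; first split=> //.
- rewrite indE (_ : (fun _ => _) = fun=> 1); first by rewrite (phase_limit_cst w_sum1).
  by apply/funext => x; rewrite asboolT.
- move=> A; rewrite indE.
  rewrite (_ : (fun k => P _) = EFin \o (fun k => iter (k * c + l) op (fun x => (`[< A x.1 >])%:R) x0)).
    apply: cvg_EFin; first by near=> k.
    apply: (phase_limit_cvg w_ge0 w_sum1 erg x0_near).
    exact: (dominated_indic erg (fun x : state => `[< A x.1 >])).
  apply/funext => k /=; rewrite -(chain_law arrivals F x0 _ [set x : state | A x.1]).
  congr (P _); rewrite -switch_chain //.
Unshelve. all: by end_near. Qed.

Hypothesis stale_b : (stale <= b)%N.

Lemma switch_perp_moment l r (C : R) :
  (forall t, iter t op (fun x => qperp x.1 ^+ r) z0 <= C) ->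
  (law_mean (mu l) (fun v => (qperp v ^+ r)%R) <= C%:E)%E.
Proof.
move=> leC; rewrite (steady_mean w_ge0 w_sum1 x0_near eta0 erg l
  (k := r) (f := fun v => qperp v ^+ r) (B := 1)).
- rewrite lee_fin; apply: (mean_le_empty mwP ctlP phase_f0 w_ge0 w_sum1 stale_b x0_near
    phase_f0 eta0 erg _ (k := r) (f := fun v => qperp v ^+ r) (B := 1)) => // v.
  exact: qperp_norm.
- by move=> v; rewrite exprn_ge0// frob_norm_ge0.
- exact: qperp_norm.
Qed.

Lemma switch_qsum l (C2 : R) : (l < c)%N ->
  (forall t, iter t op (fun x => qperp x.1 ^+ 2) z0 <= C2) ->
  exists2 L : R, law_mean (mu l) qsum = L%:E &
  `|e * L - (1 - (2 * n%:R)^-1) * (\sum_i \sum_j fine ('V_P[(fun v => (a 0%N v i j)%:R : R)])%E)| <=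
  Num.sqrt e * (n%:R / 2 * (1 + C2 + 2 * n%:R) + 2 * (c%:R * (n%:R * (n%:R * amax.+1%:R)))).
Proof.
move=> lc leC2; have nE : law_mean (mu l) qsum =
    (phase_limit w F c l x0 (fun x => entry_sum (realmx R x.1)))%:E.
  apply: (steady_mean w_ge0 w_sum1 x0_near eta0 erg l (k := 1) _ (@qsum_norm R n)).
  by move=> v; apply: sumr_ge0 => i _; apply: sumr_ge0 => j _; rewrite mxE.
eexists; first exact: nE.
have varE : (\sum_i \sum_j fine ('V_P[(fun v => (a 0%N v i j)%:R : R)])%E) =
    \sum_i \sum_j arrival_var w (@noise_mx n amax) nu e i j.
  apply: eq_bigr => i _; apply: eq_bigr => j _.
  rewrite (var_entry arrivals mean_nu) /=; apply: eq_bigr => al _.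
  by congr (_ * _ ^+ 2); rewrite [RHS]mxE [X in _ = X + _]mxE [X in _ = _ + X]mxE.
rewrite varE; set u := Num.sqrt e.
have u0 : 0 < u by rewrite sqrtr_gt0.
have eE : e = u ^+ 2 by rewrite sqr_sqrtr// ltW.
have u1 : u < 1 by rewrite -sqrtr1 ltr_sqrt.
have C20 : 0 <= C2 by apply: le_trans (leC2 0%N); rewrite exprn_ge0// frob_norm_ge0.
apply: le_trans (mean_qsum_estimate n0 ctlP phase_f0 nu_ds vmin0 w_ge0 w_sum1 arr_mean e0 e1
  idle_gt0 stale_b x0_near phase_f0 eta0 erg arr_uncorrelated lc u0 (C2 := C2) _) _.
  move=> j; apply: (mean_le_empty mwP ctlP phase_f0 w_ge0 w_sum1 stale_b x0_near
    phase_f0 eta0 erg _ (k := 2) (f := fun v => qperp v ^+ 2) (B := 1)) => // v.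
  exact: qperp_norm.
set D := 2 * _; have D0 : 0 <= D by rewrite !mulr_ge0.
by rewrite eE; exact: load_bound.
Qed.

End steady.

End load.
End stochastic_switch.

Section heavy_traffic.
Variables (R : realType) (n amax : nat) (ctl : finType).
Variables (sched : 'M[nat]_n -> ctl -> 'S_n) (next : 'M[nat]_n -> ctl -> ctl).
Variables (mw : 'M[nat]_n -> 'S_n) (m c : nat) (phase : ctl -> nat) (f1 : ctl).
Hypotheses (n0 : (0 < n)%N) (mwP : maxweight_rule mw)
  (ctlP : recent_maxweight amax sched next mw m c phase) (phase_f1 : phase f1 = 0%N).
Variables (nu sigma : 'M[R]_n).
Hypotheses (nu_ds : doubly_stochastic nu) (nu_gt0 : forall i j, 0 < nu i j).
Variables (d : R -> measure_display) (T : forall e : R, measurableType (d e)).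
Variables (P : forall e : R, probability (T e) R) (a : forall e : R, nat -> T e -> 'M[nat]_n).
Variables (q : forall e : R, nat -> T e -> 'M[nat]_n) (s : forall e : R, nat -> T e -> 'S_n).
#[local] Arguments a : clear implicits.
#[local] Arguments q : clear implicits.
#[local] Arguments s : clear implicits.
Hypotheses (arrivals : forall e : R, 0 < e < 1 -> arrival_process (P e) (a e) amax)
  (mean_nu : forall e : R, 0 < e < 1 -> arrival_mean (P e) (a e) ((1 - e) *: nu))
  (var_lim : forall t i j,
     (fun e : R => 'V_(P e)[(fun w => (a e t w i j)%:R : R)]%E) @ 0^'+
       --> (sigma i j ^+ 2)%:E).
Variables (q0 : R -> 'M[nat]_n) (f0 : R -> ctl).
Hypotheses (phase_f0 : forall e, phase (f0 e) = 0%N).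
Hypothesis dynamics : forall e : R, 0 < e < 1 ->
  [/\ forall w, q e 0%N w = q0 e, switch_evolution (a e) (q e) (s e)
    & forall t w, s e t w = sched (q e t w) (ctl_path next (f0 e) (q e) t w)].

Local Notation F := (@switch_update n amax ctl sched next).
Local Notation qperp := (fun q : 'M[nat]_n => frob_norm (perp_K (realmx R q))).
Local Notation qsum := (fun q : 'M[nat]_n => \sum_i \sum_j realmx R q i j).

Lemma min_entry : exists2 vmin, 0 < vmin & forall i j, vmin <= nu i j.
Proof.
exists (\big[Num.min/1]_(ij : 'I_n * 'I_n) nu ij.1 ij.2) => [|i j].
  by apply: (big_ind (fun x => 0 < x)) => // x y x0 y0; rewrite lt_min x0.
exact: (bigmin_le _ (i, j) (fun ij => nu ij.1 ij.2)).
Qed.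

Let small (e : R) : bool := 0 < e < 1.

(** One law for each load and each phase serves both conclusions. *)
Lemma steady_laws : exists (e0 : R) (Cst : nat -> R) (D : R)
    (mu : R -> nat -> 'M[nat]_n -> R), [/\ 0 < e0,
  forall e l, small e -> steady_state (P e) (q e) c l (mu e l),
  forall e l r, small e -> e <= e0 -> (l < c)%N ->
    (law_mean (mu e l) (fun v => (qperp v ^+ r)%R) <= (Cst r)%:E)%E
  & forall e l, small e -> e <= e0 -> (l < c)%N ->
    exists2 L : R, law_mean (mu e l) qsum = L%:E &
    `|e * L - (1 - (2 * n%:R)^-1) *
        (\sum_i \sum_j fine 'V_(P e)[(fun v => (a e 0%N v i j)%:R : R)]%E)| <=
    Num.sqrt e * D].
Proof.
have [vmin vmin0 nu_min] := min_entry.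
have [Cst moments] := perp_moments n0 mwP ctlP phase_f1 nu_ds vmin0 nu_min.
have nnu : 0 <= frob_norm nu := frob_norm_ge0 nu.
(* e * frob_norm nu <= vmin / 2 up to this load *)
pose e0 := vmin / (2 * (1 + frob_norm nu)).
have e0_gt0 : 0 < e0 by rewrite divr_gt0// mulr_gt0// ltr_pwDl.
pose D := n%:R / 2 * (1 + Cst 2%N + 2 * n%:R) + 2 * (c%:R * (n%:R * (n%:R * amax.+1%:R))) : R.
exists e0, Cst, D.
suff /choice [mu hmu] : forall e, exists mu : nat -> 'M[nat]_n -> R, small e ->
    [/\ forall l, steady_state (P e) (q e) c l (mu l),
    forall l r, e <= e0 -> (l < c)%N ->
    (law_mean (mu l) (fun v => (qperp v ^+ r)%R) <= (Cst r)%:E)%E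
  & forall l, e <= e0 -> (l < c)%N ->
    exists2 L : R, law_mean (mu l) qsum = L%:E &
    `|e * L - (1 - (2 * n%:R)^-1) *
        (\sum_i \sum_j fine 'V_(P e)[(fun v => (a e 0%N v i j)%:R : R)]%E)| <=
    Num.sqrt e * D].
  exists mu; split=> // [e l|e l r|e l] sm; have [h1 h2 h3] := hmu e sm => //; first exact: h2.
  exact: h3.
move=> e; have [sm|] := boolP (small e); last by exists (fun _ _ => 0).
have /andP[eps0 eps1] := sm; have [qs ev sc] := dynamics sm.
have [b sb xb] := always_near_max_any mwP ctlP (q0 e, f0 e).
have ar := arrivals sm; have me := mean_nu sm.
have w1 := noise_pmf_sum1 ar; have w0 := noise_pmf_ge0 (P e) (a e) (amax := amax).
have wm i j : \sum_(al : noise_type n amax) noise_pmf (P e) (a e) al * (noise_mx al i j)%:R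
    = (1 - e) * nu i j.
  by rewrite (mean_entry ar me) mxE.
have [eta [gam [K [eta0 erg]]]] := switch_ergodic n0 mwP ctlP nu_ds vmin0 nu_min
  w0 w1 wm eps0 (noise_pmf_zero_gt0 ar) b.
have mom : e <= e0 -> forall r t, iter t (noise_op (noise_pmf (P e) (a e)) F)
    (fun y => qperp y.1 ^+ r) (empty_state next m c (f0 e)) <= Cst r.
  move=> ee r t; rewrite (empty_state_eq ctlP (phase_f0 e) phase_f1); apply: (moments e) => //.
  have : e * (2 * (1 + frob_norm nu)) <= vmin by rewrite -ler_pdivlMr// mulr_gt0// ltr_pwDl.
  by lra.
exists (steady_law (noise_pmf (P e) (a e)) F c fst (q0 e, f0 e)) => _; split.
- move=> l; exact: (switch_steady_state ar qs ev sc xb eta0 erg).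
- move=> l r ee lc.
  exact: (switch_perp_moment n0 mwP ctlP (phase_f0 e) ar xb eta0 erg sb l (mom ee r)).
- move=> l ee lc.
  exact: (switch_qsum n0 mwP ctlP (phase_f0 e) nu_ds vmin0 eps0 eps1 ar me xb eta0 erg sb lc
    (mom ee 2%N)).
Qed.

Theorem recent_maxweight_SSC : achieves_SSC P q s c.
Proof.
have [vmin vmin0 nu_min] := min_entry; split=> [e sm|].
  have /andP[e0 e1] := sm; have [qs ev sc] := dynamics sm.
  exact: (switch_stable n0 mwP ctlP (phase_f0 e) nu_ds vmin0 nu_min e0
    (arrivals sm) (mean_nu sm) qs ev sc).
have [e0 [Cst [D [mu [e0_gt0 st mom _]]]]] := steady_laws.
exists e0, Cst; split=> // e sm ee l lc; exists (mu e l); first exact: st.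
by move=> r _; exact: mom.
Qed.

Theorem recent_maxweight_heavy_traffic :
  heavy_traffic_limit P q c ((1 - (2 * n%:R)^-1) * frob_norm sigma ^+ 2).
Proof.
have [e0 [Cst [D [mu [e0_gt0 st _ est]]]]] := steady_laws.
move=> l lc; exists (fun e => mu e l) => [e sm|]; first exact: st.
have [L hL] : exists L : R -> R, forall e, small e && (e <= e0) ->
    law_mean (mu e l) qsum = (L e)%:E /\
    `|e * L e - (1 - (2 * n%:R)^-1) *
        (\sum_i \sum_j fine 'V_(P e)[(fun v => (a e 0%N v i j)%:R : R)]%E)| <= Num.sqrt e * D.
  suff /choice[L hL] : forall e, exists L : R, small e && (e <= e0) ->
      law_mean (mu e l) qsum = L%:E /\
      `|e * L - (1 - (2 * n%:R)^-1) *
        (\sum_i \sum_j fine 'V_(P e)[(fun v => (a e 0%N v i j)%:R : R)]%E)| <= Num.sqrt e * D.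
    by exists L.
  move=> e; have [/andP[sm ee]|] := boolP (small e && (e <= e0)); last by exists 0.
  by have [L L1 L2] := est e l sm ee lc; exists L.
have near_small : \forall e \near (0 : R)^'+, small e && (e <= e0).
  near=> e; apply/andP; split; last by near: e; exact: nbhs_right_le.
  by apply/andP; split; near: e; [exact: nbhs_right_gt|exact: nbhs_right_lt].
pose V e : R := \sum_i \sum_j fine 'V_(P e)[(fun v => (a e 0%N v i j)%:R : R)]%E.
have Vlim : V e @[e --> 0^'+] --> frob_norm sigma ^+ 2.
  rewrite sqr_frob_norm; apply: cvg_sumr => i; apply: cvg_sumr => j; rewrite -expr2.
  exact: (fine_cvg (@var_lim 0%N i j)).
have sqrt_lim : Num.sqrt e * D @[e --> (0 : R)^'+] --> (0 : R).
  have sqrt0 : Num.sqrt e @[e --> (0 : R)^'+] --> Num.sqrt (0 : R).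
    by apply: cvg_at_right_filter; exact: sqrt_continuous.
  by rewrite sqrtr0 in sqrt0; rewrite -[X in _ --> X](mul0r D); exact: cvgMl.
have diff_lim : (e * L e - (1 - (2 * n%:R)^-1) * V e) @[e --> (0 : R)^'+] --> (0 : R).
  apply: norm_cvg0; apply: (squeeze_cvgr _ (cvg_cst (0 : R)) sqrt_lim).
  near=> e; rewrite normr_ge0 /=; apply: (hL e _).2.
  by near: e.
apply: cvg_EFin.
  near=> e; have /hL[-> _] : small e && (e <= e0) by near: e.
  by [].
have : (e * L e - (1 - (2 * n%:R)^-1) * V e) + (1 - (2 * n%:R)^-1) * V e @[e --> (0 : R)^'+]
    --> 0 + (1 - (2 * n%:R)^-1) * frob_norm sigma ^+ 2.
  by apply: cvgD => //; apply: cvgMr.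
rewrite add0r; apply: cvg_trans; apply: near_eq_cvg; near=> e.
have /hL[E _] : small e && (e <= e0) by near: e.
by rewrite /= E /= subrK.
Unshelve. all: by end_near. Qed.

End heavy_traffic.

(** * Bursty and pipelined MaxWeight *)

Section bursty.
Variables (n m : nat) (mw : 'M[nat]_n -> 'S_n).

(** The schedule of the previous slot and the position in the current burst. *)
Definition bursty_ctl : finType := ('S_n * 'I_m)%type.

Definition bursty_sched (q : 'M[nat]_n) (f : bursty_ctl) : 'S_n :=
  if f.2 == 0%N :> nat then mw q else f.1.

Definition bursty_next (q : 'M[nat]_n) (f : bursty_ctl) : bursty_ctl :=
  (bursty_sched q f, ordS f.2).

Section run.
Variables (Q : nat -> 'M[nat]_n) (g : nat -> bursty_ctl).
Hypothesis g_next : forall t, g t.+1 = bursty_next (Q t) (g t).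

Lemma bursty_phase t : (g t).2 = (((g 0%N).2 + t) %% m)%N :> nat.
Proof.
elim: t => [|t IH]; first by rewrite addn0 modn_small.
by rewrite g_next /= IH -addn1 modnDml addn1 addnS.
Qed.

Lemma bursty_run t j : (g t).2 = 0%N :> nat -> (j < m)%N ->
  bursty_sched (Q (t + j)) (g (t + j)%N) = mw (Q t).
Proof.
move=> t0; elim: j => [|j IH] jm; first by rewrite addn0 /bursty_sched t0.
have ph : (g (t + j.+1)%N).2 = j.+1 :> nat.
  rewrite bursty_phase addnA -modnDml -bursty_phase t0 add0n modn_small//.
by rewrite /bursty_sched ph /= addnS g_next /= IH// ltnW.
Qed.

End run.

Hypothesis m0 : (0 < m)%N.

(** The burst in progress after [m] slots started within these [m] slots, namely when
    the clock came back to 0. *)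
Lemma bursty_recent amax :
  recent_maxweight amax bursty_sched bursty_next mw m m (fun f => f.2).
Proof.
split=> [x al y|q f|f|f f' ff'].
- pose g t := (traj (@switch_update n amax _ bursty_sched bursty_next) x al t).2.
  pose Q t := (traj (@switch_update n amax _ bursty_sched bursty_next) x al t).1.
  have gn t : g t.+1 = bursty_next (Q t) (g t) by [].
  have lm := ltn_ord x.2.2; exists (m - x.2.2)%N; first exact: leq_subr.
  have := @bursty_run Q g gn (m - x.2.2)%N x.2.2 _ lm; rewrite subnK ?(ltnW lm)//; apply.
  by rewrite (bursty_phase gn) /= subnKC ?(ltnW lm)// modnn.
- by [].
- exact: ltn_ord.
- have run h : (iter m (bursty_next 0) h).1 = mw 0.
    pose g t := iter t (bursty_next 0) h.
    have gn t : g t.+1 = bursty_next ((fun=> 0) t) (g t) by [].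
    have lm := ltn_ord h.2; pose t := ((m - h.2) %% m)%N.
    have tm : (t < m)%N by rewrite ltn_mod.
    have ph_t : (g t).2 = 0%N :> nat.
      by rewrite (bursty_phase gn) modnDmr subnKC ?(ltnW lm)// modnn.
    have jm : (m.-1 - t < m)%N by rewrite (leq_ltn_trans (leq_subr _ _))// prednK.
    have e : (t + (m.-1 - t) = m.-1)%N by rewrite subnKC// -ltnS prednK.
    have := bursty_run gn ph_t jm; rewrite e => <-.
    have -> : iter m (bursty_next 0) h = g m.-1.+1 by rewrite /g prednK.
    by rewrite gn.
  rewrite [LHS]surjective_pairing [RHS]surjective_pairing !run; congr pair; apply: val_inj.
  have ph h : (iter m (bursty_next 0) h).2 = ((h.2 + m) %% m)%N :> nat.
    exact: (@bursty_phase (fun=> 0) (fun t => iter t (bursty_next 0) h)).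
  by rewrite /= (ph f) (ph f') ff'.
Qed.

Lemma bursty_dynamics (T : Type) (q : nat -> T -> 'M[nat]_n) (s : nat -> T -> 'S_n)
    (f : bursty_ctl) :
  f.2 = 0%N :> nat -> bursty_maxweight mw m q s ->
  forall t w, s t w = bursty_sched (q t w) (ctl_path bursty_next f q t w).
Proof.
move=> f0 sE t w; have gn k : ctl_path bursty_next f q k.+1 w =
  bursty_next (q k w) (ctl_path bursty_next f q k w) by [].
rewrite sE {2 3}(divn_eq t m).
rewrite (@bursty_run (q^~ w) (fun k => ctl_path bursty_next f q k w) gn)// ?ltn_mod//.
by rewrite (bursty_phase gn) /= f0 add0n modnMl.
Qed.

End bursty.

Section pipelined.
Variables (n m' : nat) (mw : 'M[nat]_n -> 'S_n).
Local Notation m := m'.+1.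

(** Entry i is the schedule for i slots later; those of the first [m] slots are part of the
    initial state. *)
Definition pipelined_ctl : finType := {ffun 'I_m -> 'S_n}.

Definition pipelined_sched (q : 'M[nat]_n) (f : pipelined_ctl) : 'S_n := f ord0.

Definition pipelined_next (q : 'M[nat]_n) (f : pipelined_ctl) : pipelined_ctl :=
  [ffun i : 'I_m => if i == m' :> nat then mw q else f (inord i.+1)].

Lemma pipelined_run (Q : nat -> 'M[nat]_n) (g : nat -> pipelined_ctl) :
  (forall t, g t.+1 = pipelined_next (Q t) (g t)) -> forall t (i : 'I_m),
  g t i = if (t + i < m)%N then g 0%N (inord (t + i)) else mw (Q (t + i - m)%N).
Proof.
move=> gn; elim=> [|t IH] i; first by rewrite add0n ltn_ord inord_val.
rewrite gn ffunE; have [im|im] := eqVneq (i : nat) m'.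
  by rewrite im addSnnS ltnNge leq_addl/= addnK.
have im' : (i.+1 < m)%N by rewrite ltnS ltn_neqAle im -ltnS ltn_ord.
by rewrite IH inordK// addnS addSn.
Qed.

(** The schedule in use is always exactly [m] slots old; there is no clock, that is, its
    period is 1. *)
Lemma pipelined_recent amax :
  recent_maxweight amax pipelined_sched pipelined_next mw m 1 (fun=> 0%N).
Proof.
split=> // [x al y|f f' _].
- pose g t := (traj (@switch_update n amax _ pipelined_sched pipelined_next) x al t).2.
  pose Q t := (traj (@switch_update n amax _ pipelined_sched pipelined_next) x al t).1.
  have gn t : g t.+1 = pipelined_next (Q t) (g t) by [].
  by exists 0%N => //; have := pipelined_run gn m ord0; rewrite addn0 ltnn subnn.
- apply/ffunP => i.
  have run h : iter m (pipelined_next 0) h i = mw 0.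
    rewrite (@pipelined_run (fun=> 0) (fun t => iter t (pipelined_next 0) h))//.
    by rewrite ltnNge leq_addr.
  by rewrite !run.
Qed.

Lemma pipelined_dynamics (T : Type) (q : nat -> T -> 'M[nat]_n) (s : nat -> T -> 'S_n)
    (f : pipelined_ctl) :
  (forall (i : 'I_m) w, s i w = f i) -> pipelined_maxweight mw m q s ->
  forall t w, s t w = pipelined_sched (q t w) (ctl_path pipelined_next f q t w).
Proof.
move=> sf [sE _] t w; rewrite /pipelined_sched.
rewrite (@pipelined_run (q^~ w) (fun k => ctl_path pipelined_next f q k w))// addn0.
case: ifPn => [tm|]; first by rewrite /= -(sf _ w) inordK.
by rewrite -leqNgt => mt; rewrite -sE subnK.
Qed.

End pipelined.

Theorem proposition11 (R : realType) (n m : nat) (hn : (0 < n)%N)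
  (hm : (0 < m)%N) (nu sigma : 'M[R]_n) (hnu : doubly_stochastic nu)
  (hnu_min : forall i j, 0 < nu i j) (amax : nat)
  (d : R -> measure_display) (T : forall e : R, measurableType (d e))
  (P : forall e : R, probability (T e) R)
  (a : forall e : R, nat -> T e -> 'M[nat]_n)
  (harr : forall e : R, 0 < e < 1 -> arrival_process (P e) (a e) amax)
  (hmean : forall e : R, 0 < e < 1 -> arrival_mean (P e) (a e) ((1 - e) *: nu))
  (hvar : forall t i j,
     (fun e : R => 'V_(P e)[(fun w => (a e t w i j)%:R : R)]%E) @ 0^'+
       --> (sigma i j ^+ 2)%:E)
  (mw : 'M[nat]_n -> 'S_n) (hmw : maxweight_rule mw) :
  (forall (q : forall e : R, nat -> T e -> 'M[nat]_n)
          (s : forall e : R, nat -> T e -> 'S_n),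
     (forall e : R, 0 < e < 1 ->
        [/\ deterministic (q e 0%N),
            switch_evolution (a e) (q e) (s e)
          & bursty_maxweight mw m (q e) (s e)]) ->
     achieves_SSC P q s m /\
     heavy_traffic_limit P q m
       ((1 - (2 * n%:R)^-1) * frob_norm sigma ^+ 2))
  /\
  (forall (q : forall e : R, nat -> T e -> 'M[nat]_n)
          (s : forall e : R, nat -> T e -> 'S_n),
     (forall e : R, 0 < e < 1 ->
        [/\ deterministic (q e 0%N),
            switch_evolution (a e) (q e) (s e)
          & pipelined_maxweight mw m (q e) (s e)]) ->
     achieves_SSC P q s 1 /\
     heavy_traffic_limit P q 1
       ((1 - (2 * n%:R)^-1) * frob_norm sigma ^+ 2)).
Proof.
have start (q : forall e : R, nat -> T e -> 'M[nat]_n) :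
    (forall e, 0 < e < 1 -> deterministic (q e 0%N)) ->
    exists q0 : R -> 'M[nat]_n, forall e, 0 < e < 1 -> forall w, q e 0%N w = q0 e.
  move=> det; suff /choice[q0 h] : forall e, exists v, 0 < e < 1 -> forall w, q e 0%N w = v.
    by exists q0.
  move=> e; have [/det[v h]|] := boolP (0 < e < 1); first by exists v.
  by exists 0.
split=> q s hyp.
  have [|q0 q0E] := start q; first by move=> e /hyp[].
  pose f : bursty_ctl n m := (1%g, Ordinal hm).
  have dyn e : 0 < e < 1 -> [/\ forall w, q e 0%N w = q0 e, switch_evolution (a e) (q e) (s e)
      & forall t w, s e t w = bursty_sched mw (q e t w) (ctl_path (bursty_next mw) f (q e) t w)].
    by move=> sm; have [_ ev sE] := hyp e sm; split=> //; [exact: q0E|exact: bursty_dynamics].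
  split.
    exact: (recent_maxweight_SSC hn hmw (bursty_recent mw hm amax) (f1 := f) erefl
      (q0 := q0) (f0 := fun=> f)
      hnu hnu_min harr hmean (fun=> erefl) dyn).
  exact: (recent_maxweight_heavy_traffic hn hmw (bursty_recent mw hm amax) (f1 := f) erefl
      (q0 := q0) (f0 := fun=> f)
      hnu hnu_min harr hmean hvar (fun=> erefl) dyn).
case: m hm hyp => // m' _ hyp.
have [|q0 q0E] := start q; first by move=> e /hyp[].
have [f fE] : exists f : R -> pipelined_ctl n m', forall e, 0 < e < 1 ->
    forall (i : 'I_m'.+1) w, s e i w = f e i.
  suff /choice[f h] : forall e, exists f : pipelined_ctl n m', 0 < e < 1 ->
      forall (i : 'I_m'.+1) w, s e i w = f i by exists f.
  move=> e; have [/hyp[_ _ [_ det]]|] := boolP (0 < e < 1); last by exists [ffun=> 1%g].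
  have /choice[g gE] : forall i : 'I_m'.+1, exists v, forall w, s e i w = v.
    by move=> i; exact: det.
  by exists [ffun i => g i] => _ i w; rewrite ffunE.
have dyn e : 0 < e < 1 -> [/\ forall w, q e 0%N w = q0 e, switch_evolution (a e) (q e) (s e)
    & forall t w, s e t w =
        pipelined_sched (q e t w) (ctl_path (pipelined_next mw) (f e) (q e) t w)].
  move=> sm; have [_ ev sE] := hyp e sm; split=> //; first exact: q0E.
  by apply: pipelined_dynamics => //; exact: fE.
split.
  exact: (recent_maxweight_SSC hn hmw (pipelined_recent m' mw amax) (f1 := f 0) erefl
    (q0 := q0) (f0 := f)
    hnu hnu_min harr hmean (fun=> erefl) dyn).
exact: (recent_maxweight_heavy_traffic hn hmw (pipelined_recent m' mw amax) (f1 := f 0) erefl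
    (q0 := q0) (f0 := f)
  hnu hnu_min harr hmean hvar (fun=> erefl) dyn).
Qed.
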